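(* Let $X$ be a compact Hausdorff space, let $D$ be a unital Banach algebra (with unit of norm one), let $\alpha:A\to A$ be a contractive endomorphism of $A=C(X,D)$ generating a partial dynamical system $(X,\varphi)$, and let $a\in A$. Let $\Omega\subseteq\Delta_\infty$ be any set such that $\mu(\Omega)>0$ for every $\mu\in\mathrm{Erg}(\Delta_\infty,\varphi)$. Then $$\ln r(a\alpha)=\max_{\mu\in\mathrm{Erg}(\Delta_\infty,\varphi)}\lambda_\mu(\overline\alpha\cdot\overline a\circ\varphi,\varphi)=\max_{(x,v)\in\Omega\times S}\lambda_x\big(C^b_{(\overline a\circ\varphi)^*\overline\alpha^*,\varphi},v\big),$$ where $\overline\alpha\cdot\overline a\circ\varphi$ denotes the function $\Delta\ni x\mapsto\alpha_x\overline{a}(\varphi(x))\in\mathcal{B}(D)$, $(\overline a\circ\varphi)^*\overline\alpha^*$ denotes the function $\Delta\ni x\mapsto\overline{a(\varphi(x))}^*\alpha_x^*\in\mathcal{B}(D^* )$, and $S$ is the unit sphere in $D^*$.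
   Context: For an endomorphism $\alpha$ of $C(X,D)$ put $\alpha_x(d):=\alpha(1\otimes d)(x)$ for $d\in D$, $x\in X$ (where $1\otimes d$ is the constant function $d$), and $\Delta:=\{x\in X:\alpha_x\neq0\}$ (a clopen set). One says that $\alpha$ generates the partial dynamical system $(X,\varphi)$ if $\varphi:\Delta\to X$ is continuous and $\alpha(b)(x)=\alpha_x(b(\varphi(x)))$ for $x\in\Delta$, $\alpha(b)(x)=0$ for $x\notin\Delta$, for all $b\in C(X,D)$. The weighted endomorphism $a\alpha$ is the operator $b\mapsto a\,\alpha(b)$ on $A$ and $r(a\alpha)$ is its spectral radius in $\mathcal{B}(A)$. For $d\in D$, $\overline d\in\mathcal{B}(D)$ is left multiplication, $\overline d w=dw$; $\overline a(x):=\overline{a(x)}$. Each $\alpha_x$ is regarded as an element of $\mathcal{B}(D)$, so $\alpha_x\overline a(\varphi(x))$ is the operator $d\mapsto\alpha_x(a(\varphi(x))d)$. For a partial map $\varphi:\Delta\to X$ put $\Delta_0=X$, $\Delta_n=\varphi^{-1}(\Delta_{n-1})$ for $n>0$, $\Delta_{-n}=\varphi^n(\Delta_n)$; its essential domain is $\Delta_\infty=\bigcap_{n\in\mathbb{Z}}\Delta_n$. A normalized Radon measure $\mu$ is $\varphi$-invariant if $\mu(\varphi^{-1}(\omega))=\mu(\omega)$ for every Borel $\omega$, and $\varphi$-ergodic if, in addition, $\varphi^{-1}(\omega)=\omega$ implies $\mu(\omega)\in\{0,1\}$. $\mathrm{Erg}(\Delta_\infty,\varphi)$ denotes the ergodic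 normalized Radon measures for the full map $\varphi:\Delta_\infty\to\Delta_\infty$. For a bounded function $c:\Delta\to\mathcal{B}(G)$ ($G$ a Banach space) and $x\in\Delta_n$ put $C^f_{c,\varphi}(x,n)=c(x)c(\varphi(x))\cdots c(\varphi^{n-1}(x))$ and $C^b_{c,\varphi}(x,n)=c(\varphi^{n-1}(x))\cdots c(\varphi(x))c(x)$. For $x\in\Delta_\infty$, $v\in G$: $\lambda_x(C,v)=\liminf_{n\to\infty}\frac1n\ln\|C(x,n)v\|$ (with $\ln0=-\infty$). For $\mu\in\mathrm{Erg}(\Delta_\infty,\varphi)$, the measure exponent $\lambda_\mu(c,\varphi)\in[-\infty,\infty)$ is the number (which exists by Kingman's subadditive theorem) such that $\liminf_{n\to\infty}\frac1n\ln\|C^f_{c,\varphi}(x,n)\|=\lambda_\mu(c,\varphi)$ for $\mu$-almost every $x\in\Delta_\infty$. *)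

(* Defs.v *)
From HB Require Import structures.
From mathcomp Require Import all_boot all_order all_algebra.
From mathcomp Require Import complex lra.
From mathcomp Require Import all_classical all_reals all_analysis.
Set Implicit Arguments.
Unset Strict Implicit.
Unset Printing Implicit Defensive.
Import Order.TTheory GRing.Theory Num.Theory.
Import numFieldNormedType.Exports.
Local Open Scope classical_set_scope.
Local Open Scope ring_scope.
Local Open Scope complex_scope.

(* Pointedness (that is, nonemptiness) is needed for measurable types. *)
HB.mixin Record PointedTopological_isCompactHausdorff X
    & PointedTopological X := {
  compact_space : compact [set: X];
  hausdorff_compact_space : hausdorff_space X
}.

#[short(type="compactHausdorffType")]
HB.structure Definition CompactHausdorff :=
  {X of PointedTopological X & PointedTopological_isCompactHausdorff X}.

(* The product is a separate operation because the library's ring structures and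
   normed modules have no common join below [numDomainType]. *)
HB.mixin Record NormedModule_isNormedAlgebra (K : numFieldType) D
    & NormedModule K D := {
  amul : D -> D -> D;
  aone : D;
  amulA : associative amul;
  amul1l : left_id aone amul;
  amul1r : right_id aone amul;
  amulDl : left_distributive amul +%R;
  amulDr : right_distributive amul +%R;
  amulZl : forall (k : K) (x y : D), amul (k *: x) y = k *: amul x y;
  amulZr : forall (k : K) (x y : D), amul x (k *: y) = k *: amul x y;
  norm_amul_le : forall x y : D, `|amul x y| <= `|x| * `|y|;
  norm_aone : `|aone| = 1
}.

#[short(type="normedAlgType")]
HB.structure Definition NormedAlgebra (K : numFieldType) :=
  {D of NormedModule K D & NormedModule_isNormedAlgebra K D}.

#[short(type="banachAlgType")]
HB.structure Definition BanachAlgebra (K : numFieldType) :=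
  {D of NormedAlgebra K D & CompleteNormedModule K D}.

Notation "x *b y" := (amul x y) (at level 40, left associativity) : ring_scope.

(* The norm of a [normedModType R[i]] takes its values in [R[i]]; [rnorm] is the
   same (real) number seen in [R], see [normE]. *)
Definition rnorm (R : realType) (E : normedModType R[i]) (v : E) : R :=
  complex.Re `|v|.

Section RealNorm.
Variables (R : realType) (E : normedModType R[i]).
Implicit Types u v : E.

Lemma normE v : `|v| = (rnorm v)%:C.
Proof. by rewrite /rnorm RRe_real// ger0_real. Qed.

Lemma rnorm_ge0 v : 0 <= rnorm v.
Proof. by rewrite -lecR -normE; exact: normr_ge0. Qed.

Lemma rnormD u v : rnorm (u + v) <= rnorm u + rnorm v.
Proof. by rewrite -lecR rmorphD/= -!normE ler_normD. Qed.

Lemma rnormZ (k : R[i]) v : rnorm (k *: v) = complex.Re `|k| * rnorm v.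
Proof.
rewrite {1}/rnorm normrZ normE; case: (`|k|) => x y /=.
by rewrite mulr0 subr0.
Qed.

Lemma rnorm_eq0 v : rnorm v = 0 -> v = 0.
Proof. by move=> v0; apply/normr0_eq0; rewrite normE v0. Qed.

Lemma rnorm_continuous : continuous (@rnorm R E).
Proof.
move=> v; apply/cvgrPdist_lt => e e0.
have eC0 : 0 < e%:C by rewrite ltcR.
have : \forall u \near v, `|v - u| < e%:C.
  by apply/nbhs_ballP; exists e%:C => //= u; rewrite -ball_normE.
apply: filterS => u; rewrite normE ltcR; apply: le_lt_trans.
rewrite ler_norml; apply/andP; split.
  have := rnormD (v - u) (- v).
  have -> : v - u - v = - u by rewrite addrAC subrr add0r.
  by rewrite /rnorm !normrN -/(rnorm _) -/(rnorm _) -/(rnorm _); lra.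
have := rnormD (v - u) u; rewrite subrK; lra.
Qed.
End RealNorm.

Definition continuousp (T U : topologicalType) : {pred T -> U} :=
  [pred f | `[< continuous f >]].
Arguments continuousp : clear implicits.

Definition contFun (T U : topologicalType) := {f : T -> U | f \in continuousp T U}.

HB.instance Definition _ (T U : topologicalType) :=
  SubType.on (contFun T U).

Definition contFun_fun (T U : topologicalType) (f : contFun T U) : T -> U := \val f.
Coercion contFun_fun : contFun >-> Funclass.

Section Lmod.
Variables (R : realType) (X : topologicalType) (E : normedModType R[i]).

Fact continuousp_submod : submod_closed (continuousp X E).
Proof.
split; first by apply/asboolP => x; exact: cvg_cst.
move=> k f g /asboolP fc /asboolP gc; apply/asboolP => x.
by apply: cvgD; [apply: cvgZr; exact: fc|exact: gc].
Qed.

HB.instance Definition _ :=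
  GRing.isSubmodClosed.Build _ _ (continuousp X E) continuousp_submod.
HB.instance Definition _ := [Choice of contFun X E by <:].
HB.instance Definition _ := [SubChoice_isSubLmodule of contFun X E by <:].
End Lmod.

Lemma contFun_continuous (T U : topologicalType) (f : contFun T U) :
  continuous f.
Proof. exact: asboolW (valP f). Qed.

Lemma contFunP (T U : topologicalType) (f g : contFun T U) :
  f =1 g -> f = g.
Proof. by move=> fg; apply/val_inj/funext. Qed.

Section Norm.
Variables (R : realType) (X : compactHausdorffType) (E : normedModType R[i]).
Implicit Types f g : contFun X E.

Definition sup_norm f : R := sup (range (fun x => rnorm (f x))).

Lemma sup_norm_has_sup f : has_sup (range (fun x => rnorm (f x))).
Proof.
split; first by exists (rnorm (f point)); exists point.
have : compact (range (fun x => rnorm (f x))).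
  apply: continuous_compact; last exact: compact_space.
  apply: continuous_subspaceT => x; apply: continuous_comp.
    exact: contFun_continuous.
  exact: rnorm_continuous.
move=> /compact_bounded[M [_ MP]]; exists (M + 1) => _ [x _ <-].
have /MP : M < M + 1 by rewrite ltrDl.
move=> /(_ (rnorm (f x))) h; apply: le_trans (h _); first exact: ler_norm.
by exists x.
Qed.

Lemma rnorm_le_sup_norm f x : rnorm (f x) <= sup_norm f.
Proof.
by apply: ub_le_sup; [case: (sup_norm_has_sup f)|exists x].
Qed.

Lemma sup_norm_le f (M : R) :
  (forall x, rnorm (f x) <= M) -> sup_norm f <= M.
Proof.
move=> fM; apply: ge_sup; first by case: (sup_norm_has_sup f).
by move=> _ [x _ <-]; exact: fM.
Qed.

Let normD f g : (sup_norm (f + g))%:C <= (sup_norm f)%:C + (sup_norm g)%:C.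
Proof.
rewrite -rmorphD lecR; apply: sup_norm_le => x.
by apply: (le_trans (rnormD _ _)); apply: lerD; exact: rnorm_le_sup_norm.
Qed.

Let normZ (k : R[i]) f : (sup_norm (k *: f))%:C = `|k| * (sup_norm f)%:C.
Proof.
have kE : `|k| = (complex.Re `|k|)%:C by rewrite RRe_real// ger0_real.
rewrite kE -rmorphM; congr (_%:C); apply/eqP; rewrite eq_le.
set r := complex.Re `|k|.
have r0 : 0 <= r by rewrite -lecR -kE; exact: normr_ge0.
apply/andP; split.
  apply: sup_norm_le => x; have -> : (k *: f : contFun X E) x = k *: f x by [].
  by rewrite rnormZ ler_wpM2l// rnorm_le_sup_norm.
have [->|rN0] := eqVneq r 0.
  by rewrite mul0r (le_trans (rnorm_ge0 ((k *: f : contFun X E) point)))// rnorm_le_sup_norm.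
have rp : 0 < r by rewrite lt_neqAle eq_sym rN0.
rewrite mulrC -ler_pdivlMr//; apply: sup_norm_le => x.
rewrite ler_pdivlMr// mulrC -rnormZ; exact: (rnorm_le_sup_norm (k *: f : contFun X E) x).
Qed.

Let norm_eq0 f : (sup_norm f)%:C = 0 -> f = 0.
Proof.
move=> /(@complexI R) f0; apply: contFunP => x; apply: rnorm_eq0.
by apply/eqP; rewrite eq_le rnorm_ge0 andbT -f0 rnorm_le_sup_norm.
Qed.

HB.instance Definition _ :=
  Lmodule_isNormed.Build R[i] (contFun X E) normD normZ norm_eq0.

Lemma rnorm_contFunE f : rnorm f = sup_norm f.
Proof. by []. Qed.

End Norm.

Section Mul.
Variables (R : realType) (T : topologicalType) (D : normedAlgType R[i]).

Lemma cvg_rnorm (E : normedModType R[i]) (F : set_system T) (FF : Filter F)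
    (h : T -> E) (l : E) :
  rnorm (l - h y) @[y --> F] --> (0 : R) -> h @ F --> l.
Proof.
move=> h0; apply/cvgrPdist_lt => e; rewrite ltcE/= => /andP[/eqP im0 e0].
have {}h0 := cvgr_lt _ h0 _ e0.
near=> y; rewrite normE ltcE/= im0 eqxx/=; near: y; exact: h0.
Unshelve. all: by end_near. Qed.

Lemma rnorm_amul (x y : D) : rnorm (x *b y) <= rnorm x * rnorm y.
Proof. by rewrite -lecR rmorphM/= -!normE norm_amul_le. Qed.

Lemma amulNl (x y : D) : (- x) *b y = - (x *b y).
Proof. by rewrite -scaleN1r amulZl scaleN1r. Qed.

Lemma amulNr (x y : D) : x *b (- y) = - (x *b y).
Proof. by rewrite -scaleN1r amulZr scaleN1r. Qed.

Lemma amul_continuous (f g : T -> D) :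
  continuous f -> continuous g -> continuous (fun x => f x *b g x).
Proof.
move=> fc gc x; apply: cvg_rnorm.
pose u y := rnorm (f x - f y) * rnorm (g y) + rnorm (f x) * rnorm (g x - g y).
have sub_cvg (h : T -> D) : continuous h ->
    rnorm (h x - h y) @[y --> x] --> (0 : R).
  move=> hc; have -> : (0 : R) = rnorm (h x - h x) by rewrite subrr /rnorm normr0.
  apply: (@continuous_cvg _ _ _ _ _ _ (@rnorm R D)).
    exact: rnorm_continuous.
  by apply: cvgB; [exact: cvg_cst|exact: hc].
have u0 : u y @[y --> x] --> (0 : R).
  rewrite [X in _ --> X](_ : _ = 0 * rnorm (g x) + rnorm (f x) * 0); last first.
    by rewrite mul0r mulr0 addr0.
  apply: cvgD; apply: cvgM.
  - exact: sub_cvg.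
  - by apply: (@continuous_cvg _ _ _ _ _ _ (@rnorm R D));
      [exact: rnorm_continuous|exact: gc].
  - exact: cvg_cst.
  - exact: sub_cvg.
apply: (@squeeze_cvgr _ _ _ _ (cst 0) u) => //; last exact: cvg_cst.
near=> y; rewrite rnorm_ge0/=.
have -> : f x *b g x - f y *b g y = (f x - f y) *b g y + f x *b (g x - g y).
  by rewrite amulDl amulDr amulNl amulNr [RHS]addrC subrKA.
by apply: (le_trans (rnormD _ _)); apply: lerD; exact: rnorm_amul.
Unshelve. all: by end_near. Qed.

Lemma contFun_subproof (E : topologicalType) (f : T -> E) :
  continuous f -> f \in continuousp T E.
Proof. by move=> fc; apply/asboolP. Qed.

Definition contFun_of (E : topologicalType) (f : T -> E) (fc : continuous f) :
  contFun T E := exist _ f (contFun_subproof fc).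

Definition contFun_mul (f g : contFun T D) : contFun T D :=
  contFun_of (amul_continuous (@contFun_continuous _ _ f) (@contFun_continuous _ _ g)).

Definition contFun_cst (E : topologicalType) (d : E) : contFun T E :=
  contFun_of (fun x : T => @cvg_cst E d T (nbhs x) _).

End Mul.

Section ContFunAlgebra.
Variables (R : realType) (X : compactHausdorffType) (D : normedAlgType R[i]).
Implicit Types f g h : contFun X D.

Let mulA : associative (@contFun_mul R X D).
Proof. by move=> f g h; apply: contFunP => x; exact: amulA. Qed.

Let mul1l : left_id (contFun_cst X aone) (@contFun_mul R X D).
Proof. by move=> f; apply: contFunP => x; exact: amul1l. Qed.

Let mul1r : right_id (contFun_cst X aone) (@contFun_mul R X D).
Proof. by move=> f; apply: contFunP => x; exact: amul1r. Qed.

Let mulDl : left_distributive (@contFun_mul R X D) +%R.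
Proof. by move=> f g h; apply: contFunP => x; exact: amulDl. Qed.

Let mulDr : right_distributive (@contFun_mul R X D) +%R.
Proof. by move=> f g h; apply: contFunP => x; exact: amulDr. Qed.

Let mulZl (k : R[i]) f g : contFun_mul (k *: f) g = k *: contFun_mul f g.
Proof. by apply: contFunP => x; exact: amulZl. Qed.

Let mulZr (k : R[i]) f g : contFun_mul f (k *: g) = k *: contFun_mul f g.
Proof. by apply: contFunP => x; exact: amulZr. Qed.

Let norm_mul f g : `|contFun_mul f g| <= `|f| * `|g|.
Proof.
rewrite !normE -rmorphM lecR; apply: sup_norm_le => x.
apply: (le_trans (rnorm_amul _ _)).
by apply: ler_pM; rewrite ?rnorm_ge0//; exact: rnorm_le_sup_norm.
Qed.

Let norm1 : `|contFun_cst X (aone : D)| = 1.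
Proof.
rewrite normE; congr (_%:C); have r1 : rnorm (aone : D) = 1.
  by rewrite /rnorm norm_aone.
apply/eqP; rewrite eq_le; apply/andP; split.
  by apply: sup_norm_le => x; rewrite r1.
by have := rnorm_le_sup_norm (contFun_cst X (aone : D)) point; rewrite r1.
Qed.

HB.instance Definition _ := NormedModule_isNormedAlgebra.Build R[i] (contFun X D)
  mulA mul1l mul1r mulDl mulDr mulZl mulZr norm_mul norm1.

End ContFunAlgebra.

Section Operators.
Variable R : realType.

(* Operators are plain functions; membership in B(E, F) is [bounded_op]. *)
Definition bounded_op (E F : normedModType R[i]) (T : E -> F) : Prop :=
  linear T /\ exists M : R, forall v, rnorm (T v) <= M * rnorm v.

Definition op_norm (E F : normedModType R[i]) (T : E -> F) : \bar R :=
  ereal_sup [set (rnorm (T v))%:E | v in [set v | rnorm v <= 1]].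

Definition op_spectrum (E : normedModType R[i]) (T : E -> E) : set R[i] :=
  [set z | ~ exists S : E -> E, [/\ bounded_op S,
             forall v, S (z *: v - T v) = v &
             forall v, z *: S v - T (S v) = v]].

Definition spectral_radius (E : normedModType R[i]) (T : E -> E) : \bar R :=
  ereal_sup [set (complex.Re `|z|)%:E | z in op_spectrum T].

(* On a functional [E -> R[i]^o], [op_norm] is the norm of the dual space. *)
Definition dual_sphere (E : normedModType R[i]) : set (E -> R[i]^o) :=
  [set v | bounded_op v /\ op_norm v = 1%E].

Definition adjoint (E : normedModType R[i]) (T : E -> E) (v : E -> R[i]^o) :
  E -> R[i]^o := v \o T.

(* [lne 0 = -oo]; the term of index 0 does not matter. *)
Definition exp_growth (u : nat -> \bar R) : \bar R :=
  limn_einf (fun n => ((n%:R^-1)%:E * lne (u n))%E).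

End Operators.

Arguments dual_sphere {R} E.

(* A partial map with domain [Delta] is represented by a total function [phi]
   whose values outside [Delta] are never used. *)
Section PartialMaps.
Variables (X : Type) (phi : X -> X) (Delta : set X).

Fixpoint iter_dom (n : nat) : set X :=
  if n is m.+1 then Delta `&` phi @^-1` iter_dom m else setT.

Definition domZ (n : int) : set X :=
  match n with
  | Posz m => iter_dom m
  | Negz m => iter m.+1 phi @` iter_dom m.+1
  end.

Definition essential_domain : set X := \bigcap_(n in [set: int]) domZ n.

End PartialMaps.

Section Cocycles.
Variables (X G : Type) (c : X -> G -> G) (phi : X -> X).

Fixpoint fwd_cocycle (x : X) (n : nat) : G -> G :=
  if n is m.+1 then c x \o fwd_cocycle (phi x) m else id.

Fixpoint bwd_cocycle (x : X) (n : nat) : G -> G :=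
  if n is m.+1 then bwd_cocycle (phi x) m \o c x else id.

End Cocycles.

Notation borelType X := (g_sigma_algebraType (@open X)).

Section Measures.
Variables (R : realType) (X : ptopologicalType).

Definition radon (mu : probability (borelType X) R) : Prop :=
  forall B : set (borelType X), measurable B ->
    mu B = ereal_sup [set mu K | K in [set K : set X | compact K /\ K `<=` B]].

(* Ergodic normalized Radon measures of the full map [phi : Y -> Y], [Y] closed.
   A Borel measure on the subspace [Y] is identified with the Borel measure on
   [X] that vanishes outside [Y]; the Borel sets of [Y] are then the Borel sets
   of [X] included in [Y] ([Y] itself, possibly empty, is not a pointed type). *)
Definition Erg (Y : set X) (phi : X -> X) : set (probability (borelType X) R) :=
  [set mu | [/\ radon mu,
    mu (~` Y) = 0%E,
    forall B : set (borelType X), measurable B -> B `<=` Y ->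
      mu (Y `&` phi @^-1` B) = mu B &
    forall B : set (borelType X), measurable B -> B `<=` Y ->
      Y `&` phi @^-1` B = B -> mu B = 0%E \/ mu B = 1%E]].

(* The almost sure value of the exponent. It is unique since [mu] is not zero and
   exists for ergodic [mu] on [essential_domain] by Kingman's theorem, so that
   the default value [-oo] is not used. *)
Definition measure_exponent (E : normedModType R[i]) (Y : set X)
    (c : X -> E -> E) (phi : X -> X) (mu : probability (borelType X) R) :
    \bar R :=
  xget -oo%E [set l | {ae mu, forall x : borelType X, Y x ->
    exp_growth (fun n => op_norm (fwd_cocycle c phi x n)) = l}].

End Measures.

(* [m] is the maximum of [S], with the convention that [max set0 = -oo]. *)
Definition is_max (R : realType) (S : set (\bar R)) (m : \bar R) : Prop :=
  (S m /\ ubound S m) \/ (S = set0 /\ m = -oo%E).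

Section WeightedEndomorphisms.
Variables (R : realType) (X : compactHausdorffType) (D : banachAlgType R[i]).
Variable alpha : contFun X D -> contFun X D.

(* The map written $\alpha_x$, and the set $\Delta$ of points where it is nonzero. *)
Definition fiber (x : X) (d : D) : D := alpha (contFun_cst X d) x.

Definition fiber_support : set X := [set x | fiber x <> (fun _ => 0)].

Definition generates (phi : X -> X) : Prop :=
  [/\ {within fiber_support, continuous phi},
      forall b x, fiber_support x -> alpha b x = fiber x (b (phi x)) &
      forall b x, ~ fiber_support x -> alpha b x = 0].

Definition weighted (a : contFun X D) (b : contFun X D) : contFun X D :=
  a *b alpha b.

Definition lmul (d w : D) : D := d *b w.

End WeightedEndomorphisms.

(* Main.v *)
(* Write [V b = alpha (a b)] and [P n x = |(V^n 1)(x)|]. Since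
   [V^n b = (V^n 1) (alpha^n b)], the function [P n x] is the norm of the forward
   cocycle at [x], it vanishes outside [iter_dom n], and it is submultiplicative
   along the orbits. The spectral radius is the growth rate [rho] of
   [sup_x P n x] (Gelfand's formula, by averaging the resolvent over roots of
   unity), so that no exponent exceeds [ln rho].

   When [rho > 0], normalize [P] to [rho = 1]. An extreme point among the
   linear functionals on [C(X, R)] below a sublinear functional expressing
   maximal growth is, by the Riesz representation theorem, an ergodic measure
   carried by the essential domain. By maximality and the covering argument of
   Katznelson and Weiss, [P n x] decays subexponentially at almost every [x].
   This is the first maximum. Such a point exists in [Omega], and at this point a
   gliding hump construction yields a functional [v] that sees the growth of the
   cocycle at the times [k ^ 2], hence at all times; this is the second one. *)
Require Import Defs.
From HB Require Import structures.
From mathcomp Require Import all_boot all_order all_algebra.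
From mathcomp Require Import complex finmap lra ring.
From mathcomp Require Import all_classical all_reals all_analysis.
From mathcomp Require Import measurable_realfun.
Set Implicit Arguments.
Unset Strict Implicit.
Unset Printing Implicit Defensive.
Import Order.TTheory GRing.Theory Num.Theory.
Import numFieldNormedType.Exports.
Local Open Scope classical_set_scope.
Local Open Scope ring_scope.
Local Open Scope complex_scope.

(** * Extreme linear functionals *)

(** The cocycle may vanish, so that [ln (P n x)] has no finite value everywhere: maximal growth is
    expressed by inequalities that are tested only where [0 < P n x]. Their best constants form a
    sublinear functional, and extremality among its linear minorants yields ergodicity only because
    the two normalized pieces of such a minorant along an invariant set are minorants again; this is
    the point of [below_tangent_face]. Neither Kingman's theorem nor an ergodic decomposition is
    invoked, since the lower bound on the growth is obtained directly at almost every point.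

    The humps have weights [3 ^ - (k + 1)]. One hump for each time [n] would lower the exponent by
    [ln 3]; placed at the times [k ^ 2], they cost only [O(sqrt n)] in the logarithm.

    In Gelfand's formula, the averages over roots of unity stand in for the holomorphy of the
    resolvent: an average of errors is no larger than the largest of them, so two circles are
    compared with a bound that does not depend on the number of roots. *)

Section ExtremeFunctional.
Variables (R : realType) (K : nzRingType) (iota : {rmorphism R -> K}).
Variables (V : lmodType K) (S : set V).
Hypotheses (S0 : S 0) (SD : forall u v, S u -> S v -> S (u + v)).
Hypothesis (SZ : forall t u, S u -> S (iota t *: u)).

(** Scalars are real and act through [iota], and only the vectors of [S] count. This covers both the
    continuous functions among all the functions [X -> R] and a complex normed space seen as a real
    one. *)
Definition sublinear_on (p : V -> R) :=
  (forall u v, S u -> S v -> p (u + v) <= p u + p v) /\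
  (forall t u, S u -> 0 <= t -> p (iota t *: u) = t * p u).

Definition linear_on (L : V -> R) :=
  (forall u v, S u -> S v -> L (u + v) = L u + L v) /\
  (forall t u, S u -> L (iota t *: u) = t * L u).

Definition le_on (f g : V -> R) := forall u, S u -> f u <= g u.

(* The sublinear functional [q] stands for the closed convex set of the linear
   functionals below it; [q] is a face of [p] when this set is a face of the
   one of [p]. *)
Definition face (p q : V -> R) :=
  [/\ sublinear_on q, le_on q p &
      forall t A B, 0 < t < 1 -> linear_on A -> linear_on B ->
        le_on A p -> le_on B p ->
        le_on (fun u => t * A u + (1 - t) * B u) q -> le_on A q /\ le_on B q].

Lemma SN u : S u -> S (- u).
Proof. by move=> Su; rewrite -scaleN1r -(rmorphN1 iota); exact: SZ. Qed.

Lemma sublinear_on0 p : sublinear_on p -> p 0 = 0.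
Proof.
by case=> _ pZ; have := pZ 0 0 S0 (lexx _); rewrite rmorph0 scale0r mul0r.
Qed.

Lemma sublinear_onN p u : sublinear_on p -> S u -> - p (- u) <= p u.
Proof.
move=> sp Su; have := sublinear_on0 sp; case: sp => pD _ p0.
by have := pD _ _ Su (SN Su); rewrite subrr p0; lra.
Qed.

Lemma linear_onN L u : linear_on L -> S u -> L (- u) = - L u.
Proof.
by case=> _ LZ Su; rewrite -[in LHS](scale1r u) -scaleNr -(rmorphN1 iota) LZ// mulN1r.
Qed.

(* The face of the functionals below [q] that are maximal at [g]. *)
Definition exposed (q : V -> R) (g f : V) : R :=
  inf [set q (f + iota t *: g) - t * q g | t in [set t | 0 <= t]].

Section Exposed.
Variables (q : V -> R) (g : V).
Hypotheses (sq : sublinear_on q) (Sg : S g).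

Lemma exposed_lbound f : S f ->
  lbound [set q (f + iota t *: g) - t * q g | t in [set t | 0 <= t]] (- q (- f)).
Proof.
move=> Sf _ [t /= t0 <-]; case: sq => qD qZ.
have := qD _ _ (SD Sf (SZ t Sg)) (SN Sf); rewrite addrAC subrr add0r qZ//; lra.
Qed.

Lemma exposed_le f t : S f -> 0 <= t ->
  exposed q g f <= q (f + iota t *: g) - t * q g.
Proof.
move=> Sf t0; apply: ge_inf; first by exists (- q (- f)); exact: exposed_lbound.
by exists t.
Qed.

Lemma exposed_ge f c : S f ->
  (forall t, 0 <= t -> c <= q (f + iota t *: g) - t * q g) -> c <= exposed q g f.
Proof.
move=> Sf H; apply: lb_le_inf; last by move=> _ [t /= t0 <-]; exact: H.
by exists (q (f + iota 0 *: g) - 0 * q g); exists 0 => /=.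
Qed.

Lemma exposed_le_id : le_on (exposed q g) q.
Proof.
move=> f Sf; have := exposed_le Sf (lexx 0).
by rewrite rmorph0 scale0r addr0 mul0r subr0.
Qed.

(** Together with [exposed_le_id], this forces every linear functional below [exposed q g] to take
    the value [q g] at [g]. *)
Lemma exposedN : exposed q g (- g) <= - q g.
Proof.
have := exposed_le (SN Sg) ler01.
by rewrite rmorph1 scale1r addNr (sublinear_on0 sq) mul1r sub0r.
Qed.

Lemma exposed_sublinear : sublinear_on (exposed q g).
Proof.
case: (sq) => qD qZ; split=> [u v Su Sv|t u Su].
- rewrite -lerBlDl; apply: exposed_ge => // t t0; rewrite lerBlDl -lerBlDr.
  apply: exposed_ge => // s s0; rewrite lerBlDr.
  apply: le_trans (exposed_le (SD Su Sv) (addr_ge0 s0 t0)) _.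
  have := qD _ _ (SD Su (SZ s Sg)) (SD Sv (SZ t Sg)).
  by rewrite addrACA -scalerDl -rmorphD; lra.
- rewrite le_eqVlt => /predU1P[<-|t0].
    rewrite rmorph0 scale0r mul0r; apply/eqP; rewrite eq_le.
    apply/andP; split; first by rewrite -[leRHS](sublinear_on0 sq) exposed_le_id.
    by apply: exposed_ge => // s s0; rewrite add0r qZ// subrr.
  apply/eqP; rewrite eq_le; apply/andP; split.
    rewrite -ler_pdivrMl//; apply: exposed_ge => // s s0; rewrite ler_pdivrMl//.
    apply: le_trans (exposed_le (SZ t Su) (mulr_ge0 (ltW t0) s0)) _.
    rewrite rmorphM -scalerA -scalerDr qZ ?(ltW t0)//; last by apply: SD => //; exact: SZ.
    by rewrite mulrBr mulrA.
  apply: exposed_ge; first exact: SZ.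
  move=> s s0; rewrite -ler_pdivlMl//.
  have s'0 : 0 <= t^-1 * s by rewrite mulr_ge0// invr_ge0 ltW.
  apply: le_trans (exposed_le Su s'0) _; rewrite ler_pdivlMl//.
  rewrite mulrBr !mulrA mulfV ?gt_eqF// mul1r -(qZ t) ?(ltW t0)//;
    last by apply: SD => //; exact: SZ.
  by rewrite scalerDr scalerA -rmorphM mulrA mulfV ?gt_eqF// mul1r.
Qed.

End Exposed.

(** Since [q] is a face, [A] and [B] lie below [q]; neither exceeds [q g] at [g], while their convex
    combination reaches it, so both reach it. A linear [L] below [q] with [L g = q g] satisfies
    [L f = L (f + s g) - s (q g)], hence lies below [exposed q g]. *)
Lemma exposed_face p q g : S g -> face p q -> face p (exposed q g).
Proof.
move=> Sg [sq qp fq]; split; first exact: exposed_sublinear.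
  by move=> u Su; exact: le_trans (exposed_le_id _ _ _) (qp _ Su).
move=> t A B t01 lA lB Ap Bp ABq.
have [Aq Bq] : le_on A q /\ le_on B q.
  apply: (fq t) => // u Su; apply: le_trans (ABq _ Su) _; exact: exposed_le_id.
have [t0 t1] := andP t01.
have ABg : t * A (- g) + (1 - t) * B (- g) <= - q g.
  exact: le_trans (ABq _ (SN Sg)) (exposedN sq Sg).
have [EA EB] : A g = q g /\ B g = q g.
  move: ABg (Aq _ Sg) (Bq _ Sg); rewrite !linear_onN//.
  move: (A g) (B g) (q g) => x y z H1 H2 H3.
  have t'0 : 0 < 1 - t by lra.
  have h1 : 0 <= t * (z - x) by apply: mulr_ge0; lra.
  have h2 : 0 <= (1 - t) * (z - y) by apply: mulr_ge0; lra.
  have h3 : t * (z - x) = 0 by lra.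
  have h4 : (1 - t) * (z - y) = 0 by lra.
  have e1 : z - x = 0 by apply: (mulfI (lt0r_neq0 t0)); rewrite mulr0.
  have e2 : z - y = 0 by apply: (mulfI (lt0r_neq0 t'0)); rewrite mulr0.
  by split; lra.
have key (L : V -> R) : linear_on L -> le_on L q -> L g = q g -> le_on L (exposed q g).
  move=> [LD LZ] Lq Lg f Sf; apply: exposed_ge => // s s0.
  have := Lq _ (SD Sf (SZ s Sg)); rewrite LD ?LZ ?Lg//; last exact: SZ.
  by lra.
by split; exact: key.
Qed.

Section Chain.
Variables (p : V -> R) (F : set (V -> R)).
Hypotheses (Fp : F `<=` face p) (F0 : F !=set0).
Hypothesis Ftot : total_on F (fun f g => le_on g f).

Let q u := inf [set f u | f in F].

Let q_le f u : F f -> S u -> q u <= f u.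
Proof.
move=> Ff Su; apply: ge_inf; last by exists f.
exists (- p (- u)) => _ [h Fh <-]; have [sh hp _] := Fp Fh.
by apply: le_trans (sublinear_onN sh Su); rewrite lerN2 hp//; exact: SN.
Qed.

Let q_ge c u : (forall f, F f -> c <= f u) -> c <= q u.
Proof.
move=> H; apply: lb_le_inf; last by move=> _ [h Fh <-]; exact: H.
by case: F0 => f Ff; exists (f u); exists f.
Qed.

(** The pointwise infimum works. Its subadditivity uses that [F] is a chain: of two members chosen
    for [u] and for [v], the smaller one serves both. *)
Lemma chain_face : exists2 r, face p r & forall f, F f -> le_on r f.
Proof.
exists q; last by move=> f Ff u Su; exact: q_le.
split.
- split=> [u v Su Sv|t u Su].
    rewrite -lerBlDl; apply: q_ge => f Ff; rewrite lerBlDl -lerBlDr.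
    apply: q_ge => h Fh; rewrite lerBlDr.
    have [[fD _] _ _] := Fp Ff; have [[hD _] _ _] := Fp Fh.
    have [hf|fh] := Ftot Ff Fh.
      apply: le_trans (q_le Fh (SD Su Sv)) _.
      by apply: le_trans (hD _ _ Su Sv) _; rewrite lerD2l hf.
    apply: le_trans (q_le Ff (SD Su Sv)) _.
    by apply: le_trans (fD _ _ Su Sv) _; rewrite lerD2r fh.
  rewrite le_eqVlt => /predU1P[<-|t0].
    rewrite rmorph0 scale0r mul0r; apply/eqP; rewrite eq_le; apply/andP; split.
      case: F0 => f Ff; have [sf _ _] := Fp Ff.
      by rewrite -(sublinear_on0 sf) q_le.
    by apply: q_ge => f Ff; have [sf _ _] := Fp Ff; rewrite (sublinear_on0 sf).
  apply/eqP; rewrite eq_le; apply/andP; split.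
    rewrite -ler_pdivrMl//; apply: q_ge => f Ff; rewrite ler_pdivrMl//.
    by have [[_ fZ] _ _] := Fp Ff; rewrite -fZ ?(ltW t0)// q_le//; exact: SZ.
  apply: q_ge => f Ff; have [[_ fZ] _ _] := Fp Ff.
  by rewrite fZ ?(ltW t0)// ler_pM2l// q_le.
- case: F0 => f Ff u Su; have [_ fp _] := Fp Ff.
  exact: le_trans (q_le Ff Su) (fp _ Su).
- move=> t A B t01 lA lB Ap Bp ABq.
  have H f : F f -> le_on A f /\ le_on B f.
    move=> Ff; have [_ _ ff] := Fp Ff; apply: (ff t) => // u Su.
    exact: le_trans (ABq _ Su) (q_le Ff Su).
  by split=> u Su; apply: q_ge => f Ff; have [Af Bf] := H _ Ff; [exact: Af|exact: Bf].
Qed.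

End Chain.

(** Zorn's lemma gives a minimal face [q]. It cannot be cut further by [exposed], which makes it
    linear; a face reduced to a single functional is an extreme point. This contains the Hahn-Banach
    theorem and the part of the Krein-Milman theorem used later, without a topology on the
    functionals. *)
Theorem exists_extreme_le (p : V -> R) : sublinear_on p ->
  exists L, [/\ linear_on L, le_on L p &
    forall t A B, 0 < t < 1 -> linear_on A -> linear_on B ->
      le_on A p -> le_on B p ->
      (forall u, S u -> L u = t * A u + (1 - t) * B u) ->
      forall u, S u -> A u = L u].
Proof.
move=> sp.
have pp : face p p by split.
pose T := {q | face p q}.
pose r (f g : T) := `[< le_on (sval g) (sval f) >].
have [||A Atot|[q fq] qmax] := @ZL_preorder T (exist _ p pp) r.
- by move=> f; apply/asboolP => u.
- move=> f g h /asboolP h1 /asboolP h2; apply/asboolP => u Su.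
  exact: le_trans (h2 _ Su) (h1 _ Su).
- have [->|/set0P[f0 Af0]] := eqVneq A set0; first by exists (exist _ p pp).
  have [|||q fq qA] := @chain_face p [set sval f | f in A].
  + by move=> _ [f _ <-]; exact: (svalP f).
  + by exists (sval f0); exists f0.
  + move=> _ _ [f Af <-] [g Ag <-].
    by have [/asboolP|/asboolP] := Atot _ _ Af Ag; [left|right].
  by exists (exist _ q fq) => f Af; apply/asboolP; apply: qA; exists f.
have [sq qp qface] := fq.
have qN g : S g -> q (- g) = - q g.
  move=> Sg.
  have /qmax/asboolP/(_ _ (SN Sg)) : r (exist _ q fq) (exist _ _ (exposed_face Sg fq)).
    by apply/asboolP; exact: exposed_le_id.
  move=> /= /le_trans/(_ (exposedN sq Sg)) h.
  by have := sublinear_onN sq (SN Sg); rewrite opprK; lra.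
have lq : linear_on q.
  case: (sq) => qD qZ; split=> [u v Su Sv|t u Su].
    have := qD _ _ Su Sv; have := qD _ _ (SN Su) (SN Sv).
    by rewrite -opprD !qN//; [lra|exact: SD].
  have [t0|t0] := leP 0 t; first exact: qZ.
  have /(qZ (- t) _ Su) : 0 <= - t by lra.
  by rewrite rmorphN scaleNr qN; [lra|exact: SZ].
(* A linear functional below a linear one equals it, by comparison at [u] and at [- u]. *)
have le_eq A : linear_on A -> le_on A q -> forall u, S u -> A u = q u.
  move=> lA Aq u Su; have := Aq _ Su; have := Aq _ (SN Su).
  by rewrite qN// linear_onN//; lra.
exists q; split => // t A B t01 lA lB Ap Bp qAB; apply: le_eq => //.
by have [|] := qface t A B t01 lA lB Ap Bp; first by move=> u Su; rewrite -qAB.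
Qed.

End ExtremeFunctional.

(** * Riesz representation *)

Section ContinuousReal.
Variables (R : realType) (X : topologicalType).
Implicit Types f g : X -> R.

Lemma continuousRD f g : continuous f -> continuous g -> continuous (f + g).
Proof. by move=> cf cg x; apply: cvgD; [exact: cf|exact: cg]. Qed.

Lemma continuousRZ (k : R) f : continuous f -> continuous (k *: f).
Proof. by move=> cf x; apply: cvgZr; exact: cf. Qed.

Lemma continuousRN f : continuous f -> continuous (- f).
Proof. by move=> cf x; apply: cvgN; exact: cf. Qed.

Lemma continuousRM f g : continuous f -> continuous g -> continuous (f * g).
Proof. by move=> cf cg x; apply: cvgM; [exact: cf|exact: cg]. Qed.

Lemma continuousR_cst (k : R) : continuous (cst k : X -> R).
Proof. by move=> x; exact: cvg_cst. Qed.

Lemma continuousR_max f g : continuous f -> continuous g -> continuous (f \max g).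
Proof. by move=> cf cg x; apply: continuous_max; [exact: cf|exact: cg]. Qed.

Lemma continuousR_min f g : continuous f -> continuous g -> continuous (f \min g).
Proof. by move=> cf cg x; apply: continuous_min; [exact: cf|exact: cg]. Qed.

Lemma closed_ge_continuous f (c : R) : continuous f -> closed [set x | c <= f x].
Proof.
move=> cf; rewrite (_ : [set x | _] = f @^-1` [set r | c <= r])//.
by apply: closed_comp => [x _|]; [exact: cf|exact: closed_ge].
Qed.

Lemma open_gt_continuous f (c : R) : continuous f -> open [set x | c < f x].
Proof.
move=> cf; rewrite (_ : [set x | _] = f @^-1` [set r | c < r])//.
by apply: open_comp => [x _|]; [exact: cf|exact: open_gt].
Qed.

End ContinuousReal.

(** * The outer measure of a positive normalized functional *)

Section Means.
Variables (R : realType) (X : compactHausdorffType).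
Implicit Types (f g : X -> R) (A O K : set X) (L : (X -> R) -> R).

Definition mean L :=
  [/\ linear_on (idfun : {rmorphism R -> R}) [set f : X -> R | continuous f] L,
      forall f, continuous f -> (forall x, 0 <= f x) -> 0 <= L f &
      L (cst 1) = 1].

Lemma separating_function A B : closed A -> closed B -> A `&` B = set0 ->
  exists f, [/\ continuous f, forall x, 0 <= f x <= 1,
    forall x, A x -> f x = 0 & forall x, B x -> f x = 1].
Proof.
move=> cA cB AB.
have nX : normal_space X.
  apply: compact_normal; [exact: hausdorff_compact_space|exact: compact_space].
have us := normal_uniform_separator nX cA cB AB.
exists (Urysohn A B); split.
- exact: Urysohn_continuous.
- move=> x; have : range (@Urysohn X R A B) (Urysohn A B x) by exists x.
  by move=> /Urysohn_range; rewrite /= in_itv.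
- move=> x Ax; have := Urysohn_sub0 (R := R) us; apply.
  by exists x.
- move=> x Bx; have := Urysohn_sub1 (R := R) us; apply.
  by exists x.
Qed.

Section MeanTheory.
Variables (L : (X -> R) -> R) (mL : mean L).

Lemma meanD f g : continuous f -> continuous g -> L (f + g) = L f + L g.
Proof. by case: mL => -[LD _] _ _; exact: LD. Qed.

Lemma meanZ (k : R) f : continuous f -> L (k *: f) = k * L f.
Proof. by case: mL => -[_ LZ] _ _; exact: LZ. Qed.

Lemma meanN f : continuous f -> L (- f) = - L f.
Proof. by move=> cf; rewrite -scaleN1r meanZ// mulN1r. Qed.

Lemma mean_cst (k : R) : L (cst k) = k.
Proof.
have -> : cst k = k *: (cst 1 : X -> R) by apply/funext => x; rewrite /cst fctE [RHS]mulr1.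
by case: (mL) => _ _ L1; rewrite meanZ ?L1 ?mulr1//; exact: continuousR_cst.
Qed.

Lemma mean_le f g : continuous f -> continuous g -> (forall x, f x <= g x) ->
  L f <= L g.
Proof.
move=> cf cg fg; rewrite -subr_ge0 -meanN// -meanD//; last exact: continuousRN.
case: mL => _ L0 _; apply: L0; last by move=> x; rewrite fctE subr_ge0.
by apply: continuousRD => //; exact: continuousRN.
Qed.

(** The functions vanish outside [O] but need not have compact support inside it. Compactness is
    recovered from [trunc e], which vanishes off the compact set [{e <= f}] and lowers the mean by
    at most [e]. *)
Definition below O : set (X -> R) :=
  [set f : X -> R | [/\ continuous f, forall x, 0 <= f x <= 1 & forall x, ~ O x -> f x = 0]].

Definition open_mass O : \bar R := ereal_sup [set (L f)%:E | f in below O].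

Local Open Scope ereal_scope.

Lemma open_mass_ge O f : below O f -> (L f)%:E <= open_mass O.
Proof. by move=> Of; apply: ereal_sup_ubound; exists f. Qed.

Lemma open_mass_le O c : (forall f, below O f -> (L f)%:E <= c) -> open_mass O <= c.
Proof. by move=> H; apply: ge_ereal_sup => _ [f Of <-]; exact: H. Qed.

Lemma below0 O : below O (cst 0%R).
Proof. by split=> [|x|//]; [exact: continuousR_cst|rewrite lexx ler01]. Qed.

Lemma open_mass_ge0 O : 0 <= open_mass O.
Proof. by rewrite -[0](congr1 EFin (mean_cst 0)) open_mass_ge//; exact: below0. Qed.

Lemma open_mass_le1 O : open_mass O <= 1.
Proof.
apply: open_mass_le => f [cf f01 _]; rewrite lee_fin -(mean_cst 1).
by apply: mean_le => // [|x]; [exact: continuousR_cst|case/andP: (f01 x)].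
Qed.

Lemma open_mass_fin O : open_mass O \is a fin_num.
Proof.
by rewrite ge0_fin_numE ?open_mass_ge0// (le_lt_trans (open_mass_le1 O))// ltry.
Qed.

Lemma open_mass_sub A B : A `<=` B -> open_mass A <= open_mass B.
Proof.
move=> AB; apply: open_mass_le => f [cf f01 f0]; apply: open_mass_ge; split => // x Bx.
by apply: f0 => /AB.
Qed.

Lemma open_mass0 : open_mass set0 = 0.
Proof.
apply/eqP; rewrite eq_le open_mass_ge0 andbT; apply: open_mass_le => f [cf f01 f0].
have -> : f = cst 0%R by apply/funext => x; exact: f0.
by rewrite mean_cst.
Qed.

Definition trunc (e : R) f : X -> R := ((f - cst e) \max cst 0)%R.

Lemma trunc_continuous e f : continuous f -> continuous (trunc e f).
Proof.
move=> cf; apply: continuousR_max; last exact: continuousR_cst.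
by apply: continuousRD => //; apply: continuousRN; exact: continuousR_cst.
Qed.

Lemma truncE e f x : (trunc e f x = Num.max (f x - e) 0)%R.
Proof. by []. Qed.

Lemma mean_trunc e f : continuous f -> (L f <= L (trunc e f) + e)%R.
Proof.
move=> cf.
have -> : (L (trunc e f) + e)%R = L (trunc e f + cst e)%R.
  by rewrite meanD ?mean_cst//; [exact: trunc_continuous|exact: continuousR_cst].
apply: mean_le => // [|x].
  apply: continuousRD; [exact: trunc_continuous|exact: continuousR_cst].
by rewrite fctE truncE /cst; case: (ltP (f x - e)%R 0%R) => h; lra.
Qed.

Lemma trunc_range e f : (0 < e)%R -> (forall x, 0 <= f x <= 1)%R ->
  forall x, (0 <= trunc e f x <= 1)%R.
Proof.
by move=> e0 f01 x; have := f01 x; rewrite truncE; case: (ltP (f x - e)%R 0%R) => h; lra.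
Qed.

Lemma trunc_eq0 e f x : (f x <= e)%R -> trunc e f x = 0%R.
Proof. by move=> fe; rewrite truncE; case: (ltP (f x - e)%R 0%R) => h; lra. Qed.

(* The part of [f] outside the compact set [{f >= e} \ O1] is cut off by an
   Urysohn function, which splits [f] between [O1] and [O2]. *)
Lemma open_massU A B : open A -> open B ->
  open_mass (A `|` B) <= open_mass A + open_mass B.
Proof.
move=> oA oB; apply: open_mass_le => f [cf f01 f0].
apply/lee_addgt0Pr => e e0.
pose K := [set x | (e <= f x)%R] `&` ~` A.
have cK : closed K.
  by apply: closedI; [exact: closed_ge_continuous|exact: open_closedC].
have [|h [ch h01 h0 h1]] := separating_function (open_closedC oB) cK.
  rewrite -subset0 => x [Bx [/= fx Ax]]; have : (f x = 0)%R by apply: f0 => -[].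
  lra.
have -> : open_mass A + open_mass B + e%:E = (open_mass A + open_mass B) + e%:E by [].
apply: (@le_trans _ _ ((L (trunc e f * (cst 1 - h)) + L (trunc e f * h))%:E + e%:E)).
  rewrite -EFinD lee_fin; apply: le_trans (mean_trunc e cf) _; rewrite lerD2r.
  rewrite -meanD.
  - by rewrite -mulrDr subrK mulr1.
  - apply: continuousRM; first exact: trunc_continuous.
    by apply: continuousRD; [exact: continuousR_cst|exact: continuousRN].
  - by apply: continuousRM => //; exact: trunc_continuous.
rewrite leeD2r// EFinD leeD//; apply: open_mass_ge; split.
- apply: continuousRM; first exact: trunc_continuous.
  by apply: continuousRD; [exact: continuousR_cst|exact: continuousRN].
- move=> x; rewrite !fctE /=; have /andP[t0 t1] := trunc_range e0 f01 x.
  have /andP[g0 g1] := h01 x; apply/andP; split.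
    by apply: mulr_ge0 => //; lra.
  by apply: mulr_ile1 => //; lra.
- move=> x Ax; rewrite !fctE /=; have [fx|fx] := leP (f x) e.
    by rewrite trunc_eq0// mul0r.
  by rewrite h1 ?subrr ?mulr0//; split => //=; exact: ltW.
- by apply: continuousRM => //; exact: trunc_continuous.
- move=> x; rewrite !fctE /=; have /andP[t0 t1] := trunc_range e0 f01 x.
  have /andP[g0 g1] := h01 x; apply/andP; split; first by apply: mulr_ge0.
  exact: mulr_ile1.
- by move=> x Bx; rewrite !fctE /= h0// mulr0.
Qed.

(** The compact set [{e <= f}] is covered by finitely many of the [F n], so [trunc e f] is below a
    finite union, where [open_massU] applies. *)
Lemma open_mass_bigcup (F : (set X)^nat) : (forall n, open (F n)) ->
  open_mass (\bigcup_n F n) <= \sum_(n <oo) open_mass (F n).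
Proof.
move=> oF.
have fin n : open_mass (\bigcup_(i < n) F i) <= \sum_(0 <= i < n) open_mass (F i).
  elim: n => [|n IH]; first by rewrite big_nil bigcup_mkord big_ord0 open_mass0.
  rewrite bigcup_mkord big_ord_recr/= big_nat_recr//= -bigcup_mkord.
  apply: le_trans (open_massU _ (oF n)) _; last exact: leeD2r.
  by apply: bigcup_open.
apply: open_mass_le => f [cf f01 f0]; apply/lee_addgt0Pr => e e0.
have cK : compact [set x | (e <= f x)%R].
  apply: (subclosed_compact (closed_ge_continuous cf) compact_space) => //.
have : cover_compact [set x | (e <= f x)%R] by rewrite -compact_cover.
move=> /(_ nat setT F (fun i _ => oF i)) [|D _ KD].
  move=> x /= ex; have [//|nF] := pselect ((\bigcup_n F n) x).
  by have := f0 _ nF; lra.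
have [n Dn] : exists n, forall i, [set` D] i -> (i < n)%N.
  exists (\max_(i <- finmap.enum_fset D) i).+1 => i iD.
  by rewrite ltnS; apply: (@leq_bigmax_seq _ (finmap.enum_fset D) xpredT id).
apply: (@le_trans _ _ ((L (trunc e f))%:E + e%:E)).
  by rewrite -EFinD lee_fin; exact: mean_trunc.
rewrite leeD2r//; apply: (@le_trans _ _ (open_mass (\bigcup_(i < n) F i))).
  apply: open_mass_ge; split.
  - exact: trunc_continuous.
  - exact: trunc_range.
  - move=> x nF; apply: trunc_eq0; rewrite leNgt; apply/negP => /ltW /KD [i /= iD Fi].
    by apply: nF; exists i => //=; exact: Dn.
apply: le_trans (fin n) _; apply: nneseries_lim_ge => i _ _.
exact: open_mass_ge0.
Qed.

Definition outer_mass A : \bar R :=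
  ereal_inf [set open_mass O | O in [set O | open O /\ A `<=` O]].

Lemma outer_mass_le A O : open O -> A `<=` O -> outer_mass A <= open_mass O.
Proof. by move=> oO AO; apply: ereal_inf_lbound; exists O. Qed.

Lemma outer_mass_ge A c :
  (forall O, open O -> A `<=` O -> c <= open_mass O) -> c <= outer_mass A.
Proof. by move=> H; apply: le_ereal_inf_tmp => _ [U [hU AU] <-]; exact: H. Qed.

Lemma outer_mass_open O : open O -> outer_mass O = open_mass O.
Proof.
move=> oO; apply/eqP; rewrite eq_le outer_mass_le//=.
by apply: outer_mass_ge => U _; exact: open_mass_sub.
Qed.

Lemma outer_mass0 : outer_mass set0 = 0.
Proof. by rewrite outer_mass_open ?open_mass0//; exact: open0. Qed.

Lemma outer_mass_ge0 A : 0 <= outer_mass A.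
Proof. by apply: outer_mass_ge => *; exact: open_mass_ge0. Qed.

Lemma outer_mass_sub A B : A `<=` B -> outer_mass A <= outer_mass B.
Proof.
move=> AB; apply: outer_mass_ge => O oO BO.
by apply: outer_mass_le => //; exact: subset_trans BO.
Qed.

Lemma outer_mass_le1 A : outer_mass A <= 1.
Proof. by apply: le_trans (outer_mass_le openT _) (open_mass_le1 _). Qed.

Lemma outer_mass_fin A : outer_mass A \is a fin_num.
Proof.
by rewrite ge0_fin_numE ?outer_mass_ge0// (le_lt_trans (outer_mass_le1 A))// ltry.
Qed.

Lemma outer_mass_approx A (e : R) : (0 < e)%R ->
  exists O, [/\ open O, A `<=` O & open_mass O <= outer_mass A + e%:E].
Proof.
move=> e0; have [_ [U [hU AU] <-]] := lb_ereal_inf_adherent e0 (outer_mass_fin A).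
by move=> /ltW h; exists U.
Qed.

Lemma outer_mass_sigma_subadditive : sigma_subadditive outer_mass.
Proof.
move=> F; apply/lee_addgt0Pr => e e0.
have /choice[U HU] : forall n, exists U, [/\ open U, F n `<=` U &
    open_mass U <= outer_mass (F n) + (e / (2 ^ n.+1)%:R)%:E].
  by move=> n; apply: outer_mass_approx; rewrite divr_gt0// ltr0n expn_gt0.
apply: (@le_trans _ _ (open_mass (\bigcup_n U n))).
  apply: outer_mass_le; first by apply: bigcup_open => n _; case: (HU n).
  by apply: subset_bigcup => n _; case: (HU n).
apply: le_trans (open_mass_bigcup _) _; first by move=> n; case: (HU n).
apply: le_trans (epsilon_trick _ _ (ltW e0)); last by move=> n; exact: outer_mass_ge0.
apply: lee_nneseries => n _; first by move=> _; exact: open_mass_ge0.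
by case: (HU n).
Qed.

HB.instance Definition _ := isOuterMeasure.Build R X outer_mass outer_mass0
  outer_mass_ge0 outer_mass_sub outer_mass_sigma_subadditive.

(** Let [f] be below [V & O], and [g] below [W], the part of [V] where [f < d]; [W] contains [V]
    minus [O] because [f] vanishes there. The functions [trunc d f] and [g] are never both nonzero,
    so their sum is still below [V], and it loses at most [d] on the mean of [f]. *)
Lemma open_caratheodory O : open O -> outer_mass.-caratheodory O.
Proof.
move=> oO; apply: le_caratheodory_measurable => E.
apply: outer_mass_ge => V oV EV.
have oVO : open (V `&` O) by exact: openI.
apply/lee_addgt0Pr => e e0.
apply: (@le_trans _ _ (open_mass (V `&` O) + outer_mass (V `\` O))).
  apply: leeD; first by apply: outer_mass_le => //; exact: setSI.
  by apply: outer_mass_sub => x [/EV Vx Ox].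
rewrite -leeBrDr ?outer_mass_fin//; apply: open_mass_le => f [cf f01 f0].
pose d := (e / 2)%R; have d0 : (0 < d)%R by rewrite divr_gt0.
rewrite leeBrDr ?outer_mass_fin//.
pose W := V `&` [set x | (f x < d)%R].
have oW : open W.
  apply: openI => //; rewrite (_ : [set x | _] = f @^-1` [set r | r < d]%R)//.
  by apply: open_comp => [x _|]; [exact: cf|exact: open_lt].
have VW : V `\` O `<=` W.
  by move=> x [Vx Ox]; split => //=; rewrite f0// => -[].
apply: (@le_trans _ _ ((L f)%:E + open_mass W)).
  by rewrite leeD2l// outer_mass_le.
rewrite -leeBrDl ?fin_numE//; apply: open_mass_le => g [cg g01 g0].
rewrite leeBrDl ?fin_numE//.
apply: (@le_trans _ _ ((L (trunc d f + g))%:E + e%:E)).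
  rewrite -!EFinD lee_fin meanD//; last exact: trunc_continuous.
  have := mean_trunc d cf; rewrite /d; lra.
rewrite leeD2r//; apply: open_mass_ge; split.
- by apply: continuousRD => //; exact: trunc_continuous.
- move=> x; rewrite fctE; have [fx|fx] := leP (f x) d.
    by rewrite trunc_eq0// add0r.
  rewrite g0 ?addr0; first exact: trunc_range.
  by move=> [_ /=]; lra.
- move=> x Vx; rewrite fctE g0 ?addr0; last by move=> [].
  by rewrite trunc_eq0// f0 ?(ltW d0)// => -[].
Qed.

Lemma borel_caratheodory (A : set (borelType X)) : measurable A ->
  outer_mass.-caratheodory A.
Proof.
have : <<s @open X >> `<=` outer_mass.-caratheodory.
  apply: smallest_sub; last exact: open_caratheodory.
  split.
  - exact: caratheodory_measurable_set0.
  - by move=> B mB; rewrite setTD; exact: caratheodory_measurable_setC.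
  - exact: caratheodory_measurable_bigcup.
exact.
Qed.

Definition mass : set (borelType X) -> \bar R := outer_mass.

Lemma mass0 : mass set0 = 0. Proof. exact: outer_mass0. Qed.

Lemma mass_ge0 A : 0 <= mass A. Proof. exact: outer_mass_ge0. Qed.

Lemma mass_semi_sigma_additive : semi_sigma_additive mass.
Proof.
move=> A mA tA mbigcupA.
apply: (caratheodory_measure_sigma_additive (mu := outer_mass)) => //.
  by move=> n; exact: borel_caratheodory.
exact: borel_caratheodory.
Qed.

HB.instance Definition _ := isMeasure.Build _ _ _ mass mass0 mass_ge0
  mass_semi_sigma_additive.

Lemma mass_setT : mass setT = 1.
Proof.
apply/eqP; rewrite eq_le outer_mass_le1/= /mass outer_mass_open; last exact: openT.
rewrite -[leLHS](congr1 EFin (mean_cst 1)) open_mass_ge//; split => [|x|x].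
- exact: continuousR_cst.
- by rewrite ler01 lexx.
- by move=> /(_ I).
Qed.

HB.instance Definition _ := Measure_isProbability.Build _ _ _ mass mass_setT.

Lemma exists_mass : exists mu : probability (borelType X) R,
  forall A, mu A = outer_mass A.
Proof. by exists mass. Qed.

End MeanTheory.
End Means.

(** * Regularity of the measure and representation of the functional *)

Section BorelMeasures.
Variables (R : realType) (X : compactHausdorffType).
Implicit Types (f g : X -> R) (A O K : set X) (L : (X -> R) -> R).

Lemma open_measurable A : open A -> measurable (A : set (borelType X)).
Proof. exact: sub_gen_smallest. Qed.

Lemma closed_measurable A : closed A -> measurable (A : set (borelType X)).
Proof.
move=> cA; rewrite -(setCK A); apply: measurableC.
by apply: open_measurable; exact: closed_openC.
Qed.

Lemma continuous_borel_measurable f : continuous f ->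
  measurable_fun setT (f : borelType X -> R).
Proof.
move=> cf.
apply: (measurability _ (measurable_realfun.RGenOInfty.measurableE R)) => // _ [_ [a ->] <-].
rewrite setTI; apply: open_measurable; apply: open_comp => [x _|]; first exact: cf.
exact: interval_open.
Qed.

Lemma continuous_compact_bounded f : continuous f -> exists M, forall x, `|f x| <= M.
Proof.
move=> cf; have /compact_bounded[M [_ MP]] : compact (range f).
  apply: continuous_compact; last exact: compact_space.
  exact: continuous_subspaceT.
by exists (M + 1) => x; apply: MP; [rewrite ltrDl|exists x].
Qed.

Section Integral.
Variable mu : probability (borelType X) R.
Local Notation intg := (Rintegral mu).

Lemma bounded_measurable_integrable D (f : borelType X -> R) M : measurable D ->
  measurable_fun D f -> (forall x, `|f x| <= M) -> mu.-integrable D (EFin \o f).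
Proof.
move=> mD mf fM; apply: measurable_bounded_integrable => //.
  by apply: le_lt_trans (probability_le1 mu mD) _; rewrite ltry.
exists M; split; first by rewrite num_real.
by move=> y My x _ /=; exact: le_trans (fM x) (ltW My).
Qed.

Lemma continuous_integrable D f : measurable (D : set (borelType X)) -> continuous f ->
  mu.-integrable D (EFin \o f).
Proof.
move=> mD cf; have [M fM] := continuous_compact_bounded cf.
apply: bounded_measurable_integrable fM => //.
by apply: measurable_funTS; exact: continuous_borel_measurable.
Qed.

End Integral.

Section Riesz.
Variables (L : (X -> R) -> R) (mL : mean L) (mu : probability (borelType X) R).
Hypothesis muE : forall A, mu A = outer_mass L A.

(** The open set [{1 - e < h}] contains [K], and any function below it is at most [h + e]. *)
Lemma measure_le_mean K (h : X -> R) : closed K -> continuous h -> (forall x, 0 <= h x) ->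
  (forall x, K x -> 1 <= h x) -> (mu K <= (L h)%:E)%E.
Proof.
move=> cK ch h0 h1; rewrite muE; apply/lee_addgt0Pr => e e0.
have oO : open [set x | 1 - e < h x] by exact: open_gt_continuous.
apply: (@le_trans _ _ (open_mass L [set x | 1 - e < h x])).
  by apply: outer_mass_le => // x /h1 /=; lra.
apply: open_mass_le => k [ck k01 k0]; rewrite -EFinD lee_fin.
rewrite -(mean_cst mL e) -meanD//; last exact: continuousR_cst.
apply: mean_le => // [|x].
  by apply: continuousRD => //; exact: continuousR_cst.
rewrite fctE /cst; have := h0 x; have := k01 x.
have [hx|hx] := ltP (1 - e) (h x); first lra.
by rewrite k0 /=; [lra|apply/negP; rewrite -leNgt].
Qed.

Lemma measure_ge_mean K (e : R) : closed K -> 0 < e ->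
  exists h : X -> R, [/\ continuous h, forall x, 0 <= h x <= 1, forall x, K x -> h x = 1 &
    ((L h)%:E <= mu K + e%:E)%E].
Proof.
move=> cK e0; have [U [oU KU UK]] := outer_mass_approx mL K e0.
have [|h [ch h01 h0 h1]] := separating_function R (open_closedC oU) cK.
  by rewrite -subset0 => x [+ /KU].
exists h; split => //; rewrite muE; apply: le_trans UK.
by apply: open_mass_ge; split.
Qed.

(** Inner regularity of [B] is outer regularity of its complement: the complement of an open set is
    compact. *)
Lemma mass_radon : radon mu.
Proof.
move=> B mB; apply/eqP; rewrite eq_le; apply/andP; split; last first.
  apply: ge_ereal_sup => _ [K [cK KB] <-]; rewrite !muE; exact: outer_mass_sub.
apply/lee_addgt0Pr => e e0.
have [U [oU BU UB]] := outer_mass_approx mL (~` B) e0.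
have cU : closed (~` U) by exact: open_closedC.
apply: (@le_trans _ _ (mu (~` U) + e%:E)%E).
  have := probability_setC mu (measurableC mB); rewrite setCK => ->.
  rewrite (probability_setC mu (open_measurable oU)).
  rewrite [mu U]muE [mu (~` B)]muE [outer_mass L U]outer_mass_open//.
  move: UB (open_mass_fin mL U) (outer_mass_fin mL (~` B)).
  case: (open_mass L U) => [u| |]//; case: (outer_mass L (~` B)) => [b| |]//=.
  by rewrite !lee_fin => + _ _; lra.
rewrite leeD2r//; apply: ereal_sup_ubound; exists (~` U) => //; split.
  exact: (subclosed_compact cU compact_space).
by move=> x Ux; apply: contrapT => /BU.
Qed.

Local Notation intg := (Rintegral mu setT).

(* Splitting [f] at the level [d] as [min f d + max (f - d) 0], the error
   [d * mu {0 < max (f - d) 0}] made on the second part is at most the mean of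
   the first one. *)
Lemma integral_le_layer (d : R) n (f : X -> R) : 0 < d -> continuous f ->
  (forall x, 0 <= f x <= n%:R * d) ->
  intg f <= L f + d * fine (mu [set x | 0 < f x]).
Proof.
move=> d0; elim: n f => [|n IH] f cf fb.
  have -> : f = cst 0.
    by apply/funext => x; have := fb x; rewrite mul0r /cst => /le_anti.
  rewrite Rintegral_cst// mul0r mean_cst// add0r.
  by apply: mulr_ge0; [exact: ltW|exact: fine_ge0].
pose f1 := f \min cst d; pose f2 := trunc d f.
have cf1 : continuous f1 by apply: continuousR_min => //; exact: continuousR_cst.
have cf2 : continuous f2 by exact: trunc_continuous.
have f12 x : f x = f1 x + f2 x.
  rewrite /f1 /f2 truncE /= /cst; case: (leP (f x) d) => h.
    by rewrite max_r ?addr0// subr_le0.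
  by rewrite max_l ?subr_ge0 ?ltW//; lra.
have fE : f = f1 + f2 by apply/funext.
have f2b x : 0 <= f2 x <= n%:R * d.
  rewrite /f2 truncE; have := fb x; rewrite -natr1 mulrDl mul1r.
  have : 0 <= n%:R * d by rewrite mulr_ge0// ltW.
  by case: (ltP (f x - d) 0); lra.
have f1b x : 0 <= f1 x <= d.
  rewrite /f1 /= /cst; have /andP[fx _] := fb x.
  by case: (leP (f x) d) => h; lra.
have O1 : measurable ([set x | 0 < f x] : set (borelType X)).
  by apply: open_measurable; exact: open_gt_continuous.
have I1 : intg f1 <= d * fine (mu [set x | 0 < f x]).
  rewrite -(Rintegral_cst mu O1) [leRHS]Rintegral_mkcond.
  apply: le_Rintegral => //.
  - exact: continuous_integrable.
  - apply: (@bounded_measurable_integrable _ _ _ d) => //.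
      rewrite -measurable_restrict//; exact: measurable_cst.
    move=> x; rewrite patchE; case: ifP => _; first by rewrite gtr0_norm.
      by rewrite normr0 ltW.
  - move=> x _; rewrite patchE; case: ifPn => xO; first by case/andP: (f1b x).
    have := fb x; rewrite notin_setE/= in xO => /andP[fx _].
    change (f1 x <= 0).
    have f0 : f x = 0 by apply/eqP; rewrite eq_le fx andbT leNgt; exact/negP.
    by rewrite /f1 /= f0 min_l// ltW.
have I2 := IH _ cf2 f2b.
have I3 : d * fine (mu [set x | 0 < f2 x]) <= L f1.
  have cK : closed [set x | d <= f x] by exact: closed_ge_continuous.
  have mK := closed_measurable cK.
  have : (mu [set x | d <= f x]%R <= (L (d^-1 *: f1))%:E)%E.
    apply: measure_le_mean => //.
    - exact: continuousRZ.
    - by move=> x; rewrite fctE mulr_ge0// ?invr_ge0 ?(ltW d0)//; case/andP: (f1b x).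
    - by move=> x /= dx; rewrite fctE /f1 /= min_r// [leRHS]mulVf// gt_eqF.
  rewrite meanZ// => H; rewrite -ler_pdivlMl// -lee_fin fineK ?fin_num_measure//; last first.
    by apply: open_measurable; exact: open_gt_continuous.
  apply: le_trans H; apply: le_measure; rewrite ?inE//.
    by apply: open_measurable; exact: open_gt_continuous.
  by move=> x /=; rewrite /f2 truncE; case: (ltP (f x - d) 0); lra.
have -> : intg f = intg f1 + intg f2.
  rewrite fE RintegralD//; exact: continuous_integrable.
by rewrite {1}fE meanD//; lra.
Qed.

(** A constant [M] makes the function nonnegative, and layers of height [e] give
    [intg g <= L g + e]. The reverse inequality is the same one for [- f]. *)
Lemma mean_integral f : continuous f -> L f = intg f.
Proof.
have le_int g : continuous g -> intg g <= L g.
  move=> cg; have [M gM] := continuous_compact_bounded cg.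
  have M0 : 0 <= M by apply: le_trans (gM point).
  apply/ler_addgt0Pr => e e0.
  have cgM : continuous (g + cst M) by apply: continuousRD => //; exact: continuousR_cst.
  have [n nM] : exists n : nat, 2 * M <= n%:R * e.
    exists (Num.trunc (2 * M / e)).+1; rewrite -ler_pdivrMr//; apply: ltW.
    by apply: truncnS_gt.
  have := @integral_le_layer e n (g + cst M) e0 cgM.
  have -> : intg (g + cst M) = intg g + M.
    rewrite RintegralD//; [|exact: continuous_integrable|].
      congr (_ + _); rewrite Rintegral_cst//; transitivity (M * fine 1%E).
        by congr (_ * fine _); exact: probability_setT.
      by rewrite /= mulr1.
    by apply: continuous_integrable => //; exact: continuousR_cst.
  rewrite (meanD mL)//; last exact: continuousR_cst.
  rewrite (mean_cst mL) => H.
  have : intg g + M <= L g + M + e * fine (mu [set x | 0 < (g + cst M) x]).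
    apply: H => x; rewrite fctE /cst; have := gM x; rewrite ler_norml; lra.
  have : e * fine (mu [set x | 0 < (g + cst M) x]) <= e * 1.
    rewrite ler_pM2l// -lee_fin fineK ?probability_le1 ?fin_num_measure//;
      by apply: open_measurable; exact: open_gt_continuous.
  lra.
move=> cf; apply/eqP; rewrite eq_le le_int// andbT.
have := le_int _ (continuousRN cf); rewrite (meanN mL)//.
have -> : intg (- f) = - intg f.
  have -> : - f = (fun x => -1 * f x) by apply/funext => x; rewrite mulN1r.
  by rewrite RintegralZl ?mulN1r//; exact: continuous_integrable.
lra.
Qed.

End Riesz.
End BorelMeasures.

(** * Partial dynamical systems *)

Section PartialDynamics.
Variables (R : realType) (X : compactHausdorffType) (phi : X -> X) (Delta : set X).
Hypotheses (oD : open Delta) (cD : closed Delta).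
Hypothesis cphi : {within Delta, continuous phi}.
Implicit Types (f : X -> R) (A E O : set X).

Let phi_cvg x : Delta x -> phi @ x --> phi x.
Proof.
by move: cphi; rewrite continuous_open_subspace// => h Dx; apply: h; rewrite inE.
Qed.

Lemma open_preimage_within O : open O -> open (Delta `&` phi @^-1` O).
Proof.
rewrite !openE => oO x [Dx Ox]; rewrite /interior; apply: filterI.
  by move: oD; rewrite openE; exact.
by apply: (phi_cvg Dx); exact: oO.
Qed.

Lemma closed_preimage_within A : closed A -> closed (Delta `&` phi @^-1` A).
Proof.
move=> cA; rewrite -(setCK (Delta `&` _)); apply: open_closedC.
rewrite (_ : ~` _ = ~` Delta `|` (Delta `&` phi @^-1` (~` A))).
  apply: openU; first exact: closed_openC.
  by apply: open_preimage_within; exact: closed_openC.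
apply/seteqP; split=> x; last by move=> [Dx [/Dx]|[_ Ax] []].
by move=> DA; have [Dx|Dx] := pselect (Delta x); [right; split => // ?; exact: DA|left].
Qed.

Definition transfer f x : R := if `[< Delta x >] then f (phi x) else 0.

Lemma transferT f x : Delta x -> transfer f x = f (phi x).
Proof. by move=> Dx; rewrite /transfer asboolT. Qed.

Lemma transferF f x : ~ Delta x -> transfer f x = 0.
Proof. by move=> Dx; rewrite /transfer asboolF. Qed.

Lemma transfer_continuous f : continuous f -> continuous (transfer f).
Proof.
move=> cf x; have [Dx|Dx] := pselect (Delta x).
  rewrite /continuous_at (transferT _ Dx).
  apply: (@cvg_trans _ (f \o phi @ x)).
    apply: near_eq_cvg; near=> y; rewrite transferT//.
    by near: y; move: oD; rewrite openE; exact.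
  by apply: cvg_comp; [exact: phi_cvg|exact: cf].
rewrite /continuous_at (transferF _ Dx); apply: (@cvg_trans _ (cst 0 @ x)).
  apply: near_eq_cvg; near=> y; rewrite transferF//.
  by near: y; have := closed_openC cD; rewrite openE; exact.
exact: cvg_cst.
Unshelve. all: by end_near. Qed.

Lemma iter_dom_open n : open (iter_dom phi Delta n).
Proof. by elim: n => [|n IH] /=; [exact: openT|exact: open_preimage_within]. Qed.

Lemma iter_dom_closed n : closed (iter_dom phi Delta n).
Proof. by elim: n => [|n IH] /=; [exact: closedT|exact: closed_preimage_within]. Qed.

Lemma iter_phi_cvg n x : iter_dom phi Delta n x -> iter n phi @ x --> iter n phi x.
Proof.
elim: n x => [|n IH] x /=; first by move=> _; exact: cvg_id.
move=> [Dx Hx]; rewrite -iterS iterSr.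
have -> : iter n.+1 phi = iter n phi \o phi by apply/funext => y; rewrite iterSr.
by apply: cvg_comp; [exact: phi_cvg|exact: IH].
Qed.

Lemma iter_image_closed n : closed (iter n phi @` iter_dom phi Delta n).
Proof.
apply: compact_closed; first exact: hausdorff_compact_space.
apply: continuous_compact; last first.
  exact: (subclosed_compact (@iter_dom_closed n) compact_space).
rewrite continuous_open_subspace; last exact: iter_dom_open.
by move=> x; rewrite inE => Hx; exact: iter_phi_cvg.
Qed.

Local Notation Y := (essential_domain phi Delta).

Lemma essential_domainE : Y =
  \bigcap_n (iter_dom phi Delta n `&` iter n phi @` iter_dom phi Delta n).
Proof.
apply/seteqP; split=> x.
  move=> Yx n _; split; first exact: (Yx (Posz n)).
  case: n => [|n]; first by exists x.
  exact: (Yx (Negz n)).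
by move=> Hx [n|n] _; [case: (Hx n I)|case: (Hx n.+1 I)].
Qed.

Lemma essential_domain_sub n : Y `<=` iter_dom phi Delta n.
Proof. by rewrite essential_domainE => x /(_ n I)[]. Qed.

Lemma essential_domain_stable x : Y x -> Y (phi x).
Proof.
rewrite essential_domainE => Yx n _.
have [[Dx Hx] _] := Yx n.+1 I; have [_ [z Hz xz]] := Yx n I.
split => //; exists (phi z); last by rewrite -iterSr iterS xz.
(* [phi x] is the [n]-th iterate of [phi z]. One more step is allowed from [z] because its [n]-th
   iterate [x] is in [Delta]. *)
suff : iter_dom phi Delta n.+1 z by case.
have : Delta (iter n phi z) by rewrite xz.
elim: n z Hz {Hx xz} => //= n IH z [Dz Hz].
by rewrite -iterS iterSr => /(IH _ Hz); split.
Qed.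

Local Notation preim A := (Delta `&` phi @^-1` A).

Lemma preim_measurable (A : set (borelType X)) : measurable A ->
  measurable (preim A : set (borelType X)).
Proof.
pose F : set (set X) := [set A | measurable (preim A : set (borelType X))].
suff : <<s @open X >> `<=` F by exact.
apply: smallest_sub; last by move=> O oO; apply: open_measurable; exact: open_preimage_within.
split.
- by rewrite /F /= preimage_set0 setI0.
- move=> B mB; rewrite /F /= setTD (_ : _ `&` _ = Delta `\` preim B).
    by apply: measurableD => //; exact: open_measurable.
  apply/seteqP; split => x [Dx Bx]; split => //; first by case.
  by move=> ?; exact: Bx.
- move=> B mB; rewrite /F /= preimage_bigcup setI_bigcupr.
  by apply: bigcup_measurable => i _; exact: mB.
Qed.

(** Nothing is known of [phi] outside [Delta], not even measurability, whereas the pushforward of a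
    measure needs a measurable total map. Any constant value would do off [Delta]. *)
Definition totalized (x : X) : X := if `[< Delta x >] then phi x else point.

Lemma totalizedE x : Delta x -> totalized x = phi x.
Proof. by move=> Dx; rewrite /totalized asboolT. Qed.

Lemma totalized_measurable :
  measurable_fun setT (totalized : borelType X -> borelType X).
Proof.
move=> _ A mA; rewrite setTI.
have DE : Delta `&` totalized @^-1` A = preim A.
  by apply/seteqP; split => x [Dx] /=; rewrite totalizedE.
have CE : ~` Delta `&` totalized @^-1` A = if `[< A point >] then ~` Delta else set0.
  apply/seteqP; split=> x.
    by move=> [Dx] /=; rewrite /totalized asboolF// => Ap; rewrite asboolT.
  case: ifPn => // /asboolP Ap Dx; split => //.
  by rewrite /= /totalized asboolF.
rewrite -(setTI (_ @^-1` _)) -(setUv Delta) setIUl; apply: measurableU.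
  by rewrite DE; exact: preim_measurable.
rewrite CE; case: ifP => _ //; apply: measurableC; exact: open_measurable.
Qed.

Definition invariant_mean (L : (X -> R) -> R) :=
  mean L /\ forall f, continuous f -> L (transfer f) = L f.

Lemma essential_domain_closed : closed Y.
Proof.
rewrite essential_domainE; apply: closed_bigI => n _.
by apply: closedI; [exact: iter_dom_closed|exact: iter_image_closed].
Qed.

Section InvariantMeasure.
Variable mu : probability (borelType X) R.
Hypothesis mu_preim : forall A : set (borelType X), measurable A -> mu (preim A) = mu A.

Lemma measure_iter_preim n (A : set (borelType X)) : measurable A ->
  measurable (iter_dom phi Delta n `&` iter n phi @^-1` A : set (borelType X)) /\
  mu (iter_dom phi Delta n `&` iter n phi @^-1` A) = mu A.
Proof.
move=> mA; elim: n => [|n [mI eI]]; first by rewrite /= setTI.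
have -> : iter_dom phi Delta n.+1 `&` iter n.+1 phi @^-1` A =
    preim (iter_dom phi Delta n `&` iter n phi @^-1` A).
  apply/seteqP; split=> x /=.
    by move=> [[Dx Hx]]; rewrite -iterS iterSr.
  by move=> [Dx [Hx]]; rewrite -iterSr iterS.
by split; [exact: preim_measurable|rewrite mu_preim].
Qed.

Lemma measure1_setC (A : set (borelType X)) : measurable A -> mu A = 1%E -> mu (~` A) = 0%E.
Proof. by move=> mA A1; rewrite probability_setC// A1 subee. Qed.

(** Invariance at the whole space gives full measure to [iter_dom n]. The preimage of the [n]-th
    image under the [n]-th iterate contains [iter_dom n], so the image has full measure too. *)
Lemma measure_essential_domain : measurable (Y : set (borelType X)) /\ mu (~` Y) = 0%E.
Proof.
have mY := closed_measurable essential_domain_closed.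
split => //; apply/(negligibleP _ (measurableC mY)); rewrite essential_domainE setC_bigcap.
apply: negligible_bigcup => n; rewrite setCI; apply: negligibleU.
  apply/negligibleP.
    by apply: measurableC; apply: closed_measurable; exact: iter_dom_closed.
  apply: measure1_setC; first by apply: closed_measurable; exact: iter_dom_closed.
  have [_ +] := measure_iter_preim n (@measurableT _ (borelType X)).
  by rewrite preimage_setT setIT => ->; exact: probability_setT.
have mI : measurable (iter n phi @` iter_dom phi Delta n : set (borelType X)).
  by apply: closed_measurable; exact: iter_image_closed.
apply/negligibleP; first exact: measurableC.
apply: measure1_setC => //; apply/eqP; rewrite eq_le probability_le1//=.
have [mJ <-] := measure_iter_preim n mI.
have [mT] := measure_iter_preim n (@measurableT _ (borelType X)).
rewrite preimage_setT setIT => /esym; rewrite [mu _](@probability_setT _ _ _ mu) => ->.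
apply: le_measure; rewrite ?inE//.
  by apply: closed_measurable; exact: iter_dom_closed.
by move=> x Hx; split => //; exists x.
Qed.

Lemma measure_setI_essential (A : set (borelType X)) : measurable A -> mu (Y `&` A) = mu A.
Proof.
move=> mA; have [mY Y0] := measure_essential_domain.
rewrite -[in RHS](setIT A) -(setUv Y) setIUr measureU.
- rewrite setIC [X in (_ + X)%E](_ : _ = 0%E) ?adde0//.
  apply/eqP; rewrite -measure_le0 -Y0; apply: le_measure; rewrite ?inE.
  - by apply: measurableI => //; exact: measurableC.
  - exact: measurableC.
  - exact: subIsetr.
- exact: measurableI.
- by apply: measurableI => //; exact: measurableC.
- by rewrite setIACA setICr setI0.
Qed.

Lemma essential_preimE (A : set X) : Y `&` phi @^-1` A = Y `&` preim A.
Proof.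
apply/seteqP; split=> x [Yx]; last by case.
by split => //; split => //; case: (@essential_domain_sub 1%N _ Yx).
Qed.

Lemma measure_essential_preim (A : set (borelType X)) : measurable A ->
  mu (Y `&` phi @^-1` A) = mu A.
Proof.
by move=> mA; rewrite essential_preimE measure_setI_essential ?mu_preim//; exact: preim_measurable.
Qed.

(** Change of variables along [totalized]: its pushforward of [mu] agrees with [mu] on Borel sets,
    and the preimage of [B] differs from [B] only outside [Y], that is, by a null set. *)
Lemma integral_transfer (B : set (borelType X)) f : measurable B -> B `<=` Y ->
  Y `&` phi @^-1` B = B -> continuous f ->
  Rintegral mu B (transfer f) = Rintegral mu B f.
Proof.
move=> mB BY invB cf; have [mY Y0] := measure_essential_domain.
have DE : Delta `&` totalized @^-1` B = preim B.
  by apply/seteqP; split => x [Dx] /=; rewrite totalizedE.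
have mtB : measurable (totalized @^-1` B : set (borelType X)).
  by rewrite -(setTI (_ @^-1` _)); exact: totalized_measurable.
have [M fM] := continuous_compact_bounded cf.
have cft : measurable_fun setT (f \o totalized : borelType X -> R).
  apply: (measurableT_comp (continuous_borel_measurable cf)).
  exact: totalized_measurable.
have intft : mu.-integrable setT (EFin \o (f \o totalized)).
  by apply: bounded_measurable_integrable => // x; exact: fM.
pose nu0 : {measure set (borelType X) -> \bar R} :=
  pushforward mu (totalized : borelType X -> borelType X).
pose nu := nu0 totalized_measurable.
congr fine.
transitivity (\int[nu]_(x in B) (f x)%:E)%E; last first.
  apply: eq_measure_integral => A mA AB; rewrite /nu /nu0 /= /pushforward -(mu_preim mA).
  transitivity (mu (Y `&` (totalized @^-1` A))).
    rewrite measure_setI_essential// -(setTI (_ @^-1` _)); exact: totalized_measurable.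
  rewrite -(measure_setI_essential (preim_measurable mA)); congr (mu _).
  apply/seteqP; split=> x [Yx];
    have Dx : Delta x by case: (@essential_domain_sub 1%N _ Yx).
    by move=> /=; rewrite totalizedE.
  by move=> [_ Ax]; split => //=; rewrite totalizedE.
rewrite /nu /nu0 integral_pushforward//; first last.
- exact: integrableS intft.
- have := continuous_borel_measurable cf.
  by move=> /(measurable_EFinP setT (f : borelType X -> R)).
- exact: totalized_measurable.
rewrite [RHS](@negligible_integral _ _ _ mu _ (~` Y))//; last 2 first.
- exact: measurableC.
- exact: integrableS intft.
have -> : totalized @^-1` B `\` ~` Y = B.
  apply/seteqP; split=> x.
    move=> [tBx /contrapT Yx]; have Dx : Delta x by case: (@essential_domain_sub 1%N _ Yx).
    by rewrite -invB; split => //=; rewrite -(totalizedE Dx).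
  move=> Bx; have Yx := BY _ Bx; split; last by apply.
  have Dx : Delta x by case: (@essential_domain_sub 1%N _ Yx).
  rewrite /= totalizedE//.
  by have [] : (Y `&` phi @^-1` B) x by rewrite invB.
apply: eq_integral => x; rewrite inE => /BY Yx.
have Dx : Delta x by case: (@essential_domain_sub 1%N _ Yx).
by rewrite /= transferT// totalizedE.
Qed.

End InvariantMeasure.
Section InvariantMass.
Variables (L : (X -> R) -> R) (iL : invariant_mean L) (mu : probability (borelType X) R).
Hypothesis muE : forall A, mu A = outer_mass L A.
Let mL : mean L := proj1 iL.

(** For open sets, [transfer] carries the functions below [O] to functions below [preim O], hence
    one inequality. It extends to Borel sets by outer regularity, and its version for the complement
    of [A] gives the equality. *)
Lemma measure_preim (A : set (borelType X)) : measurable A -> mu (preim A) = mu A.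
Proof.
have le_open O : open O -> (mu O <= mu (preim O))%E.
  move=> oO; rewrite !muE !outer_mass_open//; last exact: open_preimage_within.
  apply: open_mass_le => f [cf f01 f0]; rewrite -(proj2 iL)//.
  apply: open_mass_ge; split; first exact: transfer_continuous.
    move=> x; have [Dx|Dx] := pselect (Delta x); first by rewrite transferT.
    by rewrite transferF// lexx ler01.
  move=> x Ox; have [Dx|Dx] := pselect (Delta x); last by rewrite transferF.
  by rewrite transferT// f0// => Ox'; apply: Ox.
have le_borel (B : set (borelType X)) : measurable B -> (mu B <= mu (preim B))%E.
  move=> mB; rewrite [leRHS]muE; apply: outer_mass_ge => V oV BV.
  rewrite -(outer_mass_open L oV) -muE.
  (* The largest set whose preimage lies in [V]; it is open because the image of a compact set is
     closed. *)
  pose W := ~` (phi @` (Delta `\` V)).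
  have oW : open W.
    apply: closed_openC; apply: compact_closed; first exact: hausdorff_compact_space.
    apply: continuous_compact; first by apply: continuous_subspaceW cphi => x [].
    apply: (subclosed_compact _ compact_space) => //.
    by apply: closedI => //; exact: open_closedC.
  have BW : B `<=` W by move=> x Bx [y [Dy Vy] yx]; apply/Vy/BV; split => //=; rewrite yx.
  have mW := open_measurable oW.
  apply: (@le_trans _ _ (mu W)); first by rewrite le_measure ?inE.
  apply: (le_trans (le_open _ oW)); apply: le_measure; rewrite ?inE.
  - exact: preim_measurable.
  - exact: open_measurable.
  - by move=> x [Dx Wx]; apply: contrapT => Vx; apply: Wx; exists x.
move=> mA; apply/eqP; rewrite eq_le le_borel// andbT.
have mA' := preim_measurable mA; have mC := measurableC mA.
have := le_borel _ mC.
have : (mu (preim (~` A)) <= mu (~` preim A))%E.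
  rewrite le_measure ?inE//; [exact: preim_measurable|exact: measurableC|].
  by move=> x [Dx Ax] [_ /Ax].
move=> /[swap] /le_trans/[apply]; rewrite !probability_setC//.
rewrite -(fineK (fin_num_measure mu _ mA)) -(fineK (fin_num_measure mu _ mA')).
by rewrite -!EFinB !lee_fin; lra.
Qed.

End InvariantMass.
End PartialDynamics.

(** * Ergodic measures of maximal growth *)

Section LinearGrowth.
Variable R : realType.

Lemma le_of_linear_growth (a b c : R) :
  (forall n : nat, n%:R * a <= c + n%:R * b) -> a <= b.
Proof.
move=> H; rewrite leNgt; apply/negP => ba.
have ab0 : 0 < a - b by lra.
have := H (Num.trunc (c / (a - b))).+1.
have := truncnS_gt (c / (a - b)); rewrite ltr_pdivrMr//.
by move: (_.+1%:R) => n; lra.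
Qed.

End LinearGrowth.

Section Birkhoff.
Variables (R : realType) (X : Type) (phi : X -> X).
Implicit Types (f g : X -> R).

Fixpoint birkhoff f n x : R := if n is m.+1 then f x + birkhoff f m (phi x) else 0.

Lemma birkhoffD f g n x : birkhoff (f + g) n x = birkhoff f n x + birkhoff g n x.
Proof. by elim: n x => [|n IH] x /=; [rewrite addr0|rewrite IH fctE; lra]. Qed.

Lemma birkhoffZ k f n x : birkhoff (k *: f) n x = k * birkhoff f n x.
Proof.
by elim: n x => [|n IH] x /=; [rewrite mulr0|rewrite IH mulrDr].
Qed.

Lemma birkhoff_bounds f M n x : (forall y, `|f y| <= M) ->
  - (n%:R * M) <= birkhoff f n x <= n%:R * M.
Proof.
move=> fM; elim: n x => [|n IH] x /=; first by rewrite mul0r oppr0 lexx.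
by rewrite -natr1; have := IH (phi x); have := fM x; rewrite ler_norml; lra.
Qed.

Lemma birkhoff_ge0 f n x : (forall y, 0 <= f y) -> 0 <= birkhoff f n x.
Proof. by move=> f0; elim: n x => //= n IH x; rewrite addr_ge0. Qed.

Lemma birkhoff_le f c n x : (forall y, f y <= c) -> birkhoff f n x <= n%:R * c.
Proof.
move=> fc; elim: n x => [|n IH] x /=; first by rewrite mul0r.
by rewrite -natr1; have := IH (phi x); have := fc x; lra.
Qed.

Lemma birkhoff_addn f n m x :
  birkhoff f (n + m) x = birkhoff f n x + birkhoff f m (iter n phi x).
Proof.
by elim: n x => [|n IH] x /=; rewrite ?add0r// IH -iterSr /= addrA.
Qed.

End Birkhoff.

(** * Tangent functionals of the pressure *)

Section Growth.
Variables (R : realType) (X : compactHausdorffType) (phi : X -> X) (Delta : set X).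
Hypotheses (oD : open Delta) (cD : closed Delta).
Hypothesis cphi : {within Delta, continuous phi}.
Implicit Types (f g h : X -> R).

(* The norms of a cocycle over [phi], normalized to have growth rate [1]. *)
Variable P : nat -> X -> R.
Hypotheses (cP : forall n, continuous (P n)) (P0 : forall x, P 0 x = 1).
Hypothesis PD : forall n m x, P (n + m) x <= P n x * P m (iter n phi x).
Hypothesis P_dom : forall n x, 0 < P n x -> iter_dom phi Delta n x.
Hypothesis P_ge0 : forall n x, 0 <= P n x.
Hypothesis P_large : forall n, exists x, 1 <= P n x.
Hypothesis P_small : forall e, 0 < e -> exists C, forall n x, P n x <= expR (C + n%:R * e).

Local Notation S := (birkhoff phi).

Lemma P_split n m x : 0 < P (n + m) x ->
  [/\ 0 < P n x, 0 < P m (iter n phi x) &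
      ln (P (n + m) x) <= ln (P n x) + ln (P m (iter n phi x))].
Proof.
move=> Pnm; have := lt_le_trans Pnm (PD n m x) => PP.
have Pn : 0 < P n x.
  by rewrite lt_neqAle P_ge0 andbT; apply: contraTneq PP => <-; rewrite mul0r ltxx.
have Pm : 0 < P m (iter n phi x).
  by rewrite lt_neqAle P_ge0 andbT; apply: contraTneq PP => <-; rewrite mulr0 ltxx.
by split => //; rewrite -lnM ?posrE// ler_ln ?posrE.
Qed.

Lemma ln_P_small e : 0 < e ->
  exists2 C, 0 <= C & forall n x, 0 < P n x -> ln (P n x) <= C + n%:R * e.
Proof.
move=> e0; have [C CP] := P_small e0; exists `|C| => // n x Pn.
rewrite -ler_expR lnK ?posrE//; apply: le_trans (CP n x) _.
by rewrite ler_expR lerD2r ler_norm.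
Qed.

(* The measures [mu] with [mu h <= s] for all the admissible pairs [(h, s)] are
   the invariant measures of maximal growth: they are the tangent functionals at
   [0] of the pressure of [ln P]. *)
Definition admissible h s := exists t C, 0 <= t /\
  forall n x, 0 < P n x -> S h n x + t * ln (P n x) <= C + n%:R * s.

(** For [t > 0], dividing by [t] turns admissibility into the bound [s / t] on the pressure in the
    direction [h / t]. As the pressure is [0] at [0], letting [t] grow gives its one-sided
    derivative at [0] along [h]. *)
Definition tangent h : R := inf [set s | admissible h s].

Lemma admissible_ge h s M : (forall x, `|h x| <= M) -> admissible h s -> - M <= s.
Proof.
move=> hM [t [C [t0 H]]]; apply: (@le_of_linear_growth _ _ _ C) => n.
have [x Px] := P_large n; have Px0 : 0 < P n x by apply: lt_le_trans Px.
have := H n x Px0; have /andP[] := birkhoff_bounds phi n x hM.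
have : 0 <= t * ln (P n x) by rewrite mulr_ge0// ln_ge0.
lra.
Qed.

Lemma admissible_sup h c : (forall x, h x <= c) -> admissible h c.
Proof.
move=> hc; exists 0, 0; split => // n x _; rewrite mul0r addr0 add0r.
exact: birkhoff_le.
Qed.

Lemma tangent_le h s : continuous h -> admissible h s -> tangent h <= s.
Proof.
move=> ch hs; have [M hM] := continuous_compact_bounded ch.
by apply: ge_inf => //; exists (- M) => r; exact: admissible_ge.
Qed.

Lemma tangent_ge h c : continuous h -> (forall s, admissible h s -> c <= s) ->
  c <= tangent h.
Proof.
move=> ch H; have [M hM] := continuous_compact_bounded ch.
apply: lb_le_inf => //; exists M; apply: admissible_sup => x.
exact: le_trans (ler_norm _) (hM x).
Qed.

Lemma tangent_sublinear :
  sublinear_on (idfun : {rmorphism R -> R}) [set f : X -> R | continuous f] tangent.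
Proof.
split=> [u v /= cu cv|t u /= cu].
- have cuv := continuousRD cu cv.
  rewrite -lerBlDl; apply: tangent_ge => // s [t [C [t0 H]]].
  rewrite lerBlDl -lerBlDr; apply: tangent_ge => // r [t' [C' [t'0 H']]].
  rewrite lerBlDr; apply: tangent_le => //; exists (t' + t), (C' + C); split.
    exact: addr_ge0.
  by move=> n x Px; rewrite birkhoffD; have := H n x Px; have := H' n x Px; lra.
- rewrite le_eqVlt => /predU1P[<-|t0].
    rewrite mul0r scale0r; apply/eqP; rewrite eq_le; apply/andP; split.
      apply: tangent_le; first exact: continuousR_cst.
      exact: admissible_sup.
    apply: tangent_ge; first exact: continuousR_cst.
    move=> s hs; rewrite -[leLHS]oppr0; apply: admissible_ge hs => x.
    by rewrite normr0.
  apply/eqP; rewrite eq_le; apply/andP; split.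
    rewrite -ler_pdivrMl//; apply: tangent_ge => // s [r [C [r0 H]]].
    rewrite ler_pdivrMl//; apply: tangent_le; first exact: continuousRZ.
    exists (t * r), (t * C); split; first by rewrite mulr_ge0// ltW.
    move=> n x Px; rewrite birkhoffZ -mulrA -mulrDr mulrCA -mulrDr.
    by rewrite ler_pM2l//; exact: H.
  apply: tangent_ge; first exact: continuousRZ.
  move=> s [r [C [r0 H]]]; rewrite -ler_pdivlMl//; apply: tangent_le => //.
  exists (t^-1 * r), (t^-1 * C); split; first by rewrite mulr_ge0// invr_ge0 ltW.
  move=> n x Px; rewrite -(ler_pM2l t0) !mulrDr -birkhoffZ (mulrCA n%:R) !mulrA.
  by rewrite mulfV ?gt_eqF// !mul1r; exact: H.
Qed.

Section BelowTangent.
Variable L : (X -> R) -> R.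
Hypothesis lL : linear_on (idfun : {rmorphism R -> R}) [set f : X -> R | continuous f] L.
Hypothesis Lp : le_on [set f : X -> R | continuous f] L tangent.

Lemma below_tangent_admissible h s : continuous h -> admissible h s -> L h <= s.
Proof. by move=> ch hs; exact: le_trans (Lp ch) (tangent_le ch hs). Qed.

Let LN h : continuous h -> L (- h) = - L h.
Proof. by move=> ch; rewrite -scaleN1r lL.2// mulN1r. Qed.

(** The weight [t = 0] is admissible, so [L h] never exceeds an upper bound of [h]; positivity and
    normalization follow. *)
Lemma below_tangent_mean : mean L.
Proof.
split => //.
  move=> f cf f0; rewrite -oppr_le0 -LN//.
  apply: below_tangent_admissible; first exact: continuousRN.
  by apply: admissible_sup => x; rewrite oppr_le0.
have c1 : continuous (cst 1 : X -> R) by exact: continuousR_cst.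
apply/eqP; rewrite eq_le below_tangent_admissible//; last exact: admissible_sup.
rewrite -lerN2 -LN//; apply: below_tangent_admissible; first exact: continuousRN.
exact: admissible_sup.
Qed.

(** The Birkhoff sums of the coboundary [transfer f - f] telescope and stay bounded along the orbit
    segments with [0 < P n x], so the coboundary and its opposite are both admissible with
    [s = 0]. *)
Lemma below_tangent_invariant : invariant_mean phi Delta L.
Proof.
split; first exact: below_tangent_mean.
have telescope f n x : iter_dom phi Delta n x ->
    S (transfer phi Delta f - f) n x = f (iter n phi x) - f x.
  elim: n x => [|n IH] x /=; first by rewrite subrr.
  move=> [Dx Hx]; have -> : (transfer phi Delta f - f) x = f (phi x) - f x.
    by rewrite -(transferT phi f Dx).
  by rewrite (IH _ Hx) -iterSr iterS; lra.
have le_transfer f : continuous f ->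
    L (transfer phi Delta f - f) = 0.
  move=> cf; have ct := transfer_continuous oD cD cphi cf.
  have [M fM] := continuous_compact_bounded cf.
  have cd : continuous (transfer phi Delta f - f).
    by apply: continuousRD => //; exact: continuousRN.
  apply/eqP; rewrite eq_le; apply/andP; split.
    apply: below_tangent_admissible => //; exists 0, (2 * M); split => // n x Px.
    rewrite telescope; last exact: P_dom.
    have := fM x; have := fM (iter n phi x); rewrite !ler_norml; lra.
  rewrite -oppr_le0 -LN//; apply: below_tangent_admissible; first exact: continuousRN.
  exists 0, (2 * M); split => // n x Px.
  rewrite -scaleN1r birkhoffZ telescope; last exact: P_dom.
  have := fM x; have := fM (iter n phi x); rewrite !ler_norml; lra.
move=> f cf; have := le_transfer _ cf.
rewrite lL.1//=; [|exact: transfer_continuous|exact: continuousRN].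
by rewrite LN// => ?; lra.
Qed.

(* For [0 < P (n + m) x], the sum [T n x] of the [ln P] along the [m] orbit
   segments that start at [x, ..., phi^(m-1) x] and all end at [phi^(n+m) x]
   satisfies [T (n + 1) x <= g x + T n (phi x)]. *)
Lemma block_majoration m g : continuous g ->
  (forall x, 0 < P m x -> ln (P m x) <= g x) -> 0 <= L g.
Proof.
move=> cg gP; have [K K0 PK] := ln_P_small ltr01.
have [M gM] := continuous_compact_bounded cg.
have M0 : 0 <= M by apply: le_trans (gM point).
pose T n x := \sum_(i < m) ln (P (n + m - i) (iter i phi x)).
have posT n x i : (i <= m)%N -> 0 < P (n + m) x ->
    [/\ 0 < P i x, 0 < P (n + m - i) (iter i phi x) &
       ln (P (n + m) x) <= ln (P i x) + ln (P (n + m - i) (iter i phi x))].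
  move=> im Px; have e : (n + m = i + (n + m - i))%N by rewrite subnKC// (leq_trans im)// leq_addl.
  by have := @P_split i (n + m - i) x; rewrite -e; exact.
have stepT n x : 0 < P (n.+1 + m) x -> T n.+1 x <= g x + T n (phi x).
  move=> Px; pose u i := ln (P (n.+1 + m - i) (iter i phi x)).
  have -> : T n.+1 x = \sum_(i < m) u i by [].
  have -> : T n (phi x) = \sum_(i < m) u i.+1.
    by apply: eq_bigr => i _; rewrite /u addSn subSS iterSr.
  (* Only the end terms [u 0] and [u m] remain to be compared: their difference is at most
     [ln (P m x)], hence at most [g x]. *)
  have -> : \sum_(i < m) u i = \sum_(i < m) u i.+1 + u 0 - u m.
    by elim: (m) => [|k IH]; rewrite ?big_ord0 ?big_ord_recr /= ?IH; lra.
  rewrite /u subn0 addnK /=; move: Px; rewrite addnC => /P_split[Pm _].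
  by have := gP x Pm; lra.
have sumT n x : 0 < P (n + m) x -> T n x <= S g n x + T 0 (iter n phi x).
  elim: n x => [|n IH] x Px; first by rewrite /= add0r.
  have Px' : 0 < P (n + m) (phi x) by move: Px; rewrite addSn -add1n => /P_split[].
  have := stepT _ _ Px; have := IH _ Px'; rewrite -iterSr iterS /=; lra.
have sum_le (c : R) (u : 'I_m -> R) : (forall i, u i <= c) -> \sum_i u i <= m%:R * c.
  move=> uc; rewrite mulr_natl -[X in _ *+ X]card_ord -sumr_const.
  by apply: ler_sum => i _; exact: uc.
have T0 y : 0 < P m y -> T 0 y <= m%:R * (K + m%:R).
  move=> Py; apply: sum_le => i; have [_ h _] := posT 0 y i (ltnW (ltn_ord i)) Py.
  apply: le_trans (PK _ _ h) _.
  by rewrite lerD2l mulr1 ler_nat add0n leq_subr.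
have lnT n x : 0 < P (n + m) x -> m%:R * ln (P (n + m) x) <= T n x + m%:R * (K + m%:R).
  move=> Px; rewrite -lerBlDr -mulrBr -lerN2 -mulrN opprB.
  have <- : \sum_(i < m) - ln (P (n + m - i) (iter i phi x)) = - T n x by rewrite sumrN.
  apply: sum_le => i; have im := ltnW (ltn_ord i).
  have [Pi _ h] := posT n x i im Px; have := PK _ _ Pi; rewrite mulr1.
  have : (i : nat)%:R <= m%:R :> R by rewrite ler_nat.
  lra.
rewrite -oppr_le0 -LN//; apply: below_tangent_admissible; first exact: continuousRN.
(* The weight [m] counts the segments in [T]. The constant pays for the last block [T 0], for the
   first steps cut off from each segment, and for the sum of [g] over the last [m] steps; it also
   covers the times [n < m]. *)
exists m%:R, (m%:R * (K + m%:R) + m%:R * (K + m%:R) + m%:R * M); split => // n x Px.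
rewrite -scaleN1r birkhoffZ mulr0 addr0 mulN1r.
have mK0 : 0 <= m%:R * (K + m%:R) :> R by rewrite mulr_ge0// addr_ge0.
have mM0 : 0 <= m%:R * M by rewrite mulr_ge0.
have [nm|mn] := ltnP n m.
  have nmR : n%:R <= m%:R :> R by rewrite ler_nat ltnW.
  have : m%:R * ln (P n x) <= m%:R * (K + m%:R).
    by apply: ler_wpM2l => //; have := PK _ _ Px; lra.
  have : n%:R * M <= m%:R * M by apply: ler_wpM2r.
  by have /andP[+ _] := birkhoff_bounds phi n x gM; lra.
have e : (n = (n - m) + m)%N by rewrite subnK.
rewrite e in Px; have := lnT _ _ Px; have := sumT _ _ Px.
have /T0 : 0 < P m (iter (n - m) phi x) by move: Px => /P_split[].
rewrite -e [S g n x](_ : _ = S g (n - m) x + S g m (iter (n - m) phi x)); last first.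
  by rewrite -birkhoff_addn -e.
by have /andP[+ _] := birkhoff_bounds phi m (iter (n - m) phi x) gM; lra.
Qed.

End BelowTangent.
(** A continuous substitute for the Birkhoff sum, which need not be continuous outside [iter_dom n];
    the two agree on [iter_dom n]. *)
Fixpoint transfer_sum h n : X -> R :=
  if n is m.+1 then (fun x => h x + transfer phi Delta (transfer_sum h m) x) else cst 0.

Lemma transfer_sum_continuous h n : continuous h -> continuous (transfer_sum h n).
Proof.
move=> ch; elim: n => [|n IH] /=; first exact: continuousR_cst.
by apply: continuousRD => //; exact: transfer_continuous.
Qed.

Lemma transfer_sumE h n x : iter_dom phi Delta n x -> transfer_sum h n x = S h n x.
Proof.
elim: n x => //= n IH x [Dx Hx]; rewrite -(IH _ Hx).
by rewrite -(transferT phi (transfer_sum h n) Dx).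
Qed.

Lemma invariant_transfer_sum A h n : invariant_mean phi Delta A -> continuous h ->
  A (transfer_sum h n) = n%:R * A h.
Proof.
move=> [mA iA] ch; elim: n => [|n IH] /=; first by rewrite mul0r (mean_cst mA).
have cs := @transfer_sum_continuous h n ch.
by rewrite (meanD mA)//; [rewrite iA// IH -natr1; lra|exact: transfer_continuous].
Qed.

(** An admissible pair [(h, s)] turns into a continuous majorant [g] of [ln (P n)], to which
    [block_majoration] applies. Invariance evaluates [A g] in terms of [A h]; for [B] it is enough
    that it is a mean, because [g] is first capped by the uniform subexponential bound on [P n]. *)
Lemma below_tangent_face L t A B : 0 < t < 1 ->
  linear_on (idfun : {rmorphism R -> R}) [set f : X -> R | continuous f] L ->
  le_on [set f : X -> R | continuous f] L tangent ->
  invariant_mean phi Delta A -> mean B ->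
  (forall f, continuous f -> L f = t * A f + (1 - t) * B f) ->
  le_on [set f : X -> R | continuous f] A tangent.
Proof.
move=> /andP[t0 t1] lL Lp iA mB LAB h /= ch; have mA := iA.1.
apply: tangent_ge => // s [r [C [r0 H]]]; apply/ler_addgt0Pr => e e0.
have [d d0 ->] : exists2 d, 0 < d & e = d + d by exists (e / 2); lra.
have [C1 C10 PC1] := ln_P_small ltr01.
(* The weight is made positive, so that [ln (P n x)] can be isolated, at the price of [d] in the
   slope. *)
pose r' := r + d; pose C' := C + d * C1.
have r'0 : 0 < r' by rewrite /r' ltr_wpDl.
have H' n x : 0 < P n x -> S h n x + r' * ln (P n x) <= C' + n%:R * (s + d).
  move=> Px; have := H n x Px; have := PC1 n x Px; rewrite mulr1 => h1.
  have : d * ln (P n x) <= d * (C1 + n%:R) by rewrite ler_pM2l.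
  rewrite /r' /C'; lra.
move: (r') r'0 (C') H' => {}r' r'0 {}C' {}H'.
(* After multiplication by [r' / t], the contribution of [B] has the coefficient [k]. A cap of slope
   [d / k] therefore costs exactly [d]. *)
pose k := r' * (1 - t) / t; have k0 : 0 < k by rewrite divr_gt0// mulr_gt0// subr_gt0.
have [C2 C20 PC2] := ln_P_small (divr_gt0 d0 k0).
apply: (@le_of_linear_growth _ _ _ (C' + k * C2)) => n.
pose g : X -> R := r'^-1 *: (cst (C' + n%:R * (s + d)) - transfer_sum h n).
pose g' := g \min cst (C2 + n%:R * (d / k)).
have cs := @transfer_sum_continuous h n ch.
have cg : continuous g.
  by apply: continuousRZ; apply: continuousRD; [exact: continuousR_cst|exact: continuousRN].
have cg' : continuous g' by apply: continuousR_min => //; exact: continuousR_cst.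
have : 0 <= L g'.
  apply: (block_majoration lL Lp (m := n)) => // x Px.
  rewrite /g' /= le_min PC2// andbT /g.
  rewrite -(ler_pM2l r'0) [leRHS]mulrA mulfV ?gt_eqF// mul1r.
  rewrite -[leRHS]/(C' + n%:R * (s + d) - transfer_sum h n x).
  by rewrite (transfer_sumE h (P_dom Px)) lerBrDl; exact: H'.
rewrite LAB//.
have : A g' <= A g by apply: (mean_le mA) => // x; rewrite ge_min lexx.
have : B g' <= C2 + n%:R * (d / k).
  rewrite -(mean_cst mB (C2 + _)); apply: (mean_le mB) => // [|x]; first exact: continuousR_cst.
  by rewrite ge_min lexx orbT.
have -> : A g = r'^-1 * (C' + n%:R * (s + d) - n%:R * A h).
  rewrite (meanZ mA); last by apply: continuousRD; [exact: continuousR_cst|exact: continuousRN].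
  rewrite (meanD mA) ?(meanN mA) ?(mean_cst mA) ?invariant_transfer_sum//.
    exact: continuousR_cst.
  exact: continuousRN.
set a := A g'; set b := B g'; set Q := C' + _ - _; set W := C2 + _ => bW aQ ab0.
have h1 : (1 - t) * b <= (1 - t) * W by rewrite ler_wpM2l// subr_ge0 ltW.
have h2 : t * a <= t * (r'^-1 * Q) by rewrite ler_pM2l.
have h3 : 0 <= t * (r'^-1 * Q) + (1 - t) * W by lra.
have h4 : 0 <= Q + k * W.
  have := mulr_ge0 (divr_ge0 (ltW r'0) (ltW t0)) h3.
  rewrite (_ : r' / t * _ = Q + k * W)//.
  by rewrite /k; field; rewrite !gt_eqF.
have kW : k * W = k * C2 + n%:R * d.
  by rewrite /W mulrDr (mulrCA k) [k * (d / k)]mulrC divfK// gt_eqF.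
by move: h4; rewrite kW /Q; lra.
Qed.

Lemma restricted_mean (mu : probability (borelType X) R) (D : set (borelType X)) :
  measurable D -> 0 < fine (mu D) ->
  mean (fun f : X -> R => (fine (mu D))^-1 * Rintegral mu D f).
Proof.
move=> mD d0; split.
- split=> [u v /= cu cv|t u /= cu].
    by rewrite -mulrDr -RintegralD//; exact: continuous_integrable.
  rewrite mulrCA; congr (_ * _).
  by rewrite -[RHS]RintegralZl//; exact: continuous_integrable.
- move=> f cf f0; apply: mulr_ge0; first by rewrite invr_ge0 ltW.
  by apply: Rintegral_ge0.
- by rewrite Rintegral_cst// mul1r mulVf// gt_eqF.
Qed.

Local Notation Y := (essential_domain phi Delta).

(** * Ergodicity and growth for an extreme tangent functional *)

Section MaximalMeasure.
Variables (L : (X -> R) -> R) (mu : probability (borelType X) R).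
Hypothesis lL : linear_on (idfun : {rmorphism R -> R}) [set f : X -> R | continuous f] L.
Hypothesis Lp : le_on [set f : X -> R | continuous f] L tangent.
Hypothesis Lext : forall t A B, 0 < t < 1 ->
  linear_on (idfun : {rmorphism R -> R}) [set f : X -> R | continuous f] A ->
  linear_on (idfun : {rmorphism R -> R}) [set f : X -> R | continuous f] B ->
  le_on [set f : X -> R | continuous f] A tangent ->
  le_on [set f : X -> R | continuous f] B tangent ->
  (forall f, continuous f -> L f = t * A f + (1 - t) * B f) ->
  forall f, continuous f -> A f = L f.
Hypothesis muE : forall A, mu A = outer_mass L A.

Let iL : invariant_mean phi Delta L := below_tangent_invariant lL Lp.
Let mL : mean L := iL.1.

Let mu_preim (A : set (borelType X)) : measurable A -> mu (Delta `&` phi @^-1` A) = mu A.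
Proof. exact: (measure_preim oD cD cphi iL muE). Qed.

(** If [0 < mu B < 1], the normalized restrictions of [mu] to [B] and to its complement decompose
    [L] into tangent functionals, so extremality identifies the first one with [L]. A continuous
    function close to the indicator of a large compact part of [B] tells them apart. *)
Lemma maximal_measure_ergodic (B : set (borelType X)) : measurable B -> B `<=` Y ->
  Y `&` phi @^-1` B = B -> mu B = 0%E \/ mu B = 1%E.
Proof.
move=> mB BY invB; apply: contrapT => /not_orP[B0 B1].
pose t := fine (mu B); have tE : mu B = t%:E by rewrite fineK// fin_num_measure.
have t0 : 0 < t.
  rewrite lt_neqAle; apply/andP; split; last exact: fine_ge0.
  by apply/eqP => t0; apply: B0; rewrite tE -t0.
have t1 : t < 1.
  rewrite lt_neqAle; apply/andP; split; last by rewrite -lee_fin -tE probability_le1.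
  by apply/eqP => t1; apply: B1; rewrite tE t1.
have mC := measurableC mB.
have tC : fine (mu (~` B)) = 1 - t by rewrite probability_setC// tE.
pose A f := t^-1 * Rintegral mu B f.
pose A' f := (1 - t)^-1 * Rintegral mu (~` B) f.
have mA : mean A by exact: restricted_mean.
have mA' : mean A' by rewrite /A' -tC; apply: restricted_mean => //; rewrite tC subr_gt0.
have LE f : continuous f -> L f = Rintegral mu B f + Rintegral mu (~` B) f.
  move=> cf; rewrite (mean_integral mL muE)// -(setUv B) Rintegral_setU//.
    by apply: continuous_integrable => //; rewrite setUv.
  by rewrite /disj_set setICr.
have LA f : continuous f -> L f = t * A f + (1 - t) * A' f.
  by move=> cf; rewrite LE// /A /A' !mulrA !mulfV ?mul1r// gt_eqF// subr_gt0.
have iB f : continuous f -> Rintegral mu B (transfer phi Delta f) = Rintegral mu B f.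
  by move=> cf; exact: (integral_transfer oD cD cphi mu_preim).
have iA : invariant_mean phi Delta A by split => // f cf; rewrite /A iB.
have iA' : invariant_mean phi Delta A'.
  split => // f cf; congr (_ * _); have := LE _ (transfer_continuous oD cD cphi cf).
  by rewrite iL.2// iB// LE// => /addrI.
have t01 : 0 < t < 1 by rewrite t0.
have Ap : le_on [set f : X -> R | continuous f] A tangent.
  exact: (below_tangent_face t01 lL Lp iA mA' LA).
have A'p : le_on [set f : X -> R | continuous f] A' tangent.
  apply: (below_tangent_face (t := 1 - t) _ lL Lp iA' mA) => [|f cf]; first lra.
  by rewrite LA//; lra.
have [lA _ _] := mA; have [lA' _ _] := mA'.
have AL := Lext t01 lA lA' Ap A'p LA.
(* The estimates below give [t - e < t * (t + e)], that is [t * (1 - t) < e * (1 + t)], which fails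
   for this [e] since [1 + t < 2]. *)
pose e := t * (1 - t) / 4; have e0 : 0 < e by rewrite divr_gt0// mulr_gt0// subr_gt0.
have := mass_radon mL muE mB; rewrite tE => radB.
have : ((t - e)%:E < ereal_sup [set mu K | K in [set K | compact K /\ K `<=` B]])%E.
  by rewrite -radB lte_fin; lra.
move=> /ereal_sup_gt[_ [K [cK KB] <-]] teK.
have {}cK : closed K by apply: compact_closed => //; exact: hausdorff_compact_space.
have mK := closed_measurable cK.
have [h [ch h01 h1 Lh]] := measure_ge_mean mL muE cK e0.
have Kt : (mu K <= t%:E)%E by rewrite -tE le_measure ?inE.
have kE : mu K = (fine (mu K))%:E by rewrite fineK// fin_num_measure.
have : fine (mu K) <= Rintegral mu B h.
  rewrite (_ : fine (mu K) = Rintegral mu B (\1_K : borelType X -> R)).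
    apply: le_Rintegral => //.
    - apply: (@bounded_measurable_integrable _ _ _ _ _ 1) => //.
        exact: measurable_indic.
      by move=> x; rewrite ?indicE; case: (x \in K); rewrite ?normr1 ?normr0.
    - exact: continuous_integrable.
    - move=> x Bx; rewrite ?indicE; case: (boolP (x \in K)) => [|_].
        by rewrite inE => /h1 ->.
      by case/andP: (h01 x).
  by rewrite /Rintegral integral_indic// setIidl.
have -> : Rintegral mu B h = t * L h by rewrite -AL// /A mulrA mulfV ?mul1r// gt_eqF.
move: teK Kt Lh; rewrite kE -EFinD !lte_fin !lee_fin => teK Kt Lh H.
have : t * L h <= t * (t + e) by rewrite ler_pM2l//; lra.
have : t * e <= e by rewrite ler_piMl// ltW.
have : 4 * e = t * (1 - t) by rewrite /e; field.
rewrite /= in H.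
move: (e) (t) (fine (mu K)) (L h) e0 t0 t1 H teK Lh => {}e u k l.
lra.
Qed.

Lemma maximal_measure_Erg : Erg Y phi mu.
Proof.
have [mY Y0] := measure_essential_domain oD cD cphi mu_preim.
split => //.
- exact: (mass_radon mL muE).
- by move=> B mB _; exact: (measure_essential_preim oD cD cphi mu_preim).
- exact: maximal_measure_ergodic.
Qed.

(* Katznelson and Weiss: the orbit of [x] is cut in segments along which [P] is
   small, and in single steps at the points of the set where [h >= 1]. *)
Lemma segmentation c K N (h : X -> R) n x : 0 <= K -> c <= K ->
  (forall n x, 0 < P n x -> ln (P n x) <= n%:R * K) ->
  (forall y, 0 <= h y) ->
  (forall y, (exists2 k, (0 < k <= N)%N & P k y < expR (k%:R * c)) \/ 1 <= h y) ->
  0 < P n x -> ln (P n x) <= N%:R * (K - c) + n%:R * c + (K - c) * S h n x.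
Proof.
move=> K0 cK PK h0 hN.
elim: n {-2}n (leqnn n) x => [|m IH] n nm x Px.
  move: nm Px; rewrite leqn0 => /eqP -> _; rewrite P0 ln1 /= mul0r !addr0.
  by rewrite mulr0 addr0 mulr_ge0// subr_ge0.
have Kc0 : 0 <= K - c by rewrite subr_ge0.
have [nN|Nn] := leqP n N.
  have : n%:R * (K - c) <= N%:R * (K - c) by rewrite ler_wpM2r// ler_nat.
  have : 0 <= (K - c) * S h n x by rewrite mulr_ge0// birkhoff_ge0.
  by have := PK _ _ Px; lra.
case: (hN x) => [[k /andP[k0 kN] Pk]|hx].
  have kn : (k <= n)%N by rewrite (leq_trans kN)// ltnW.
  have e : (n = k + (n - k))%N by rewrite subnKC.
  have := Px; rewrite {1}e => /P_split[Pk0 Pnk]; rewrite -e => H.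
  have /IH : (n - k <= m)%N.
    by rewrite leq_subLR (leq_trans nm)// -[m.+1]addn1 addnC leq_add2r.
  move=> /(_ _ Pnk); rewrite natrB//.
  have : ln (P k x) < k%:R * c by rewrite -(expRK (k%:R * c)) ltr_ln ?posrE// expR_gt0.
  have -> : S h n x = S h k x + S h (n - k) (iter k phi x) by rewrite -birkhoff_addn -e.
  have : 0 <= (K - c) * S h k x by rewrite mulr_ge0// birkhoff_ge0.
  by rewrite mulrDr; lra.
case: n nm Nn Px => // n nm Nn Px.
have := Px; rewrite -{1}add1n => /P_split[P1 Pn]; rewrite add1n /= => H.
have := IH n nm _ Pn; have := PK _ _ P1; rewrite mul1r -natr1 mulrDr.
have : (K - c) <= (K - c) * h x by rewrite ler_peMr.
lra.
Qed.

(** An integer [k] instead of a real constant makes this a countable union of closed sets. *)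
Definition growing c : set X :=
  [set x | exists k : nat, forall n, expR (n%:R * c) <= k%:R * P n x].

Lemma growing_measurable c : measurable (growing c : set (borelType X)).
Proof.
rewrite (_ : growing c =
    \bigcup_k \bigcap_n [set x | expR (n%:R * c) <= k%:R * P n x]); last first.
  by apply/seteqP; split=> x [k];
    [move=> H; exists k => // n _; exact: H|move=> _ H; exists k => n; exact: H].
apply: bigcupT_measurable => k; apply: bigcapT_measurable => n.
apply: closed_measurable; apply: (@closed_ge_continuous _ _ (k%:R *: P n)).
exact: continuousRZ.
Qed.

Lemma growing_preim c x : growing c x -> growing c (phi x).
Proof.
move=> [k H]; have [K _ PK] := ln_P_small ltr01.
exists (Num.trunc (k%:R * expR (K + 1 - c))).+1 => n.
have := H n.+1; rewrite -natr1 mulrDl mul1r expRD => h.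
have Pn0 : 0 <= P n (phi x) by [].
have P1 : P 1 x <= expR (K + 1).
  have [P1|P1] := ltP 0 (P 1 x).
    by rewrite -(ler_ln) ?posrE ?expR_gt0// expRK; have := PK _ _ P1; rewrite mul1r.
  by apply: le_trans P1 _; exact: expR_ge0.
have : expR (n%:R * c) * expR c <= k%:R * (expR (K + 1) * P n (phi x)).
  apply: le_trans h _; apply: ler_wpM2l => //.
  by rewrite -add1n; apply: le_trans (PD 1 n x) _; exact: ler_wpM2r.
rewrite -ler_pdivlMr ?expR_gt0// -expRN => {}h; apply: le_trans h _.
rewrite -mulrA mulrCA mulrC -!mulrA.
apply: (@le_trans _ _ (k%:R * expR (K + 1 - c) * P n (phi x))).
  by rewrite le_eqVlt; apply/orP; left; apply/eqP; rewrite (expRD (K + 1)); ring.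
by apply: ler_wpM2r => //; apply: ltW; exact: truncnS_gt.
Qed.

(** Let [F N] be the set of the points without any time [k <= N] at which [P k x < expR (k c)]. If
    [growing c] were null, [F N] would have small measure for large [N]. With [h >= 1] on [F N],
    [segmentation] makes [- (K - c) h] admissible with the slope [c], which bounds [L h] from
    below. *)
Lemma growing_not_null c : c < 0 -> mu (growing c) <> 0%E.
Proof.
move=> c0 D0.
have [K K0 PK] : exists2 K, 0 <= K & forall n x, 0 < P n x -> ln (P n x) <= n%:R * K.
  have [M PM] := continuous_compact_bounded (@cP 1%N).
  have M0 : 0 <= M by apply: le_trans (PM point).
  exists (ln (M + 1)); first by rewrite ln_ge0// lerDr.
  elim=> [|n IH] x Px; first by rewrite P0 ln1 mul0r.
  have := Px; rewrite -{1}add1n => /P_split[P1 Pn]; rewrite add1n -natr1 mulrDl mul1r.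
  have : ln (P 1 x) <= ln (M + 1).
    by rewrite ler_ln ?posrE//; [have := PM x; rewrite ger0_norm//; lra|lra].
  by have := IH _ Pn; rewrite /=; lra.
pose F N : set X := ~` \bigcup_(k in [set k | (0 < k <= N)%N]) [set x | P k x < expR (k%:R * c)].
have cF N : closed (F N).
  apply: open_closedC; apply: bigcup_open => k _.
  rewrite (_ : [set x | _] = P k @^-1` [set r | r < expR (k%:R * c)]%R)//.
  by apply: open_comp => [x _|]; [exact: cP|exact: open_lt].
have mF N := closed_measurable (cF N).
have FD : \bigcap_N F N `<=` growing c.
  move=> x Fx; exists 1 => n; rewrite mul1r leNgt; apply/negP => Pn.
  case: n Pn => [|n] Pn; first by move: Pn; rewrite mul0r expR0 P0 ltxx.
  by apply: (Fx n.+1 I); exists n.+1 => //=; rewrite leqnn.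
have F0 : mu (\bigcap_N F N) = 0%E.
  apply/eqP; rewrite -measure_le0 -D0 le_measure ?inE//.
    exact: bigcapT_measurable.
  exact: growing_measurable.
have cvgF := nonincreasing_cvg_mu (mu := mu) (F := F) _ mF (bigcapT_measurable mF).
(* The mean of [h] will be at most [2 e], half of the lower bound [- c / (K - c)] coming from
   [segmentation]. *)
pose e := - c / (4 * (K - c)).
have Kc0 : 0 < K - c by rewrite subr_gt0 (lt_le_trans c0).
have e0 : 0 < e by rewrite divr_gt0 ?oppr_gt0// mulr_gt0.
have [N muFN] : exists N, (mu (F N) < e%:E)%E.
  have [|||N _ HN] := cvgF _ _ [set y | (y < e%:E)%E].
  - by apply: le_lt_trans (probability_le1 mu (mF _)) _; rewrite ltry.
  - move=> n m nm; apply/subsetPset => x Fm [k /= kn Pk]; apply: Fm; exists k => //=.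
    by case/andP: kn => -> /leq_trans ->.
  - apply: open_nbhs_nbhs; split; first exact: open_ereal_lt_ereal.
    by change (mu (\bigcap_N F N) < e%:E)%E; rewrite F0 lte_fin.
  by exists N; apply: (HN N) => /=.
have [h [ch h01 h1 Lh]] := measure_ge_mean mL muE (cF N) e0.
have h0 y : 0 <= h y by case/andP: (h01 y).
have : L (- (K - c) *: h) <= c.
  apply: (below_tangent_admissible Lp); first exact: continuousRZ.
  exists 1, (N%:R * (K - c)); split => // n x Px; rewrite birkhoffZ mul1r.
  have := @segmentation c K N h n x K0 _ PK h0 _ Px.
  move=> /(_ (ltW (lt_le_trans c0 K0))) H.
  have /H : forall y, (exists2 k, (0 < k <= N)%N & P k y < expR (k%:R * c)) \/ 1 <= h y.
    move=> y; have [Fy|nFy] := pselect (F N y); first by right; rewrite h1.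
    by left; move: nFy; rewrite /F => /contrapT[k kN Pk]; exists k.
  lra.
rewrite lL.2// mulNr => H.
have Le : L h <= e + e.
  by rewrite -lee_fin EFinD; apply: le_trans Lh _; rewrite leeD2r// ltW.
have : (K - c) * L h <= (K - c) * (e + e) by rewrite ler_pM2l.
have : (K - c) * (e + e) = - c / 2 by rewrite /e; field; rewrite gt_eqF.
lra.
Qed.

(** The set [growing c] is only forward invariant. The union of its successive preimages is
    invariant in the strict sense required by ergodicity, and has the same measure because the
    preimages increase and have equal measures. *)
Lemma measure_growing c : c < 0 -> mu (growing c) = 1%E.
Proof.
move=> c0; have mG := growing_measurable c.
have [mY Y0] := measure_essential_domain oD cD cphi mu_preim.
have mess (A : set (borelType X)) : measurable A -> mu (Y `&` A) = mu A.
  exact: (measure_setI_essential oD cD cphi mu_preim).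
pose G k : set X := Y `&` iter k phi @^-1` growing c.
have GS k : G k.+1 = Y `&` phi @^-1` G k.
  apply/seteqP; split=> x.
    move=> [Yx]; rewrite /= -iterS iterSr => Gx; split => //.
    by split => //; exact: essential_domain_stable.
  by move=> [Yx [_ Gx]]; split => //; rewrite /= -iterS iterSr.
have mGk k : measurable (G k : set (borelType X)) /\ mu (G k) = mu (growing c).
  elim: k => [|k [mk ek]]; first by split; [exact: measurableI|rewrite mess].
  rewrite GS essential_preimE; split.
    by apply: measurableI => //; exact: (preim_measurable oD cphi).
  by rewrite mess ?mu_preim//; exact: (preim_measurable oD cphi).
have GG k : G k `<=` G k.+1.
  by move=> x [Yx Gx]; split => //=; exact: growing_preim.
have ndG : nondecreasing_seq G.
  by apply/nondecreasing_seqP => k; apply/subsetPset; exact: GG.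
have mU : measurable (\bigcup_k G k : set (borelType X)).
  by apply: bigcupT_measurable => k; case: (mGk k).
have muU : mu (\bigcup_k G k) = mu (growing c).
  have := nondecreasing_cvg_mu (mu := mu) (fun k => (mGk k).1) mU ndG.
  rewrite (_ : mu \o G = cst (mu (growing c))); last first.
    by apply/funext => k; exact: (mGk k).2.
  by move=> /cvg_lim <-//; rewrite lim_cst.
have UY : \bigcup_k G k `<=` Y by move=> x [k _ []].
have invU : Y `&` phi @^-1` (\bigcup_k G k) = \bigcup_k G k.
  apply/seteqP; split=> x.
    by move=> [Yx [k _ Gk]]; exists k.+1 => //; rewrite GS.
  move=> [k _ Gk]; split; first by case: Gk.
  by exists k => //; have := GG _ _ Gk; rewrite GS => -[].
by case: (maximal_measure_ergodic mU UY invU); rewrite muU => // /growing_not_null.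
Qed.

Lemma ae_growing : {ae mu, forall x : borelType X, forall j : nat, growing (- j.+1%:R^-1) x}.
Proof.
have mG j := growing_measurable (- (j.+1%:R^-1 : R)).
have : mu.-negligible (\bigcup_j ~` growing (- j.+1%:R^-1)).
  apply: negligible_bigcup => j; apply/negligibleP; first exact: measurableC.
  by apply: measure1_setC => //; apply: measure_growing; rewrite oppr_lt0 invr_gt0.
apply: negligibleS => x /= /existsNP[j xj]; exists j => //.
Qed.

End MaximalMeasure.

Theorem exists_maximal_ergodic : exists2 mu : probability (borelType X) R, Erg Y phi mu &
  {ae mu, forall x : borelType X, forall j : nat, growing (- j.+1%:R^-1) x}.
Proof.
have [|||L [lL Lp Lext]] := @exists_extreme_le R R (idfun : {rmorphism R -> R}) _
   [set f : X -> R | continuous f] _ _ _ tangent tangent_sublinear.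
- by move=> x; exact: cvg_cst.
- by move=> u v; exact: continuousRD.
- by move=> t u; exact: continuousRZ.
have [mu muE] := exists_mass (below_tangent_mean lL Lp).
exists mu; first exact: (maximal_measure_Erg lL Lp Lext muE).
exact: (ae_growing lL Lp Lext muE).
Qed.

End Growth.

(** * Spectral radius and growth rate *)

Section ComplexModulus.
Variable R : realType.
Implicit Types k l : R[i].

Definition cabs k : R := complex.Re `|k|.

Lemma cabsE k : `|k| = (cabs k)%:C.
Proof. by rewrite /cabs RRe_real// ger0_real. Qed.

Lemma cabs_ge0 k : 0 <= cabs k.
Proof. by rewrite -lecR -cabsE; exact: normr_ge0. Qed.

Lemma cabsM k l : cabs (k * l) = cabs k * cabs l.
Proof. by apply: complexI; rewrite rmorphM -!cabsE normrM. Qed.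

Lemma cabsV k : cabs k^-1 = (cabs k)^-1.
Proof. by apply: complexI; rewrite fmorphV -!cabsE normfV. Qed.

Lemma cabs_eq0 k : (cabs k == 0) = (k == 0).
Proof. by rewrite -(inj_eq (@complexI R)) -cabsE normr_eq0. Qed.

Lemma cabs_gt0 k : (0 < cabs k) = (k != 0).
Proof. by rewrite lt_def cabs_ge0 andbT cabs_eq0. Qed.

Lemma cabsX k n : cabs (k ^+ n) = cabs k ^+ n.
Proof. by apply: complexI; rewrite rmorphXn -!cabsE normrX. Qed.

Lemma cabsN k : cabs (- k) = cabs k.
Proof. by rewrite /cabs normrN. Qed.

Lemma cabsD k l : cabs (k + l) <= cabs k + cabs l.
Proof. by rewrite -lecR rmorphD -!cabsE ler_normD. Qed.

Lemma cabs_real (x : R) : cabs x%:C = `|x|.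
Proof.
by rewrite /cabs normc_def /= expr0n /= addr0 sqrtr_sqr.
Qed.

Lemma cabs_Re k : `|complex.Re k| <= cabs k.
Proof. by rewrite -lecR -cabsE normc_ge_Re. Qed.

Lemma cabs_le_coordinates (x y x' y' : R) :
  cabs ((x +i* y)%C - (x' +i* y')%C) <= `|x - x'| + `|y - y'|.
Proof.
have -> : (x +i* y)%C - (x' +i* y')%C = (x - x')%:C + ((y - y')%:C * 'i%C).
  by apply/eqP; rewrite eq_complex /=; apply/andP; split; apply/eqP; lra.
apply: le_trans (cabsD _ _) _; rewrite cabsM !cabs_real.
suff -> : cabs 'i%C = 1 by rewrite mulr1.
by rewrite /cabs normc_def /= expr0n expr1n add0r sqrtr1.
Qed.

End ComplexModulus.

Section LinearMap.
Variables (R : realType) (U V : lmodType R[i]) (S : U -> V) (lS : linear S).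
Let L : {linear U -> V} := HB.pack S (GRing.isLinear.Build _ _ _ _ S lS).

Lemma linear_funD u v : S (u + v) = S u + S v.
Proof. exact: (linearD L). Qed.

Lemma linear_funB u v : S (u - v) = S u - S v.
Proof. exact: (linearB L). Qed.

Lemma linear_funZ k u : S (k *: u) = k *: S u.
Proof. exact: (linearZ_LR L). Qed.

Lemma linear_fun_sum I r (P : pred I) (F : I -> U) :
  S (\sum_(i <- r | P i) F i) = \sum_(i <- r | P i) S (F i).
Proof. exact: (linear_sum L). Qed.

End LinearMap.

(** * Convergent series and geometric domination *)

Section Summation.
Variables (R : realType) (E : normedModType R[i]).
Implicit Types (u v : nat -> E) (s : E).

Lemma rnormZc (k : R[i]) (v : E) : rnorm (k *: v) = cabs k * rnorm v.
Proof. exact: rnormZ. Qed.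

Lemma rnormN (v : E) : rnorm (- v) = rnorm v.
Proof. by rewrite /rnorm normrN. Qed.

Lemma rnorm0 : rnorm (0 : E) = 0.
Proof. by rewrite /rnorm normr0. Qed.

Lemma rnormB_le (v w : E) : rnorm v <= rnorm (v - w) + rnorm w.
Proof. by rewrite -{1}(subrK w v); exact: rnormD. Qed.

Lemma rnormBC (v w : E) : rnorm (v - w) = rnorm (w - v).
Proof. by rewrite -rnormN opprB. Qed.

Definition sums_to u s := forall e : R, 0 < e -> exists N0, forall N, (N0 <= N)%N ->
  rnorm (s - \sum_(n < N) u n) <= e.

Lemma sums_to_unique u s t : sums_to u s -> sums_to u t -> s = t.
Proof.
move=> us ut; apply/eqP; rewrite -subr_eq0; apply/eqP; apply: rnorm_eq0.
apply/eqP; rewrite eq_le rnorm_ge0 andbT; apply/ler_addgt0Pr => e e0; rewrite add0r.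
have e20 : 0 < e / 2 by rewrite divr_gt0.
have [N sN] := us _ e20; have [M tM] := ut _ e20.
have := sN _ (leq_maxl N M); have := tM _ (leq_maxr N M).
set S := \sum_(n < _) u n; rewrite (rnormBC t).
have := rnormD (s - S) (S - t); rewrite addrA subrK; lra.
Qed.

Lemma sums_toD u v s t : sums_to u s -> sums_to v t ->
  sums_to (fun n => u n + v n) (s + t).
Proof.
move=> us vt e e0; have e20 : 0 < e / 2 by rewrite divr_gt0.
have [N sN] := us _ e20; have [M tM] := vt _ e20; exists (maxn N M) => K.
rewrite geq_max => /andP[NK MK]; rewrite big_split/= opprD addrACA.
by apply: le_trans (rnormD _ _) _; have := sN _ NK; have := tM _ MK; lra.
Qed.

Lemma sums_toZ k u s : sums_to u s -> sums_to (fun n => k *: u n) (k *: s).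
Proof.
move=> us e e0; have k0 : 0 < cabs k + 1 by rewrite ltr_wpDl// cabs_ge0.
have [N sN] := us (e / (cabs k + 1)) (divr_gt0 e0 k0); exists N => M /sN H.
rewrite -scaler_sumr -scalerBr rnormZc.
apply: (@le_trans _ _ ((cabs k + 1) * (e / (cabs k + 1)))).
  by apply: ler_pM; rewrite ?cabs_ge0 ?rnorm_ge0// lerDl.
by rewrite mulrC divfK// gt_eqF.
Qed.

Lemma sums_to_linear (T : E -> E) (M : R) u s : linear T ->
  (forall v : E, rnorm (T v) <= M * rnorm v) -> sums_to u s ->
  sums_to (fun n => T (u n)) (T s).
Proof.
move=> lT TM us e e0; have M0 : 0 < `|M| + 1 by rewrite ltr_wpDl.
have [N sN] := us (e / (`|M| + 1)) (divr_gt0 e0 M0); exists N => K /sN H.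
rewrite -(linear_fun_sum lT) -(linear_funB lT); apply: le_trans (TM _) _.
apply: (@le_trans _ _ ((`|M| + 1) * (e / (`|M| + 1)))).
  apply: (@le_trans _ _ ((`|M| + 1) * rnorm (s - \sum_(n < K) u n))).
    by rewrite ler_wpM2r ?rnorm_ge0//; have := ler_norm M; lra.
  by apply: ler_wpM2l => //; exact: ltW.
by rewrite mulrC divfK// gt_eqF.
Qed.

Lemma sums_to_shift u s : sums_to u s -> sums_to (fun n => u n.+1) (s - u 0%N).
Proof.
move=> us e e0; have [N sN] := us e e0; exists N => M NM.
have := sN M.+1 (leqW NM); rewrite big_ord_recl opprD addrA.
exact.
Qed.

Lemma sums_to_drop u s m : sums_to u s ->
  sums_to (fun n => u (m + n)%N) (s - \sum_(n < m) u n).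
Proof.
move=> us e /us[N sN]; exists N => M NM.
have -> : s - \sum_(n < m) u n - \sum_(n < M) u (m + n)%N = s - \sum_(n < m + M) u n.
  by rewrite big_split_ord opprD addrA.
by apply: sN; rewrite (leq_trans NM)// leq_addl.
Qed.

Lemma geometric_sum_le u (C q : R) N : 0 <= q < 1 ->
  (forall n, rnorm (u n) <= C * q ^+ n) -> rnorm (\sum_(n < N) u n) <= C / (1 - q).
Proof.
move=> /andP[q0 q1] uC.
have C0 : 0 <= C by have := uC 0%N; rewrite expr0 mulr1; exact: le_trans (rnorm_ge0 _).
apply: (@le_trans _ _ (\sum_(n < N) C * q ^+ n)).
  elim: N => [|N IH]; first by rewrite !big_ord0 rnorm0.
  rewrite !big_ord_recr/=; apply: le_trans (rnormD _ _) _.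
  by apply: lerD => //; exact: uC.
rewrite -mulr_sumr; apply: ler_wpM2l => //.
rewrite -[leRHS]mul1r ler_pdivlMr ?subr_gt0// mulrC -opprB mulNr -subrX1 opprB.
by rewrite gerBl exprn_ge0.
Qed.

Lemma sums_to_norm u s (C q : R) : 0 <= q < 1 -> (forall n, rnorm (u n) <= C * q ^+ n) ->
  sums_to u s -> rnorm s <= C / (1 - q).
Proof.
move=> q01 uC us; apply/ler_addgt0Pr => e e0; have [N sN] := us e e0.
have := geometric_sum_le N q01 uC.
have := rnormB_le s (\sum_(n < N) u n); have := sN N (leqnn N); lra.
Qed.

(** The form of completeness used by Neumann series; it passes from [D] to [C(X, D)] by summing
    pointwise. *)
Definition geometrically_complete := forall u (C q : R), 0 <= q < 1 ->
  (forall n, rnorm (u n) <= C * q ^+ n) -> exists s, sums_to u s.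

End Summation.

(** * Resolvents and the growth of iterates *)

Section Gelfand.
Variables (R : realType) (E : normedModType R[i]).
Hypothesis cE : geometrically_complete E.
Variables (T : E -> E) (M : R) (rho : R).
Hypotheses (lT : linear T) (TM : forall v, rnorm (T v) <= M * rnorm v).
Hypothesis rho_ge0 : 0 <= rho.
Hypothesis rhoT : forall q, rho < q -> exists C : R, forall n v,
  rnorm (iter n T v) <= C * q ^+ n * rnorm v.

Definition inverts (z : R[i]) (S : E -> E) := [/\ bounded_op S,
  forall v, S (z *: v - T v) = v & forall v, z *: S v - T (S v) = v].

Let iterT_linear n (k : R[i]) v w : iter n T (k *: v + w) = k *: iter n T v + iter n T w.
Proof. by elim: n => //= n ->; exact: lT. Qed.

Lemma neumann z : rho < cabs z -> exists S, inverts z S.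
Proof.
move=> rz; have z0 : z != 0 by rewrite -cabs_gt0 (le_lt_trans rho_ge0).
have cz0 : 0 < cabs z by rewrite cabs_gt0.
have [q [rq qz]] : exists q, rho < q /\ q < cabs z.
  by exists ((rho + cabs z) / 2); split; lra.
have q0 : 0 <= q by exact: le_trans rho_ge0 (ltW rq).
have [C HC] := rhoT rq.
have r01 : 0 <= q / cabs z < 1 by rewrite divr_ge0 ?cabs_ge0//= ltr_pdivrMr// mul1r.
pose u v n := z ^- n.+1 *: iter n T v.
have uC v n : rnorm (u v n) <= C * rnorm v / cabs z * (q / cabs z) ^+ n.
  rewrite /u rnormZc cabsV cabsX.
  apply: (@le_trans _ _ ((cabs z ^+ n.+1)^-1 * (C * q ^+ n * rnorm v))).
    by rewrite ler_wpM2l ?invr_ge0 ?exprn_ge0 ?cabs_ge0.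
  rewrite expr_div_n exprS invfM le_eqVlt; apply/orP; left; apply/eqP.
  by move: (cabs z ^+ n)^-1 (cabs z)^-1 (q ^+ n) (rnorm v) => b d f g; ring.
have /choice[S HS] : forall v, exists s, sums_to (u v) s.
  by move=> v; apply: cE (uC v).
have SE v s : sums_to (u v) s -> S v = s by move=> /(sums_to_unique (HS v)).
have lS : linear S.
  move=> k v w; apply: SE.
  have := sums_toD (sums_toZ k (HS v)) (HS w).
  by congr sums_to; apply/funext => n; rewrite /u iterT_linear scalerDr !scalerA mulrC.
have TS v : T (S v) = z *: S v - v.
  have h1 := sums_to_linear lT TM (HS v).
  have := sums_toZ z (sums_to_shift (HS v)).
  have -> : (fun n => z *: u v n.+1) = (fun n => T (u v n)).
    apply/funext => n; rewrite /u (linear_funZ lT) scalerA; congr (_ *: _).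
    by rewrite [z ^+ n.+2]exprS invfM mulrA mulfV// mul1r.
  move=> /(sums_to_unique h1) ->.
  by rewrite scalerBr /u /= scalerA expr1 mulfV// scale1r.
have ST v : S (T v) = T (S v).
  apply: SE; have := sums_to_linear lT TM (HS v).
  by congr sums_to; apply/funext => n; rewrite /u (linear_funZ lT) -iterS iterSr.
exists S; split.
- split => //; exists (C / cabs z / (1 - q / cabs z)) => v.
  apply: le_trans (sums_to_norm r01 (uC v) (HS v)) _.
  by rewrite le_eqVlt; apply/orP; left; apply/eqP; ring.
- by move=> v; rewrite (linear_funB lS) (linear_funZ lS) ST TS opprB addrC subrK.
- by move=> v; rewrite TS opprB addrC subrK.
Qed.

Lemma spectrum_le z : op_spectrum T z -> cabs z <= rho.
Proof. by move=> Tz; rewrite leNgt; apply/negP => /neumann. Qed.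

(** The resolvent identity [S' - S = - (z' - z) S S'] calls for a bound on [S] only. The smallness
    condition absorbs half of the norm of [S' v], so that [S'] gets the bound [2 K], uniform in
    [z']. *)
Lemma inverts_perturb z z' S S' (K : R) : inverts z S -> inverts z' S' ->
  0 <= K -> (forall v, rnorm (S v) <= K * rnorm v) -> cabs (z' - z) * K <= 1 / 2 ->
  forall v, rnorm (S' v) <= 2 * K * rnorm v /\
    rnorm (S' v - S v) <= cabs (z' - z) * (2 * K) * K * rnorm v.
Proof.
move=> [[lS _] Sl _] [_ _ Sr'] K0 SK zK v.
have e : S' v - S v = - ((z' - z) *: S (S' v)).
  have := Sl (S' v).
  have -> : z *: S' v - T (S' v) = v - (z' - z) *: S' v.
    by rewrite -{3}(Sr' v) scalerBl opprB [RHS]addrC [RHS]addrA subrK.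
  by rewrite (linear_funB lS) (linear_funZ lS) => h; rewrite -{1}h addrAC subrr add0r.
have n1 : rnorm (S' v - S v) <= cabs (z' - z) * K * rnorm (S' v).
  by rewrite e rnormN rnormZc -mulrA; apply: ler_wpM2l; [exact: cabs_ge0|exact: SK].
have n2 : rnorm (S' v) <= 2 * K * rnorm v.
  have := rnormB_le (S' v) (S v); have := SK v.
  have : cabs (z' - z) * K * rnorm (S' v) <= 1 / 2 * rnorm (S' v).
    by apply: ler_wpM2r => //; exact: rnorm_ge0.
  by lra.
split => //; apply: le_trans n1 _.
have := ler_wpM2l (mulr_ge0 (cabs_ge0 (z' - z)) K0) n2.
move=> /le_trans; apply; rewrite le_eqVlt; apply/orP; left; apply/eqP; ring.
Qed.

Lemma inverts_norm z S : inverts z S ->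
  exists2 K, 0 < K & forall v, rnorm (S v) <= K * rnorm v.
Proof.
move=> [[_ [K SK]] _ _]; exists (`|K| + 1); first by rewrite ltr_wpDl.
move=> v; apply: le_trans (SK v) _; apply: ler_wpM2r; first exact: rnorm_ge0.
by have := ler_norm K; lra.
Qed.

Lemma geometric_small (C r e : R) : 0 <= r < 1 -> 0 < e ->
  exists N, forall n, (N <= n)%N -> C * r ^+ n <= e.
Proof.
move=> /andP[r0 r1] e0.
have r1' : `|r| < 1 by rewrite ger0_norm.
have : C * r ^+ n @[n --> \oo] --> (0 : R).
  by rewrite -(mulr0 C); apply: cvgM; [exact: cvg_cst|exact: cvg_expr].
by move=> /cvgr_le/(_ _ e0)[N _ HN]; exists N => n Nn; exact: HN.
Qed.

Section Circle.
Hypothesis rho_gt0 : 0 < rho.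
Hypothesis resolvent_circle : forall z, cabs z = rho -> exists S, inverts z S.

(** Compactness of the circle is drawn from that of the segment [[- rho, rho]], over which each half
    circle is a graph; [s] is the sign of the imaginary part. The bound is locally uniform by
    [inverts_perturb]. *)
Lemma half_circle_bound (s : R) : exists K, 0 < K /\
  forall x S, - rho <= x <= rho -> inverts (x +i* (s * Num.sqrt (rho ^+ 2 - x ^+ 2)))%C S ->
  s ^+ 2 = 1 -> forall v, rnorm (S v) <= K * rnorm v.
Proof.
have [s1|s1] := eqVneq (s ^+ 2) 1; last by exists 1; split => // x S _ _ /eqP; rewrite (negbTE s1).
pose g x := s * Num.sqrt (rho ^+ 2 - x ^+ 2).
pose Q (K : R) x := forall S, inverts (x +i* g x)%C S -> forall v, rnorm (S v) <= K * rnorm v.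
have gc : continuous g.
  move=> x; apply: cvgM; first exact: cvg_cst.
  apply: continuous_comp; last exact: sqrt_continuous.
  by apply: cvgB; [exact: cvg_cst|exact: exprn_continuous].
have circ x : - rho <= x <= rho -> cabs (x +i* g x)%C = rho.
  move=> xr; rewrite /cabs normc_def /= /g exprMn s1 mul1r sqr_sqrtr.
    by rewrite addrC subrK sqrtr_sqr ger0_norm.
  rewrite subr_ge0 -(ger0_norm rho_ge0) -[_ ^+ 2]ger0_norm ?sqr_ge0// normrX.
  by apply: lerXn2r; rewrite ?nnegrE ?normr_ge0// (ger0_norm rho_ge0) ler_norml.
have FF : Filter (pinfty_nbhs R) by exact: _.
have := @segment_compact R (- rho) rho.
rewrite compact_near_coveringP => /(_ R (pinfty_nbhs R) Q FF)[].
- move=> x; rewrite /= in_itv /= => xr; have [S0 iS0] := resolvent_circle (circ x xr).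
  have [K K0 SK] := inverts_norm iS0.
  (* Two coordinates within [d] put the points within [2 d], and [2 d * K = 1 / 2] is what
     [inverts_perturb] asks for. *)
  pose d := (4 * K)^-1; have d0 : 0 < d by rewrite invr_gt0 mulr_gt0.
  have near1 : \forall y \near (x : R), `|(x : R) - y| < d.
    have cid : (fun y : R => y) @ (x : R) --> (x : R) by exact: cvg_id.
    by move/cvgrPdist_lt : cid => /(_ _ d0).
  have near2 : \forall y \near x, `|g x - g y| < d.
    by have /cvgrPdist_lt := gc (x : R); exact.
  exists ([set y | `|x - y| < d /\ `|g x - g y| < d], [set k | 2 * K <= k]).
    split => /=; first exact: (filterI near1 near2).
    by apply: nbhs_pinfty_ge; rewrite num_real.
  move=> [y k] /= [[xy gxy] Kk] S iS v.
  have [|+ _] := @inverts_perturb _ _ _ _ K iS0 iS (ltW K0) SK _ v.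
    have cle : cabs ((y +i* g y)%C - (x +i* g x)%C) <= d + d.
      apply: le_trans (cabs_le_coordinates _ _ _ _) _.
      by rewrite distrC (distrC (g y)) lerD// ltW.
    apply: (@le_trans _ _ ((d + d) * K)); first by rewrite ler_pM2r.
    by rewrite /d le_eqVlt; apply/orP; left; apply/eqP; field; rewrite gt_eqF.
  move=> /le_trans; apply; apply: ler_wpM2r => //; exact: rnorm_ge0.
- move=> K [_ HK]; exists (`|K| + 1); split; first by rewrite ltr_wpDl.
  move=> x S xr iS _ v; apply: (HK (`|K| + 1) _ x) => //.
  by have := ler_norm K; lra.
Qed.

Lemma circle_bound : exists K, 0 < K /\
  forall z S, cabs z = rho -> inverts z S -> forall v, rnorm (S v) <= K * rnorm v.
Proof.
have [K [K0 HK]] := half_circle_bound 1; have [K' [K'0 HK']] := half_circle_bound (-1).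
exists (K + K'); split; first exact: addr_gt0.
move=> [x y] S zr iS v.
have xyr : x ^+ 2 + y ^+ 2 = rho ^+ 2.
  by rewrite -zr /cabs normc_def /= sqr_sqrtr// addr_ge0// sqr_ge0.
have xr : - rho <= x <= rho.
  by rewrite -ler_norml; have := cabs_Re (x +i* y)%C; rewrite zr.
have y2 : rho ^+ 2 - x ^+ 2 = y ^+ 2 by rewrite -xyr addrAC subrr add0r.
have rv := rnorm_ge0 v; rewrite mulrDl.
have [y0|y0] := leP 0 y.
  have := HK x S xr _ (expr1n _ _) v; rewrite y2 sqrtr_sqr ger0_norm// mul1r => /(_ iS).
  have : 0 <= K' * rnorm v by rewrite mulr_ge0// ltW.
  lra.
have := HK' x S xr; rewrite sqrrN expr1n y2 sqrtr_sqr ltr0_norm// mulN1r opprK.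
move=> /(_ iS erefl v); have : 0 <= K * rnorm v by rewrite mulr_ge0// ltW.
lra.
Qed.

Lemma resolvent_outside : exists S : R[i] -> E -> E,
  forall z, rho <= cabs z -> inverts z (S z).
Proof.
suff /choice[S HS] : forall z, exists S, rho <= cabs z -> inverts z S by exists S.
move=> z; have [rz|zr] := leP rho (cabs z); last by exists id.
move: rz; rewrite le_eqVlt => /predU1P[/esym/resolvent_circle|/neumann] [S iS];
  by exists S.
Qed.

Section Averages.
Variable S : R[i] -> E -> E.
Hypothesis iS : forall z, rho <= cabs z -> inverts z (S z).

(* The mean of the [z (z - T)^-1] over the [2 ^ m]-th roots [z] of [u], which
   inverts [1 - T ^ (2 ^ m) / u]. *)
Fixpoint averaged m (u : R[i]) (v : E) : E :=
  if m is k.+1 then 2^-1 *: (averaged k (sqrtC u) v + averaged k (- sqrtC u) v)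
  else u *: S u v.

Lemma cabs_sqrtC (c : R) u : 0 <= c -> cabs u = c ^+ 2 -> cabs (sqrtC u) = c.
Proof.
move=> c0 uc; apply/eqP; rewrite -(@eqrXn2 _ 2)// ?cabs_ge0//.
by rewrite -cabsX sqrtCK uc.
Qed.

(** With [w ^ 2 = u] and [x = T ^ (2 ^ m) / w], the step of the induction is the partial fraction
    [(1 - x ^ 2)^-1 = ((1 - x)^-1 + (1 + x)^-1) / 2]. *)
Lemma averaged_inverse m (sigma : R) u : rho <= sigma -> cabs u = sigma ^+ (2 ^ m) ->
  [/\ linear (averaged m u),
      forall v, averaged m u (v - u^-1 *: iter (2 ^ m) T v) = v &
      forall v, averaged m u v - u^-1 *: iter (2 ^ m) T (averaged m u v) = v].
Proof.
move=> rs; elim: m u => [|m IH] u us.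
  have u0 : u != 0 by rewrite -cabs_gt0 us expn0 expr1 (lt_le_trans rho_gt0).
  have [|[lS _] Sl Sr] := iS (z := u); first by rewrite us expn0 expr1.
  split=> [k v w|v|v] /=.
  - by rewrite lS scalerDr !scalerA mulrC.
  - by rewrite -(linear_funZ lS) scalerBr scalerA mulfV// scale1r; exact: Sl.
  - by rewrite (linear_funZ lT) scalerA mulVf// scale1r; exact: Sr.
have u0 : u != 0 by rewrite -cabs_gt0 us exprn_gt0// (lt_le_trans rho_gt0).
pose w := sqrtC u; have w2 : w ^+ 2 = u by exact: sqrtCK.
have w0 : w != 0 by rewrite sqrtC_eq0.
have ws : cabs w = sigma ^+ (2 ^ m).
  apply: cabs_sqrtC; first by rewrite exprn_ge0// (le_trans rho_ge0).
  by rewrite us -exprM expnS mulnC.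
have [l1 a1 b1] := IH _ ws.
have [|l2 a2 b2] := IH (- w); first by rewrite cabsN.
set n := (2 ^ m)%N in a1 a2 b1 b2 *.
have lTn : linear (iter n T) by move=> k x y; exact: iterT_linear.
have -> : (2 ^ m.+1 = n + n)%N by rewrite expnS mul2n addnn.
have half v : 2^-1 *: (v + v) = v :> E.
  rewrite -{1 2}(scale1r v) -scalerDl scalerA [_ * _]mulVf ?scale1r//.
have uw : u^-1 = w^-1 * w^-1 by rewrite -w2 exprnP -exprVn.
split=> [k x y|v|v] /=; rewrite -/w.
- by rewrite l1 l2 addrACA -scalerDr !scalerDr !scalerA mulrC.
- rewrite iterD uw.
  have e1 : v - w^-1 * w^-1 *: iter n T (iter n T v) =
      (v + w^-1 *: iter n T v) - w^-1 *: iter n T (v + w^-1 *: iter n T v).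
    rewrite (linear_funD lTn) (linear_funZ lTn) /= scalerDr opprD scalerA addrA.
    by rewrite -(addrA v) subrr addr0.
  have e2 : v - w^-1 * w^-1 *: iter n T (iter n T v) =
      (v - w^-1 *: iter n T v) - (- w)^-1 *: iter n T (v - w^-1 *: iter n T v).
    rewrite (linear_funB lTn) (linear_funZ lTn) /= invrN scaleNr opprK scalerBr scalerA addrA.
    by rewrite subrK.
  by rewrite {1}e1 a1 e2 a2 addrACA subrr addr0 half.
- rewrite iterD uw.
  set x := averaged m w v; set y := averaged m (- w) v.
  have ex : x = v + w^-1 *: iter n T x by rewrite -{1}(b1 v) subrK.
  have ey : y = v - w^-1 *: iter n T y.
    by rewrite -{1}(b2 v) invrN scaleNr opprK addrK.
  have ex2 : w^-1 * w^-1 *: iter n T (iter n T x) = x - v - w^-1 *: iter n T v.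
    have -> : x - v = w^-1 *: iter n T x by rewrite {1}ex addrAC subrr add0r.
    rewrite {2}ex (linear_funD lTn) (linear_funZ lTn) /= scalerDr scalerA.
    by rewrite addrAC subrr add0r.
  have ey2 : w^-1 * w^-1 *: iter n T (iter n T y) = y - v + w^-1 *: iter n T v.
    have -> : y - v = - (w^-1 *: iter n T y) by rewrite {1}ey addrAC subrr add0r.
    rewrite {2}ey (linear_funB lTn) (linear_funZ lTn) /= scalerBr scalerA opprB.
    by rewrite subrK.
  have -> : iter n T (iter n T (2^-1 *: (x + y))) =
      2^-1 *: (iter n T (iter n T x) + iter n T (iter n T y)).
    by rewrite !(linear_funZ lTn, linear_funD lTn).
  rewrite (scalerA (w^-1 / w)) (mulrC (w^-1 / w)) -(scalerA 2^-1).
  rewrite (scalerDr (w^-1 / w)) ex2 ey2 -scalerBr -[RHS]half; congr (_ *: _).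
  have -> : x - v - w^-1 *: iter n T v + (y - v + w^-1 *: iter n T v) = (x + y) - (v + v).
    by rewrite addrACA addNr addr0 addrACA opprD.
  by rewrite opprB addrC subrK.
Qed.

(** The square root commutes with nonnegative real factors, so the roots of [k ^ (2 ^ m) u] are [k]
    times those of [u] and the averages are compared root by root. Averaging keeps the constant
    [1 / 8] for every [m]. *)
Lemma averaged_perturb m (k : R) u : 1 <= k ->
  (forall z v, cabs z = rho ->
    rnorm (k%:C * z *: S (k%:C * z) v - z *: S z v) <= 1 / 8 * rnorm v) ->
  cabs u = rho ^+ (2 ^ m) -> forall v,
  rnorm (averaged m ((k ^+ (2 ^ m))%:C * u) v - averaged m u v) <= 1 / 8 * rnorm v.
Proof.
move=> k1 kS; elim: m u => [|m IH] u um v /=.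
  by rewrite expr1; apply: kS; rewrite um expr1.
have k0 : 0 <= k ^+ (2 ^ m) by rewrite exprn_ge0// (le_trans ler01).
have -> : sqrtC ((k ^+ (2 ^ m.+1))%:C * u) = (k ^+ (2 ^ m))%:C * sqrtC u.
  rewrite rootCMl; last by rewrite lecR exprn_ge0// (le_trans ler01).
  congr (_ * _); rewrite expnS mulnC exprM rmorphXn /=.
  by rewrite sqrCK// lecR.
have ws : cabs (sqrtC u) = rho ^+ (2 ^ m).
  apply: cabs_sqrtC; first by rewrite exprn_ge0.
  by rewrite um -exprM expnS mulnC.
rewrite -mulrN -scalerBr opprD addrACA rnormZc.
have -> : cabs (2^-1 : R[i]) = 2^-1.
  rewrite cabsV; congr (_^-1).
  have -> : (2 : R[i]) = (2 : R)%:C by rewrite rmorphD.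
  by rewrite cabs_real ger0_norm.
have h1 := IH _ ws v; have h2 : cabs (- sqrtC u) = rho ^+ (2 ^ m) by rewrite cabsN.
have {}h2 := IH _ h2 v.
by have := le_trans (rnormD _ _) (lerD h1 h2); lra.
Qed.

End Averages.

(* For [k > 1], [T ^ n / (k rho) ^ n] is small, so that the averages over the
   circle of radius [k rho] are close to the identity. By uniform continuity of
   the resolvent, so are those over the circle of radius [rho] when [k] is close
   to [1], which makes [T ^ n / rho ^ n] small. *)
Lemma circle_resolvent_decay : exists2 n, (0 < n)%N &
  forall v, rnorm (iter n T v) <= rho ^+ n / 2 * rnorm v.
Proof.
have [S iS] := resolvent_outside; have [K [K0 HK]] := circle_bound.
pose c := rho * K; have c0 : 0 < c by rewrite mulr_gt0.
(* The perturbation estimate in [kS] has the factor [d * (2 c + 2 c ^ 2)], at most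
   [2 d (1 + c) ^ 2 = 1 / 8]. *)
pose d := (16 * (1 + c) ^+ 2)^-1; have d0 : 0 < d.
  by rewrite invr_gt0 mulr_gt0// exprn_gt0// addr_gt0.
have dc : 16 * d * (1 + c) ^+ 2 = 1.
  by rewrite /d; field; rewrite gt_eqF// addr_gt0.
have d1 : d * c <= 1 / 16.
  have h : d * c <= d * (1 + c) ^+ 2.
    rewrite ler_pM2l// expr2 mulrDl mul1r mulrDr; have := mulr_gt0 c0 c0; lra.
  by apply: le_trans h _; move: dc; rewrite -mulrA; lra.
pose k := 1 + d; have k1 : 1 < k by rewrite ltrDl.
have k0 : 0 < k by rewrite (lt_trans ltr01).
have kS z v : cabs z = rho ->
    rnorm (k%:C * z *: S (k%:C * z) v - z *: S z v) <= 1 / 8 * rnorm v.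
  move=> zr; set z' := k%:C * z.
  have z'r : cabs z' = k * rho by rewrite cabsM cabs_real zr gtr0_norm.
  have iz : inverts z (S z) by apply: iS; rewrite zr.
  have iz' : inverts z' (S z') by apply: iS; rewrite z'r ler_peMl// ltW.
  have zz' : cabs (z' - z) = d * rho.
    have -> : z' - z = d%:C * z.
      by rewrite /z' /k rmorphD mulrDl mul1r addrAC subrr add0r.
    by rewrite cabsM cabs_real zr gtr0_norm.
  have [|n1 n2] := inverts_perturb iz iz' (ltW K0) (HK _ _ zr iz) _ v.
    by rewrite zz' -mulrA; apply: le_trans d1 _; lra.
  have -> : z' *: S z' v - z *: S z v = (z' - z) *: S z' v + z *: (S z' v - S z v).
    by rewrite scalerBl scalerBr subrKA.
  apply: le_trans (rnormD _ _) _; rewrite !rnormZc zr zz'.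
  rewrite zz' in n2.
  have m1 : d * rho * rnorm (S z' v) <= d * rho * (2 * K * rnorm v).
    by rewrite ler_wpM2l// mulr_ge0// ltW.
  have m2 : rho * rnorm (S z' v - S z v) <= rho * (d * rho * (2 * K) * K * rnorm v).
    by rewrite ler_pM2l.
  have m3 : d * rho * (2 * K * rnorm v) + rho * (d * rho * (2 * K) * K * rnorm v) =
      d * (2 * c + 2 * c ^+ 2) * rnorm v by rewrite /c; ring.
  have m4 : d * (2 * c + 2 * c ^+ 2) <= 1 / 8.
    have : d * (2 * c + 2 * c ^+ 2) <= d * (2 * (1 + c) ^+ 2).
      by rewrite ler_pM2l// sqrrD expr1n mul1r mulr2n; lra.
    by move: dc; lra.
  have := ler_wpM2r (rnorm_ge0 v) m4; lra.
have [q [rq qk]] : exists q, rho < q /\ q < k * rho.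
  exists ((rho + k * rho) / 2); have : rho < k * rho by rewrite ltr_pMl.
  by split; lra.
have q0 : 0 < q by exact: lt_trans rq.
have kr0 : 0 < k * rho by rewrite mulr_gt0.
have [C HC] := rhoT rq.
have r01 : 0 <= q / (k * rho) < 1.
  by rewrite divr_ge0 ?(ltW q0) ?(ltW kr0)//= ltr_pdivrMr// mul1r.
have e0 : 0 < 1 / 8 :> R by lra.
have [m Hm] := geometric_small C r01 e0.
pose n := (2 ^ m)%N; have mn : (m <= n)%N by rewrite ltnW// ltn_expl.
exists n; first by rewrite expn_gt0.
move=> y.
pose u : R[i] := (rho ^+ n)%:C; pose u' : R[i] := (k ^+ n)%:C * u.
have ur : cabs u = rho ^+ n by rewrite cabs_real ger0_norm// exprn_ge0.
have u'r : cabs u' = (k * rho) ^+ n.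
  by rewrite cabsM ur cabs_real ger0_norm ?exprn_ge0 ?(ltW k0)// exprMn.
have [_ Al _] := averaged_inverse iS (lexx rho) ur.
have [_ _ Ar] : [/\ linear (averaged S m u'),
      forall v, averaged S m u' (v - u'^-1 *: iter n T v) = v &
      forall v, averaged S m u' v - u'^-1 *: iter n T (averaged S m u' v) = v].
  by apply: (averaged_inverse iS (sigma := k * rho)) => //; rewrite ler_peMl// ltW.
(* Both averages are applied to the same [b]: the one on the circle of radius [rho] returns [y], the
   one on the larger circle returns [y'], which is close to [b]. Hence [y] is close to [b], that is,
   [T ^ n y / rho ^ n] is small. *)
pose b := y - u^-1 *: iter n T y; pose y' := averaged S m u' b.
have n1 : rnorm (y' - y) <= 1 / 8 * rnorm b.
  by rewrite -{1}(Al y); apply: averaged_perturb => //; exact: ltW.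
have n2 : rnorm (y' - b) <= 1 / 8 * rnorm y'.
  have eb : b = y' - u'^-1 *: iter n T y' by rewrite /y' (Ar b).
  rewrite {1}eb opprB addrCA subrr addr0 rnormZc cabsV u'r.
  apply: le_trans (ler_wpM2l _ (HC n y')) _.
    by rewrite invr_ge0 exprn_ge0// ltW.
  rewrite mulrA; apply: ler_wpM2r; first exact: rnorm_ge0.
  by rewrite mulrC -mulrA -expr_div_n; exact: Hm.
have n3 := rnormB_le y' b.
have n4 : rnorm (y - b) <= rnorm (y' - y) + rnorm (y' - b).
  by rewrite (rnormBC y'); apply: le_trans (rnormD _ _); rewrite addrA subrK.
have n5 := rnormB_le b y; rewrite (rnormBC b) in n5.
have n6 : rnorm (y - b) = rnorm (iter n T y) / rho ^+ n.
  by rewrite /b opprB addrC subrK rnormZc cabsV ur mulrC.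
have n7 : rnorm (y - b) <= 1 / 2 * rnorm y.
  by have := rnorm_ge0 b; have := rnorm_ge0 y'; lra.
by move: n7; rewrite n6 ler_pdivrMr ?exprn_gt0//; lra.
Qed.

End Circle.

(** Beyond [rho] there is no spectrum by the Neumann series. Were the circle of radius [rho] free of
    it too, [circle_resolvent_decay] would contradict the second hypothesis; so the supremum is
    attained on this circle. *)
Theorem spectral_radius_growth : 0 < rho ->
  ~ (exists2 n, (0 < n)%N & forall v, rnorm (iter n T v) <= rho ^+ n / 2 * rnorm v) ->
  spectral_radius T = rho%:E.
Proof.
move=> r0 nT; apply/eqP; rewrite eq_le; apply/andP; split.
  by apply: ge_ereal_sup => _ [z Tz <-]; rewrite lee_fin; exact: spectrum_le.
have [z zr Tz] : exists2 z, cabs z = rho & op_spectrum T z.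
  apply: contrapT => nz; apply: nT; apply: circle_resolvent_decay => // z zr.
  by apply: contrapT => Tz; apply: nz; exists z.
by apply: ereal_sup_ubound; exists z => //; rewrite -zr.
Qed.

End Gelfand.

(** * Functionals detecting a sequence of vectors *)

Section Completeness.
Variable R : realType.

Lemma complete_geometrically_complete (E : completeNormedModType R[i]) :
  geometrically_complete E.
Proof.
move=> u C q q01 uC; pose s N := \sum_(n < N) u n.
have tail (e : R) : 0 < e -> exists N, forall M, (N <= M)%N -> rnorm (s N - s M) <= e.
  move=> e0; have [N HN] := geometric_small (C / (1 - q)) q01 e0.
  exists N => M NM; have := HN N (leqnn N).
  have -> : C / (1 - q) * q ^+ N = C * q ^+ N / (1 - q) by rewrite mulrAC.
  apply: le_trans; rewrite rnormBC -(subnKC NM) /s big_split_ord/= addrAC subrr add0r.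
  apply: (@geometric_sum_le _ _ (fun i => u (N + i)%N) (C * q ^+ N)) => // n.
  by rewrite -mulrA -exprD; exact: uC.
have cs : cvg (s @ \oo).
  apply: cauchy_cvg; apply: cauchy_exP => e e0.
  have [e1 e2] : 0 < complex.Re e /\ complex.Im e = 0.
    by move: e0; rewrite ltcE/= => /andP[/eqP].
  have [N HN] := tail (complex.Re e / 2) (divr_gt0 e1 (ltr0n _ 2)).
  exists (s N); exists N => // M /= /HN h; rewrite -ball_normE /ball_ /= normE ltcE /= e2 eqxx /=.
  by apply: le_lt_trans h _; lra.
exists (lim (s @ \oo)) => e e0.
have : rnorm (lim (s @ \oo) - s N) @[N --> \oo] --> (0 : R).
  have <- : rnorm (lim (s @ \oo) - lim (s @ \oo)) = 0 by rewrite subrr rnorm0.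
  apply: (@continuous_cvg _ _ _ _ _ _ (@rnorm R E)); first exact: rnorm_continuous.
  by apply: cvgB => //; exact: cvg_cst.
by move=> /cvgr_le/(_ _ e0)[N _ HN]; exists N => n Nn; exact: HN.
Qed.

Lemma contFun_sum (X : compactHausdorffType) (E : normedModType R[i]) n
    (u : nat -> contFun X E) x :
  (\sum_(i < n) u i : contFun X E) x = \sum_(i < n) u i x.
Proof. by elim: n => [|n IH]; rewrite ?big_ord0// !big_ord_recr/= -IH. Qed.

Lemma contFun_geometrically_complete (X : compactHausdorffType) (E : normedModType R[i]) :
  geometrically_complete E -> geometrically_complete (contFun X E).
Proof.
move=> cE u C q q01 uC.
have uCx n x : rnorm ((u n : contFun X E) x) <= C * q ^+ n.
  by apply: le_trans (uC n); exact: rnorm_le_sup_norm.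
have /choice[s Hs] : forall x, exists y, sums_to (fun n => (u n : contFun X E) x) y.
  by move=> x; apply: (cE _ _ _ q01) => n; exact: uCx.
have tail (e : R) : 0 < e -> exists N0, forall N, (N0 <= N)%N -> forall x,
    rnorm (s x - (\sum_(n < N) u n : contFun X E) x) <= e.
  move=> e0; have [N0 HN] := geometric_small (C / (1 - q)) q01 e0.
  exists N0 => N /HN; have -> : C / (1 - q) * q ^+ N = C * q ^+ N / (1 - q) by rewrite mulrAC.
  move=> h x; apply: le_trans h; rewrite contFun_sum.
  apply: sums_to_norm q01 _ (sums_to_drop N (Hs x)) => n.
  by rewrite -mulrA -exprD.
have sc : continuous s.
  move=> x; apply: cvg_rnorm; apply/cvgrPdist_le => e e0.
  have e30 : 0 < e / 3 by rewrite divr_gt0.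
  have [N HN] := tail _ e30; have {}HN := HN N (leqnn N).
  set f : contFun X E := \sum_(n < N) u n in HN.
  have fc : rnorm (f x - f y) @[y --> x] --> (0 : R).
    have <- : rnorm (f x - f x) = 0 by rewrite subrr rnorm0.
    apply: (@continuous_cvg _ _ _ _ _ _ (@rnorm R E)); first exact: rnorm_continuous.
    by apply: cvgB; [exact: cvg_cst|exact: contFun_continuous].
  have {}fc := cvgr_le _ fc _ e30; near=> y.
  rewrite sub0r normrN ger0_norm ?rnorm_ge0//.
  have h : rnorm (f x - f y) <= e / 3 by near: y; exact: fc.
  have -> : s x - s y = (s x - f x) + ((f x - f y) + (f y - s y)).
    by rewrite (addrA (f x - f y)) subrK addrA subrK.
  have := rnormD (s x - f x) ((f x - f y) + (f y - s y)).
  have := rnormD (f x - f y) (f y - s y).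
  have := HN x; have := HN y; rewrite (rnormBC (s y)); lra.
exists (contFun_of sc) => e /tail[N HN]; exists N => M NM.
by apply: sup_norm_le => x; exact: HN.
Unshelve. all: by end_near. Qed.

End Completeness.

(** * Norming functionals and the gliding hump *)

Section GlidingHump.
Variables (R : realType) (E : normedModType R[i]).

Definition real_linear (L : E -> R) :=
  (forall u v, L (u + v) = L u + L v) /\ (forall (t : R) u, L (t%:C *: u) = t * L u).

(** A linear functional below [exposed rnorm w] is below the norm and reaches it at [w]. *)
Lemma norming_functional (w : E) : exists L : E -> R,
  [/\ real_linear L, forall v, L v <= rnorm v & L w = rnorm w].
Proof.
have ST : forall u v : E, [set: E] u -> [set: E] v -> [set: E] (u + v) by [].
have SZ : forall (t : R) (u : E), [set: E] u -> [set: E] (real_complex R t *: u) by [].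
have sn : sublinear_on (real_complex R) [set: E] (@rnorm R E).
  split => [u v _ _|t u _ t0]; first exact: rnormD.
  by rewrite rnormZc cabs_real ger0_norm.
have I0 : [set: E] (0 : E) by [].
have sp := exposed_sublinear I0 ST SZ sn (I : [set: E] w).
have [L [[LD LZ] Lp _]] := exists_extreme_le I0 ST SZ sp.
have Ln v : L v <= rnorm v by apply: le_trans (Lp _ I) _; exact: (exposed_le_id ST SZ sn I I).
exists L; split => //; first by split=> [u v|t u]; [exact: LD|exact: LZ].
apply/eqP; rewrite eq_le Ln/=.
have := Lp (- w) I; have := exposedN I0 ST SZ sn (I : [set: E] w).
have -> : L (- w) = - L w.
  by have := LZ (-1) w I; rewrite rmorphN rmorph1 scaleN1r mulN1r.
lra.
Qed.

(** The tail of the series of the [3 ^ - k] after [n] is [3 ^ - n / 2]. The limit is taken as the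
    supremum of the lower bounds [lo n v], each of which is below all the corresponding upper
    bounds. *)
Lemma geometric_limit (F : nat -> E -> R) :
  (forall n, real_linear (F n)) ->
  (forall n v, `|F n.+1 v - F n v| <= 3^-1 ^+ n.+1 * rnorm v) ->
  exists2 L, real_linear L & forall n v, `|L v - F n v| <= 3^-1 ^+ n / 2 * rnorm v.
Proof.
move=> lF FF.
have step n v k : `|F (n + k)%N v - F n v| <= (3^-1 ^+ n - 3^-1 ^+ (n + k)) / 2 * rnorm v.
  elim: k => [|k IH]; first by rewrite addn0 !subrr normr0 !mul0r.
  rewrite addnS -(subrK (F (n + k)%N v) (F (n + k).+1 v)) -addrA.
  apply: le_trans (ler_normD _ _) _; apply: le_trans (lerD (FF _ _) IH) _.
  by rewrite -mulrDl ler_wpM2r ?rnorm_ge0// exprS; lra.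
pose lo n v := F n v - 3^-1 ^+ n / 2 * rnorm v.
have lohi n m v : lo n v <= F m v + 3^-1 ^+ m / 2 * rnorm v.
  have r0 k : 0 <= 3^-1 ^+ k * rnorm v by rewrite mulr_ge0 ?exprn_ge0 ?rnorm_ge0.
  have rm := r0 m; have rn := r0 n; rewrite /lo.
  have [nm|/ltnW mn] := leqP n m.
    by have := step n v (m - n)%N; rewrite subnKC// ler_distl => /andP[]; lra.
  by have := step m v (n - m)%N; rewrite subnKC// ler_distl => /andP[]; lra.
pose L v := sup (range (lo ^~ v)).
have Lv n v : `|L v - F n v| <= 3^-1 ^+ n / 2 * rnorm v.
  rewrite ler_distl; apply/andP; split.
    apply: ub_le_sup; last by exists n.
    by exists (F 0%N v + 3^-1 ^+ 0%N / 2 * rnorm v) => _ [k _ <-]; exact: lohi.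
  by apply: ge_sup; [exists (lo 0%N v), 0%N|move=> _ [k _ <-]; exact: lohi].
have L0 (z c : R) : (forall n, `|z| <= c * 3^-1 ^+ n) -> z = 0.
  move=> zc; apply/normr0_eq0/eqP; rewrite eq_le normr_ge0 andbT.
  apply/ler_addgt0Pr => e e0; rewrite add0r.
  have [|N HN] := geometric_small c _ e0 (r := 3^-1); first by apply/andP; split; lra.
  by apply: le_trans (zc N) _; exact: HN.
exists L => //; split=> [u v|t u].
- apply/eqP; rewrite -subr_eq0; apply/eqP.
  apply: (L0 _ ((rnorm (u + v) + rnorm u + rnorm v) / 2)) => n; have [FD _] := lF n.
  have := Lv n (u + v); have := Lv n u; have := Lv n v; rewrite FD.
  by rewrite !ler_norml; lra.
- apply/eqP; rewrite -subr_eq0; apply/eqP.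
  apply: (L0 _ ((rnorm (t%:C *: u) + `|t| * rnorm u) / 2)) => n; have [_ FZ] := lF n.
  have h1 := Lv n (t%:C *: u).
  have h2 : `|t * (L u - F n u)| <= `|t| * (3^-1 ^+ n / 2 * rnorm u).
    by rewrite normrM ler_wpM2l.
  by move: h1 h2; rewrite FZ !ler_norml; lra.
Qed.

(* [L] is the sum of the [+- 3 ^ - (k + 1) N_k] with [N_k] norming [w k]. The
   sign lets the [k]-th term add up at [w k] with the preceding ones, and the
   following ones sum up to at most half of it. *)
Lemma gliding_hump (w : nat -> E) : exists L : E -> R,
  [/\ real_linear L, forall v, `|L v| <= rnorm v &
      forall k, 3^-1 ^+ k.+1 / 2 * rnorm (w k) <= `|L (w k)|].
Proof.
have /choice[N HN] : forall k, exists L : E -> R,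
    [/\ real_linear L, forall v, L v <= rnorm v & L (w k) = rnorm (w k)].
  by move=> k; exact: norming_functional.
pose next k (F : E -> R) v := F v + (if 0 <= F (w k) then 1 else -1) * (3^-1 ^+ k.+1 * N k v).
pose F := fix F k := if k is j.+1 then next j (F j) else fun=> 0.
have Nv k v : `|N k v| <= rnorm v.
  have [[_ NZ] Nv _] := HN k; rewrite ler_norml Nv andbT lerNl.
  have := NZ (-1) v; rewrite mulN1r => <-; apply: le_trans (Nv _) _.
  by rewrite rnormZc cabs_real normrN normr1 mul1r.
have sg k (r : R) : `|(if 0 <= F k (w k) then 1 else -1) * r| = `|r|.
  by case: ifP; rewrite ?mul1r// mulN1r normrN.
have lF k : real_linear (F k).
  elim: k => [|k [FD FZ]]; first by split=> *; rewrite ?addr0 ?mulr0.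
  have [[ND NZ] _ _] := HN k; split=> [u v|t v] /=; rewrite /next.
    by rewrite FD ND; ring.
  by rewrite FZ NZ; ring.
have FF n v : `|F n.+1 v - F n v| <= 3^-1 ^+ n.+1 * rnorm v.
  rewrite /= /next addrAC subrr add0r sg normrM ger0_norm ?exprn_ge0//.
  by rewrite ler_wpM2l// exprn_ge0.
have [L lL LF] := geometric_limit lF FF; exists L; split => // [v|k].
  have := LF 0%N v; rewrite subr0 expr0; have := rnorm_ge0 v; lra.
have h : 3^-1 ^+ k.+1 * rnorm (w k) <= `|F k.+1 (w k)|.
  rewrite /= /next; have [_ _ ->] := HN k.
  have : 0 <= 3^-1 ^+ k.+1 * rnorm (w k) by rewrite mulr_ge0 ?exprn_ge0 ?rnorm_ge0.
  set r := 3^-1 ^+ k.+1 * rnorm (w k) => r0; have [F0|F0] := leP 0 (F k (w k)).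
    by rewrite mul1r ger0_norm; lra.
  by rewrite mulN1r ler0_norm; lra.
have := LF k.+1 (w k); rewrite distrC.
by have := ler_normD (F k.+1 (w k) - L (w k)) (L (w k)); rewrite subrK; lra.
Qed.

(** The complex linear functional whose real part is [L]. *)
Definition complexify (L : E -> R) (v : E) : R[i]^o := (L v +i* (- L ('i *: v)))%C.

Lemma complexify_linear L : real_linear L -> linear (complexify L).
Proof.
move=> [LD LZ] [x y] u v; rewrite /complexify.
have LN z : L (- z) = - L z.
  by have := LZ (-1) z; rewrite rmorphN rmorph1 scaleN1r mulN1r.
have E1 (z : E) : (x +i* y)%C *: z = x%:C *: z + y%:C *: ('i *: z).
  rewrite scalerA -scalerDl; congr (_ *: _).
  by apply/eqP; rewrite eq_complex /=; apply/andP; split; apply/eqP; ring.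
have ii z : 'i *: ('i *: z) = - z :> E by rewrite scalerA -expr2 sqr_i scaleN1r.
have E2 (z : E) : 'i *: ((x +i* y)%C *: z) = x%:C *: ('i *: z) - y%:C *: z.
  by rewrite scalerA mulrC -scalerA E1 ii scalerN.
rewrite scalerDr !LD E2 E1 !LD LN !LZ.
apply/eqP; rewrite eq_complex /=; apply/andP; split; apply/eqP; ring.
Qed.

(** Rotating [v] by a scalar of modulus one makes the value real and positive, so that it becomes a
    value of [L]. *)
Lemma complexify_le L v : real_linear L -> (forall v, `|L v| <= rnorm v) ->
  cabs (complexify L v) <= rnorm v.
Proof.
move=> lL Ln; set z := complexify L v.
have [->|z0] := eqVneq z 0; first by rewrite /cabs normr0 rnorm_ge0.
have c0 : 0 < cabs z by rewrite cabs_gt0.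
pose k := (cabs z)%:C / z.
have k1 : cabs k = 1 by rewrite cabsM cabsV cabs_real gtr0_norm// divff ?gt_eqF.
have : complexify L (k *: v) = (cabs z)%:C.
  rewrite (linear_funZ (complexify_linear lL)) -/z /k.
  by rewrite [_ *: _]mulrAC -mulrA divff// mulr1.
move/(congr1 (@complex.Re R)) => /= h; have := Ln (k *: v).
by rewrite h rnormZc k1 mul1r ger0_norm// cabs_ge0.
Qed.

End GlidingHump.

(** * Exponential growth *)

Lemma square_above n : exists k i, (n + i = k * k)%N /\ (i <= 2 * k)%N.
Proof.
elim: n => [|n [k [[|i] [nk ik]]]]; first by exists 0%N, 0%N.
  exists k.+1, (2 * k)%N; split; last by rewrite mulnS leqW// leqW.
  by move: nk; rewrite addn0 => ->; ring.
by exists k, i; split; [rewrite addSnnS|exact: ltnW].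
Qed.

Section ExponentialGrowth.
Variable R : realType.
Implicit Types (u : nat -> \bar R) (l : \bar R).

Lemma limn_einf_le u l : (\forall n \near \oo, (u n <= l)%E) -> (limn_einf u <= l)%E.
Proof.
move=> [N _ uN]; rewrite limn_einf_lim (cvg_lim _ (@cvg_einfs_sup _ u))//.
apply: ge_ereal_sup => _ [k _ <-].
apply: le_trans (uN (maxn k N) (leq_maxr _ _)).
by apply: ereal_inf_lbound; exists (maxn k N) => //=; exact: leq_maxl.
Qed.

Lemma limn_einf_ge u l : (\forall n \near \oo, (l <= u n)%E) -> (l <= limn_einf u)%E.
Proof.
move=> [N _ uN]; rewrite limn_einf_lim (cvg_lim _ (@cvg_einfs_sup _ u))//.
apply: (@le_trans _ _ (einfs u N)); last by apply: ereal_sup_ubound; exists N.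
by apply: le_ereal_inf_tmp => _ [k /= Nk <-]; exact: uN.
Qed.

Lemma lee_lne_EFin (x : \bar R) (t : R) : (x <= (expR t)%:E)%E -> (lne x <= t%:E)%E.
Proof.
have [x0 _|x0] := leP x 0%E; first by rewrite le0_lneNy// leNye.
rewrite -(@lee_lne R); last 2 first.
- by rewrite in_itv/= leey andbT ltW.
- by rewrite in_itv/= leey andbT lee_fin expR_ge0.
by rewrite lne_EFin ?expR_gt0// expRK.
Qed.

Lemma lee_EFin_lne (x : \bar R) (t : R) : ((expR t)%:E <= x)%E -> (t%:E <= lne x)%E.
Proof.
move=> tx; have x0 : (0 <= x)%E by apply: le_trans tx; rewrite lee_fin expR_ge0.
move: tx; rewrite -(@lee_lne R); last 2 first.
- by rewrite in_itv/= leey andbT lee_fin expR_ge0.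
- by rewrite in_itv/= leey andbT.
by rewrite lne_EFin ?expR_gt0// expRK.
Qed.

Lemma near_natV_small (C e : R) : 0 < e -> \forall n \near \oo, (0 < n)%N /\ C <= n%:R * e.
Proof.
move=> e0; near=> n; split; first by near: n; exact: nbhs_infty_gt.
rewrite -ler_pdivrMr//; near: n; exact: nbhs_infty_ger.
Unshelve. all: by end_near. Qed.

Lemma exp_growth_le u (l : R) :
  (forall e, 0 < e -> exists C : R, forall n, (u n <= (expR (C + n%:R * (l + e)))%:E)%E) ->
  (exp_growth u <= l%:E)%E.
Proof.
move=> ul; apply/lee_addgt0Pr => e e0; have e20 : 0 < e / 2 by rewrite divr_gt0.
have [C uC] := ul _ e20; rewrite -EFinD; apply: limn_einf_le.
have := near_natV_small C e20; apply: filterS => n [n0 nC].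
rewrite lee_pdivrMl ?ltr0n// -EFinM; apply: lee_lne_EFin.
by apply: le_trans (uC n) _; rewrite lee_fin ler_expR; lra.
Qed.

Lemma exp_growth_ge u (l : R) :
  (forall e, 0 < e -> exists C : R, forall n, ((expR (n%:R * (l - e) - C))%:E <= u n)%E) ->
  (l%:E <= exp_growth u)%E.
Proof.
move=> ul; apply/lee_subgt0Pr => e e0; have e20 : 0 < e / 2 by rewrite divr_gt0.
have [C uC] := ul _ e20; rewrite -EFinB; apply: limn_einf_ge.
have := near_natV_small C e20; apply: filterS => n [n0 nC].
rewrite lee_pdivlMl ?ltr0n// -EFinM; apply: lee_EFin_lne.
by apply: le_trans _ (uC n); rewrite lee_fin ler_expR; lra.
Qed.

Lemma exp_growth_lneNy u :
  (forall l : R, exists C : R, forall n, (u n <= (expR (C + n%:R * l))%:E)%E) ->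
  exp_growth u = -oo%E.
Proof.
move=> ul; apply: eq_ninfty => l.
by apply: exp_growth_le => e _; exact: ul.
Qed.

Lemma sparse_growth_ge u (l m : R) :
  (forall e, 0 < e -> exists C : R, forall n k i, (n + i = k * k)%N -> (i <= 2 * k)%N ->
    ((expR ((k * k)%:R * (l - e) - C - k%:R * m))%:E <= u n)%E) ->
  (l%:E <= exp_growth u)%E.
Proof.
move=> ul; apply: exp_growth_ge => e e0; have e20 : 0 < e / 2 by rewrite divr_gt0.
have [C uC] := ul _ e20; pose B := 2 * (`|l| + e) + m.
(* [B] gathers the coefficients of [k], and [- B ^ 2 / (2 e)] is the minimum of
   [k ^ 2 * (e / 2) - k * B] over real [k]. *)
exists (C + B ^+ 2 / (2 * e)) => n; have [k [i [nk ik]]] := square_above n.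
apply: le_trans (uC n k i nk ik); rewrite lee_fin ler_expR.
have nE : n%:R = k%:R * k%:R - i%:R :> R by rewrite -natrM -nk natrD addrK.
have il : - (2 * k%:R * (`|l| + e)) <= i%:R * (l - e).
  have ik' : i%:R <= 2 * k%:R :> R by rewrite -natrM ler_nat.
  have h1 : - (`|l| + e) <= l - e by have := ler_norm (- l); rewrite normrN; lra.
  have h2 : 0 <= `|l| + e by rewrite addr_ge0// ltW.
  have := ler_wpM2r h2 ik'; have := ler_wpM2l (ler0n R i) h1; lra.
have sq : 0 <= k%:R * k%:R * (e / 2) - k%:R * B + B ^+ 2 / (2 * e).
  have -> : k%:R * k%:R * (e / 2) - k%:R * B + B ^+ 2 / (2 * e) =
      (k%:R * e - B) ^+ 2 / (2 * e) by field; rewrite gt_eqF.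
  by rewrite divr_ge0 ?sqr_ge0// mulr_ge0// ltW.
rewrite nE natrM; move: il sq; rewrite /B; lra.
Qed.

Section Submultiplicative.
Variable p : nat -> R.
Hypotheses (p0 : p 0 = 1) (p_ge0 : forall n, 0 <= p n).
Hypothesis pD : forall n m, p (n + m) <= p n * p m.

Definition growth_bounds := [set q | 0 < q /\ exists C, forall n, p n <= C * q ^+ n].

(** This is the limit of the [n]-th roots of [p n] given by Fekete's lemma, written without
    roots. *)
Definition growth_rate := inf growth_bounds.

Lemma submultiplicativeX n k : p (n * k) <= p n ^+ k.
Proof.
elim: k => [|k IH]; first by rewrite muln0 p0.
by rewrite mulnS exprS; apply: le_trans (pD _ _) _; exact: ler_wpM2l.
Qed.

Lemma growth_bounds_has_inf : has_inf growth_bounds.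
Proof.
split; last by exists 0 => q [/ltW].
exists (p 1 + 1); split; first by rewrite ltr_wpDl.
exists 1 => n; rewrite mul1r; have := submultiplicativeX 1 n; rewrite mul1n => /le_trans; apply.
by apply: lerXn2r; rewrite ?nnegrE ?addr_ge0// lerDl.
Qed.

Lemma growth_rate_ge0 : 0 <= growth_rate.
Proof. by apply: lb_le_inf; [case: growth_bounds_has_inf|move=> q [/ltW]]. Qed.

Lemma growth_rate_ubound q : growth_rate < q -> exists C, forall n, p n <= C * q ^+ n.
Proof.
move=> /(inf_lt (proj1 growth_bounds_has_inf))[r [r0 [C pC]] rq].
have C0 : 0 <= C by have := pC 0%N; rewrite expr0 mulr1; exact: le_trans.
exists C => n; apply: le_trans (pC n) _; apply: ler_wpM2l => //.
by apply: lerXn2r; rewrite ?nnegrE ?(ltW r0)// ?ltW// (lt_trans r0).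
Qed.

(** If this failed at [n], some [q] below [growth_rate] would satisfy [p n <= q ^ n], and division
    of the times by [n] would make [q] a growth bound. *)
Lemma growth_rate_lbound n : growth_rate ^+ n <= p n.
Proof.
case: n => [|n]; first by rewrite expr0 p0.
rewrite leNgt; apply/negP => pn.
have g0 : 0 < growth_rate.
  rewrite lt_def growth_rate_ge0 andbT; apply/eqP => g0.
  by move: pn; rewrite g0 expr0n /= ltNge p_ge0.
have [q [q0 qg pq]] : exists q, [/\ 0 < q, q < growth_rate & p n.+1 <= q ^+ n.+1].
  have c : (x ^+ n.+1 : R) @[x --> growth_rate^'-] --> growth_rate ^+ n.+1.
    by apply: cvg_at_left_filter; exact: exprn_continuous.
  have {}c := cvgr_gt _ c _ pn; near growth_rate^'- => q; exists q; split; last 1 first.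
  - by apply: ltW; near: q; exact: c.
  - by near: q; exact: nbhs_left_gt.
  - by near: q; exact: nbhs_left_lt.
suff : growth_rate <= q by rewrite leNgt qg.
apply: ge_inf; first by case: growth_bounds_has_inf.
(* The remainder [r] of the division contributes the factor [p r / q ^ r]; the sum dominates all of
   them. *)
split => //; exists (\sum_(r < n.+1) p r / q ^+ r) => m.
have rn : (m %% n.+1 < n.+1)%N by rewrite ltn_mod.
have {1}-> : m = (n.+1 * (m %/ n.+1) + m %% n.+1)%N by rewrite mulnC -divn_eq.
apply: le_trans (pD _ _) _.
apply: (@le_trans _ _ ((q ^+ n.+1) ^+ (m %/ n.+1) * p (m %% n.+1)%N)).
  apply: ler_wpM2r => //; apply: le_trans (submultiplicativeX _ _) _.
  by apply: lerXn2r; rewrite ?nnegrE ?exprn_ge0// ltW.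
apply: (@le_trans _ _ (p (m %% n.+1)%N / q ^+ (m %% n.+1) * q ^+ m)).
  have -> : q ^+ m = (q ^+ n.+1) ^+ (m %/ n.+1) * q ^+ (m %% n.+1).
    by rewrite -exprM -exprD mulnC -divn_eq.
  by rewrite mulrCA divfK// expf_neq0// gt_eqF.
apply: ler_wpM2r; first by rewrite exprn_ge0// ltW.
rewrite (bigD1 (Ordinal rn))//= lerDl; apply: sumr_ge0 => i _.
by rewrite divr_ge0 ?exprn_ge0// ltW.
Unshelve. all: by end_near. Qed.

Lemma growth_rate0_ubound (l : R) : growth_rate = 0 ->
  exists C, forall n, p n <= expR (C + n%:R * l).
Proof.
move=> g0; have [|C pC] := @growth_rate_ubound (expR l); first by rewrite g0 expR_gt0.
have C0 : 0 < C by have := pC 0%N; rewrite expr0 mulr1 p0; exact: lt_le_trans.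
by exists (ln C) => n; rewrite expRD lnK// mulrC expRM_natl mulrC.
Qed.

Lemma growth_rate_gt0_ubound e : 0 < growth_rate -> 0 < e ->
  exists C, forall n, p n <= expR (C + n%:R * (ln growth_rate + e)).
Proof.
move=> g0 e0; have [|C pC] := @growth_rate_ubound (expR (ln growth_rate + e)).
  by rewrite -{1}(@lnK _ growth_rate)// ltr_expR ltrDl.
have C0 : 0 < C by have := pC 0%N; rewrite expr0 mulr1 p0; exact: lt_le_trans.
by exists (ln C) => n; rewrite expRD lnK// mulrC expRM_natl mulrC.
Qed.

End Submultiplicative.

End ExponentialGrowth.

(** * Operator norms *)

Section OperatorNorm.
Variables (R : realType) (E F : normedModType R[i]).
Implicit Types T : E -> F.

Lemma op_norm_le T (M : R) : 0 <= M -> (forall v, rnorm (T v) <= M * rnorm v) ->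
  (op_norm T <= M%:E)%E.
Proof.
move=> M0 TM; apply: ge_ereal_sup => _ [v /= v1 <-]; rewrite lee_fin.
by apply: le_trans (TM v) _; rewrite -[leRHS]mulr1; exact: ler_wpM2l.
Qed.

Lemma op_norm_ge T (v : E) : rnorm v <= 1 -> ((rnorm (T v))%:E <= op_norm T)%E.
Proof. by move=> v1; apply: ereal_sup_ubound; exists v. Qed.

Lemma op_norm_ge_ratio T (v : E) (B : R) :
  (forall (k : R) v, T (k%:C *: v) = k%:C *: T v) -> 0 < B -> rnorm v <= B ->
  ((rnorm (T v) / B)%:E <= op_norm T)%E.
Proof.
move=> TZ B0 vB; have -> : rnorm (T v) / B = rnorm (T (B^-1%:C *: v)).
  by rewrite TZ rnormZc cabs_real gtr0_norm ?invr_gt0// mulrC.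
apply: op_norm_ge; rewrite rnormZc cabs_real gtr0_norm ?invr_gt0//.
by rewrite mulrC ler_pdivrMr// mul1r.
Qed.

Lemma op_normZ T (k : R) : 0 < k -> op_norm (fun v => k%:C *: T v) = (k%:E * op_norm T)%E.
Proof.
move=> k0; rewrite /op_norm -ereal_sup_pZl//; congr ereal_sup.
apply/seteqP; split=> [_ [v v1 <-]|_ [_ [v v1 <-] <-]].
  by exists (rnorm (T v))%:E; [exists v|rewrite rnormZc cabs_real gtr0_norm].
by exists v => //; rewrite rnormZc cabs_real gtr0_norm.
Qed.

End OperatorNorm.

(** * Almost sure values of exponents *)

Section AlmostEverywhere.
Variables (R : realType) (X : ptopologicalType) (mu : probability (borelType X) R).
Variable Y : set X.
Hypotheses (mY : measurable (Y : set (borelType X))) (muY : mu (~` Y) = 0%E).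

Lemma ae_exists (Q : X -> Prop) : {ae mu, forall x : borelType X, Q x} ->
  exists2 x, Y x & Q x.
Proof.
move=> aQ; apply: contrapT => nQ.
have nY : mu.-negligible (~` Y) by exists (~` Y); split => //; exact: measurableC.
have [B [mB B0 sB]] := negligibleU aQ nY.
suff /eqP : mu setT = 0%E by rewrite probability_setT onee_eq0.
apply/eqP; rewrite eq_le measure_ge0 andbT -B0; apply: le_measure; rewrite ?inE//.
move=> x _; apply: sB; apply: contrapT => /not_orP[/= /contrapT Qx /contrapT Yx].
by apply: nQ; exists x.
Qed.

(** The set [W] may fail to be measurable, hence the outer measure: if [W] missed [Q], it would lie
    in a measurable null set. *)
Lemma ae_intersects (Q : X -> Prop) (W : set X) :
  {ae mu, forall x : borelType X, Q x} -> (0 < mu_ext mu W)%E -> exists2 x, W x & Q x.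
Proof.
move=> [B [mB B0 sB]]; apply: contraPP => nQ; apply/negP; rewrite -leNgt -B0.
rewrite -(measurable_mu_extE mu mB); apply: le_mu_ext => x Wx; apply: sB => /= Qx.
by apply: nQ; exists x.
Qed.

Variables (E : normedModType R[i]) (c : X -> E -> E) (phi : X -> X).

Lemma measure_exponent_le l :
  (forall x, Y x -> (exp_growth (fun n => op_norm (fwd_cocycle c phi x n)) <= l)%E) ->
  (measure_exponent Y c phi mu <= l)%E.
Proof.
move=> cl; rewrite /measure_exponent; case: xgetP => [m _|_]; last exact: leNye.
by move=> /ae_exists[x Yx /(_ Yx) <-]; exact: cl.
Qed.

Lemma measure_exponentE l : {ae mu, forall x : borelType X, Y x ->
    exp_growth (fun n => op_norm (fwd_cocycle c phi x n)) = l} ->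
  measure_exponent Y c phi mu = l.
Proof.
move=> al; apply: xget_unique => // m am.
by have [x Yx [/(_ Yx) <- /(_ Yx) <-]] := ae_exists (filterI am al).
Qed.

End AlmostEverywhere.

(** * Weighted endomorphisms *)

Section WeightedEndomorphism.
Variables (R : realType) (X : compactHausdorffType) (D : banachAlgType R[i]).
Variables (alpha : contFun X D -> contFun X D) (phi : X -> X) (a : contFun X D).
Hypothesis alpha_linear : linear alpha.
Hypothesis alphaM : {morph alpha : b c / b *b c}.
Hypothesis alpha_contractive : forall b, sup_norm (alpha b) <= sup_norm b.
Hypothesis alpha_phi : generates alpha phi.

Notation Delta := (fiber_support alpha).
Notation one := (aone : contFun X D).
Notation cst d := (contFun_cst X d : contFun X D).

Lemma amulE (f g : contFun X D) x : (f *b g : contFun X D) x = f x *b g x.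
Proof. by []. Qed.

Lemma sup_norm_amul (f g : contFun X D) : sup_norm (f *b g) <= sup_norm f * sup_norm g.
Proof. exact: (rnorm_amul f g). Qed.

Lemma sup_norm_ge0 (f : contFun X D) : 0 <= sup_norm f.
Proof. exact: (rnorm_ge0 f). Qed.

Lemma sup_norm_cst d : sup_norm (cst d) = rnorm d.
Proof.
apply/eqP; rewrite eq_le; apply/andP; split; first by apply: sup_norm_le.
exact: (rnorm_le_sup_norm (cst d) point).
Qed.

Lemma rnorm_aone : rnorm (aone : D) = 1.
Proof. by rewrite /rnorm norm_aone. Qed.

Lemma sup_norm_one : sup_norm one = 1.
Proof. by rewrite [LHS]sup_norm_cst rnorm_aone. Qed.

Lemma sup_norm_attained (f : contFun X D) : exists x, rnorm (f x) = sup_norm f.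
Proof.
have [|||x _ fx] := @compact_EVT_max X R (fun x => rnorm (f x)) setT.
- by exists point.
- exact: compact_space.
- apply: continuous_subspaceT => x; apply: continuous_comp; last exact: rnorm_continuous.
  exact: contFun_continuous.
exists x; apply/eqP; rewrite eq_le rnorm_le_sup_norm/=.
by apply: sup_norm_le => y; apply: fx; rewrite inE.
Qed.

(** The value [alpha one x] is an idempotent of [D]: it is zero, and then kills the fiber, or it has
    norm at least one. The gap between [0] and [1] makes [Delta] clopen. *)
Lemma fiber_supportP x : Delta x <-> 1 <= rnorm (alpha one x).
Proof.
have [_ _ off] := alpha_phi; split; last first.
  by move=> h; apply: contrapT => /off nx; move: h; rewrite nx rnorm0 ler10.
move=> Dx; have [e0|e0] := eqVneq (alpha one x) 0.
  case: Dx; apply/funext => d; rewrite /fiber.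
  have -> : contFun_cst X d = one *b contFun_cst X d by rewrite amul1l.
  by rewrite alphaM amulE e0 -(scale0r (0 : D)) amulZl !scale0r.
have ee : alpha one x = alpha one x *b alpha one x.
  by rewrite -amulE -alphaM amul1l.
have n0 : 0 < rnorm (alpha one x).
  by rewrite lt_def rnorm_ge0 andbT; apply: contra e0 => /eqP/rnorm_eq0/eqP.
have := rnorm_amul (alpha one x) (alpha one x).
by rewrite -ee ler_pMl.
Qed.

Lemma rnorm_contFun_continuous (f : contFun X D) : continuous (fun x => rnorm (f x)).
Proof.
by move=> x; apply: continuous_comp; [exact: contFun_continuous|exact: rnorm_continuous].
Qed.

Lemma fiber_support_closed : closed Delta.
Proof.
rewrite (_ : Delta = [set x | 1 <= rnorm (alpha one x)]).
  exact/closed_ge_continuous/rnorm_contFun_continuous.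
by apply/funext => x; apply/propext; exact: fiber_supportP.
Qed.

Lemma fiber_support_open : open Delta.
Proof.
rewrite (_ : Delta = [set x | 0 < rnorm (alpha one x)]).
  exact/open_gt_continuous/rnorm_contFun_continuous.
apply/seteqP; split=> x /=; first by move=> /fiber_supportP; exact: lt_le_trans.
move=> h; apply: contrapT => nx; have [_ _ off] := alpha_phi.
by move: h; rewrite off// rnorm0 ltxx.
Qed.

Lemma alpha_le (b : contFun X D) x : Delta x -> rnorm (alpha b x) <= rnorm (b (phi x)).
Proof.
move=> Dx; have [_ on _] := alpha_phi; rewrite on// -[leRHS]sup_norm_cst.
by apply: le_trans (alpha_contractive _); exact: rnorm_le_sup_norm.
Qed.

Lemma alpha_eq0 (b : contFun X D) x : (Delta x -> b (phi x) = 0) -> alpha b x = 0.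
Proof.
have [_ _ off] := alpha_phi; have [Dx b0|nDx _] := pselect (Delta x); last exact: off.
apply: rnorm_eq0; apply/eqP; rewrite eq_le rnorm_ge0 andbT.
by apply: le_trans (alpha_le _ Dx) _; rewrite b0// rnorm0.
Qed.

Lemma iter_alpha_le n b x : iter_dom phi Delta n x ->
  rnorm (iter n alpha b x) <= rnorm (b (iter n phi x)).
Proof.
elim: n x => [|n IH] x; first by [].
move=> [Dx /IH]; rewrite -iterSr /=; apply: le_trans; exact: alpha_le.
Qed.

Lemma iter_alpha_contractive n b : sup_norm (iter n alpha b) <= sup_norm b.
Proof. by elim: n => //= n; apply: le_trans; exact: alpha_contractive. Qed.

(* Up to bounded factors, its iterates are those of the weighted endomorphism,
   and they have the advantage of splitting as products of values on [X], see
   [iter_transport_mul]. *)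
Definition transport (b : contFun X D) : contFun X D := alpha (a *b b).

Lemma transport_mul (f g : contFun X D) : transport (f *b g) = transport f *b alpha g.
Proof. by rewrite /transport amulA alphaM. Qed.

Lemma iter_transport_mul n (b : contFun X D) :
  iter n transport b = iter n transport one *b iter n alpha b.
Proof. by elim: n => [|n IH]; [rewrite amul1l|rewrite !iterS IH transport_mul]. Qed.

Definition local_norm n x := rnorm (iter n transport one x).

Definition uniform_norm n := sup_norm (iter n transport one).

Lemma local_norm_continuous n : continuous (local_norm n).
Proof. exact: rnorm_contFun_continuous. Qed.

Lemma local_norm_ge0 n x : 0 <= local_norm n x. Proof. exact: rnorm_ge0. Qed.

Lemma uniform_norm_ge0 n : 0 <= uniform_norm n. Proof. exact: sup_norm_ge0. Qed.

Lemma local_norm0 x : local_norm 0 x = 1. Proof. exact: rnorm_aone. Qed.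

Lemma uniform_norm0 : uniform_norm 0 = 1. Proof. exact: sup_norm_one. Qed.

Lemma local_norm_le n x : local_norm n x <= uniform_norm n.
Proof. exact: rnorm_le_sup_norm. Qed.

Lemma iter_transport_dom n b x : ~ iter_dom phi Delta n x -> iter n transport b x = 0.
Proof.
elim: n x b => [|n IH] x b nx; first by case: nx.
rewrite iterS; apply: alpha_eq0 => Dx; rewrite amulE IH.
  by rewrite -(scale0r (0 : D)) amulZr !scale0r.
by move=> h; apply: nx.
Qed.

Lemma local_norm_dom n x : 0 < local_norm n x -> iter_dom phi Delta n x.
Proof.
move=> nx; apply: contrapT => /iter_transport_dom h.
by move: nx; rewrite /local_norm h rnorm0 ltxx.
Qed.

Lemma iter_transport_le n (b : contFun X D) x :
  rnorm (iter n transport b x) <= local_norm n x * rnorm (b (iter n phi x)).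
Proof.
have [Dx|nx] := pselect (iter_dom phi Delta n x); last first.
  by rewrite iter_transport_dom// rnorm0 mulr_ge0// rnorm_ge0.
rewrite iter_transport_mul; apply: le_trans (rnorm_amul _ _) _.
by apply: ler_wpM2l; [exact: rnorm_ge0|exact: iter_alpha_le].
Qed.

Lemma sup_norm_iter_transport n (b : contFun X D) :
  sup_norm (iter n transport b) <= uniform_norm n * sup_norm b.
Proof.
rewrite iter_transport_mul; apply: le_trans (sup_norm_amul _ _) _.
by apply: ler_wpM2l; [exact: sup_norm_ge0|exact: iter_alpha_contractive].
Qed.

Lemma local_normD n m x : local_norm (n + m) x <= local_norm n x * local_norm m (iter n phi x).
Proof. by rewrite {1}/local_norm iterD; exact: iter_transport_le. Qed.

Lemma uniform_normD n m : uniform_norm (n + m) <= uniform_norm n * uniform_norm m.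
Proof. by rewrite {1}/uniform_norm iterD; exact: sup_norm_iter_transport. Qed.

Notation cocycle := (fun x => fiber alpha x \o lmul (a (phi x))).

Lemma iter_transportE n (b : contFun X D) x : iter_dom phi Delta n x ->
  iter n transport b x = fwd_cocycle cocycle phi x n (b (iter n phi x)).
Proof.
elim: n x => [//|n IH] x [Dx nx]; rewrite [in LHS]iterS iterSr /= -IH//.
by have [_ on _] := alpha_phi; rewrite /transport on.
Qed.

Lemma op_norm_fwd_cocycle n x : iter_dom phi Delta n x ->
  op_norm (fwd_cocycle cocycle phi x n) = (local_norm n x)%:E.
Proof.
move=> nx; apply/eqP; rewrite eq_le; apply/andP; split.
  apply: op_norm_le; first exact: local_norm_ge0.
  move=> d; have := iter_transport_le n (cst d) x.
  by rewrite iter_transportE.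
rewrite /local_norm iter_transportE//.
by apply: op_norm_ge; rewrite rnorm_aone.
Qed.

Lemma bwd_cocycle_adjoint n x v :
  bwd_cocycle (fun x => adjoint (lmul (a (phi x))) \o adjoint (fiber alpha x)) phi x n v =
  v \o fwd_cocycle cocycle phi x n.
Proof. by elim: n x v => [|n IH] x v //=; rewrite IH. Qed.

Definition rate := growth_rate uniform_norm.

Lemma rate_ge0 : 0 <= rate.
Proof. exact: growth_rate_ge0 uniform_norm0 uniform_norm_ge0 uniform_normD. Qed.

Lemma weighted_linear : linear (weighted alpha a).
Proof. by move=> k u v; rewrite /weighted alpha_linear amulDr amulZr. Qed.

Lemma weighted_bounded (b : contFun X D) : rnorm (weighted alpha a b) <= sup_norm a * rnorm b.
Proof.
apply: le_trans (sup_norm_amul _ _) _; apply: ler_wpM2l; first exact: sup_norm_ge0.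
exact: alpha_contractive.
Qed.

Lemma iter_weighted n b : iter n.+1 (weighted alpha a) b = a *b iter n transport (alpha b).
Proof. by elim: n b => [|n IH] b //; rewrite iterS IH. Qed.

Lemma iter_transport_weighted n b :
  iter n.+1 transport b = alpha (iter n (weighted alpha a) (a *b b)).
Proof. by elim: n b => [|n IH] b //; rewrite iterS IH. Qed.

Lemma weighted_growth q : rate < q -> exists C : R, forall n (b : contFun X D),
  rnorm (iter n (weighted alpha a) b) <= C * q ^+ n * rnorm b.
Proof.
move=> rq; have q0 : 0 < q.
  exact: le_lt_trans rate_ge0 rq.
have [C pC] : exists C, forall n, uniform_norm n <= C * q ^+ n.
  exact: (growth_rate_ubound uniform_norm0 uniform_norm_ge0 uniform_normD).
have C0 : 0 <= C.
  by have := pC 0%N; rewrite expr0 mulr1; exact: le_trans (uniform_norm_ge0 _).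
have D0 : 0 <= sup_norm a * C / q by rewrite divr_ge0 ?mulr_ge0 ?sup_norm_ge0// ltW.
(* The iterate of order [n + 1] involves only [n] transports, hence the division by [q]; the summand
   [1] takes care of order zero. *)
exists (1 + sup_norm a * C / q) => -[|n] b.
  by rewrite expr0 mulr1 mulrDl mul1r lerDl mulr_ge0// rnorm_ge0.
rewrite iter_weighted; apply: le_trans (sup_norm_amul _ _) _.
apply: (@le_trans _ _ (sup_norm a * (C * q ^+ n * sup_norm b))).
  apply: ler_wpM2l; first exact: sup_norm_ge0.
  apply: le_trans (sup_norm_iter_transport _ _) _.
  apply: ler_pM; [exact: uniform_norm_ge0|exact: sup_norm_ge0|exact: pC|].
  exact: alpha_contractive.
rewrite rnorm_contFunE !mulrA; apply: ler_wpM2r; first exact: sup_norm_ge0.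
rewrite exprS mulrA; apply: ler_wpM2r; first by rewrite exprn_ge0// ltW.
by rewrite mulrDl divfK ?gt_eqF// lerDr mul1r ltW.
Qed.

(** A decay by one half at time [n] would compound to [2 ^ - k] at time [n k]. The lower bound
    [rate ^ j <= uniform_norm j] then gives [rate * 2 ^ k <= sup_norm a] for every [k]. *)
Lemma weighted_not_decay : 0 < rate ->
  ~ (exists2 n, (0 < n)%N & forall b : contFun X D,
       rnorm (iter n (weighted alpha a) b) <= rate ^+ n / 2 * rnorm b).
Proof.
move=> r0 [n n0 Tn].
have Tnk k (b : contFun X D) :
    sup_norm (iter (n * k) (weighted alpha a) b) <= (rate ^+ n / 2) ^+ k * sup_norm b.
  elim: k => [|k IH]; first by rewrite muln0 expr0 mul1r.
  rewrite mulnS iterD; apply: le_trans (Tn _) _; rewrite exprS -[leRHS]mulrA.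
  by apply: ler_wpM2l => //; rewrite divr_ge0 ?exprn_ge0// ltW.
have h k : rate * 2 ^+ k <= sup_norm a.
  have h1 : uniform_norm (n * k).+1 <= (rate ^+ n / 2) ^+ k * sup_norm a.
    rewrite /uniform_norm iter_transport_weighted; apply: le_trans (alpha_contractive _) _.
    by rewrite amul1r; exact: Tnk.
  have h2 : rate ^+ (n * k).+1 <= uniform_norm (n * k).+1.
    exact: growth_rate_lbound uniform_norm0 uniform_norm_ge0 uniform_normD _.
  have := le_trans h2 h1; rewrite exprS exprM expr_div_n.
  have e0 : 0 < (rate ^+ n) ^+ k by rewrite !exprn_gt0.
  by rewrite mulrC -!mulrA ler_pM2l// mulrC ler_pdivlMr ?exprn_gt0// .
have [|k] := @geometric_small R (sup_norm a) (1 / 2) (rate / 2) _ (divr_gt0 r0 (ltr0n _ 2)).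
  by apply/andP; split; lra.
move=> /(_ k (leqnn k)); rewrite expr_div_n expr1n mulrA mulr1.
rewrite ler_pdivrMr ?exprn_gt0//; have := h k.
have : 0 < rate * 2 ^+ k by rewrite mulr_gt0 ?exprn_gt0.
lra.
Qed.

Lemma lne_spectral_radius_weighted :
  lne (spectral_radius (weighted alpha a)) = lne rate%:E.
Proof.
have cE : geometrically_complete (contFun X D).
  exact/contFun_geometrically_complete/complete_geometrically_complete.
(* For [rate = 0] an upper bound is enough, since [lne] sends every nonpositive value to [-oo]. *)
have [r0|r0] := eqVneq rate 0.
  rewrite r0 (le0_lneNy (lexx _)); apply: le0_lneNy; apply: ge_ereal_sup => _ [z Tz <-].
  rewrite lee_fin -r0.
  exact: (spectrum_le cE weighted_linear weighted_bounded rate_ge0 weighted_growth).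
have rp : 0 < rate by rewrite lt_def r0 rate_ge0.
congr lne; apply: (spectral_radius_growth cE weighted_linear weighted_bounded) => //.
- exact: rate_ge0.
- exact: weighted_growth.
- exact: weighted_not_decay.
Qed.

Lemma local_norm_small e : 0 < rate -> 0 < e ->
  exists C, forall n x, local_norm n x <= expR (C + n%:R * (ln rate + e)).
Proof.
move=> r0 e0; have [|C pC] := growth_rate_gt0_ubound uniform_norm0 uniform_norm_ge0
  uniform_normD _ e0; first exact: r0.
by exists C => n x; apply: le_trans (local_norm_le _ _) (pC n).
Qed.

Lemma exp_growth_le_rate (u : nat -> \bar R) x :
  (forall n, (u n <= (local_norm n x)%:E)%E) -> (exp_growth u <= lne rate%:E)%E.
Proof.
move=> ux; have [r0|r0] := eqVneq rate 0.
  rewrite r0 le0_lneNy// exp_growth_lneNy// => l.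
  have [C pC] := growth_rate0_ubound uniform_norm0 uniform_norm_ge0 uniform_normD l r0.
  exists C => n; apply: le_trans (ux n) _; rewrite lee_fin.
  exact: le_trans (local_norm_le _ _) (pC n).
have rp : 0 < rate by rewrite lt_def r0 rate_ge0.
rewrite lne_EFin//; apply: exp_growth_le => e /(local_norm_small rp)[C HC].
by exists C => n; apply: le_trans (ux n) _; rewrite lee_fin.
Qed.

Notation Delta_oo := (essential_domain phi Delta).

Lemma exp_growth_fwd_cocycle_le x : Delta_oo x ->
  (exp_growth (fun n => op_norm (fwd_cocycle cocycle phi x n)) <= lne rate%:E)%E.
Proof.
move=> Yx; apply: (exp_growth_le_rate (x := x)) => n.
by rewrite op_norm_fwd_cocycle//; exact: essential_domain_sub Yx.
Qed.

Definition visible x := forall e, 0 < e ->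
  exists C, forall n, expR (n%:R * (ln rate - e) - C) <= local_norm n x.

Lemma exp_growth_fwd_cocycle_ge x : 0 < rate -> Delta_oo x -> visible x ->
  exp_growth (fun n => op_norm (fwd_cocycle cocycle phi x n)) = lne rate%:E.
Proof.
move=> r0 Yx vx; apply/eqP; rewrite eq_le; apply/andP; split.
  exact: exp_growth_fwd_cocycle_le.
rewrite lne_EFin//; apply: exp_growth_ge => e /vx[C HC]; exists C => n.
by rewrite op_norm_fwd_cocycle ?lee_fin//; exact: essential_domain_sub Yx.
Qed.

Lemma exists_visible_measure : 0 < rate ->
  exists2 mu : probability (borelType X) R, Erg Delta_oo phi mu &
    {ae mu, forall x : borelType X, visible x}.
Proof.
move=> r0; have rn n : 0 < rate ^+ n by rewrite exprn_gt0.
have rE n (t : R) : expR (n%:R * (ln rate + t)) = rate ^+ n * expR (n%:R * t).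
  by rewrite mulrDr expRD expRM_natl lnK.
have [phic _ _] := alpha_phi.
have [] := @exists_maximal_ergodic R X phi Delta fiber_support_open fiber_support_closed
  phic (fun n x => local_norm n x / rate ^+ n).
- move=> n x; apply: cvgM; [exact: local_norm_continuous|exact: cvg_cst].
- by move=> x; rewrite local_norm0 expr0 divr1.
- move=> n m x; rewrite mulrACA -invfM -exprD ler_pM2r ?invr_gt0//.
  exact: local_normD.
- by move=> n x; rewrite pmulr_lgt0 ?invr_gt0//; exact: local_norm_dom.
- by move=> n x; rewrite divr_ge0 ?local_norm_ge0// ltW.
(* [P_large]: after division by [rate ^ n] the maximum over [X] is at least one, by
   [growth_rate_lbound]. *)
- move=> n; have [x xn] := sup_norm_attained (iter n transport one); exists x.
  rewrite ler_pdivlMr// mul1r /local_norm xn.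
  exact: (growth_rate_lbound uniform_norm0 uniform_norm_ge0 uniform_normD).
- move=> e /(local_norm_small r0)[C HC]; exists C => n x.
  by rewrite ler_pdivrMr//; apply: le_trans (HC n x) _; rewrite !expRD rE; lra.
move=> mu Emu vmu; exists mu => //; apply: filterS vmu => x vx e e0.
have [j je] : exists j, j.+1%:R^-1 <= e.
  have := near_natV_small 1 e0 => -[N _ HN]; exists N.
  have [_ h] := HN N.+1 (leqnSn N).
  by rewrite -[_^-1]mul1r ler_pdivrMr// mulrC.
have [k Hk] := vx j.
have k0 : 0 < k%:R :> R.
  rewrite lt_def ler0n andbT; apply/eqP => k0.
  by have := lt_le_trans (expR_gt0 _) (Hk 0%N); rewrite k0 [_ * _]mul0r ltxx.
exists (ln k%:R) => n; rewrite expRD expRN lnK// ler_pdivrMr// rE -ler_pdivlMl//.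
apply: (@le_trans _ _ (expR (n%:R * - j.+1%:R^-1))).
  by rewrite ler_expR ler_wpM2l// lerN2.
by apply: le_trans (Hk n) _; rewrite mulrC -mulrA mulrC; lra.
Qed.

Lemma cocycle_linear n x : linear (fwd_cocycle cocycle phi x n).
Proof.
elim: n x => [//|n IH] x k u v /=; rewrite IH /lmul amulDr amulZr /fiber.
set u' := _ *b _; set v' := _ *b _.
have -> : cst (k *: u' + v') = k *: cst u' + cst v' by exact: contFunP.
by rewrite alpha_linear.
Qed.

Lemma dual_sphere_le (v : D -> R[i]^o) d : dual_sphere D v -> cabs (v d) <= rnorm d.
Proof.
move=> [[vl _] v1]; apply/ler_addgt0Pr => e e0.
have B0 : 0 < rnorm d + e by rewrite ltr_wpDl// rnorm_ge0.
have vZ (k : R) w : v (k%:C *: w) = k%:C *: v w by exact: (linear_funZ vl).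
have := op_norm_ge_ratio (T := v) (v := d) vZ B0; rewrite lerDl ltW// => /(_ isT).
by rewrite v1 lee_fin ler_pdivrMr// mul1r.
Qed.

Lemma exp_growth_functional_le x (v : D -> R[i]^o) : Delta_oo x -> dual_sphere D v ->
  (exp_growth (fun n => op_norm (v \o fwd_cocycle cocycle phi x n)) <= lne rate%:E)%E.
Proof.
move=> Yx vS; apply: (exp_growth_le_rate (x := x)) => n.
apply: op_norm_le; first exact: local_norm_ge0.
move=> d; apply: le_trans (dual_sphere_le _ vS) _.
have := iter_transport_le n (cst d) x.
by rewrite iter_transportE//; exact: essential_domain_sub Yx.
Qed.

Lemma uniform_norm_le_expR : exists m : R, forall n, uniform_norm n <= expR (n%:R * m).
Proof.
have p1 : 0 < uniform_norm 1 + 1 by rewrite ltr_wpDl// uniform_norm_ge0.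
exists (ln (uniform_norm 1 + 1)) => n; rewrite expRM_natl lnK//.
have := submultiplicativeX uniform_norm0 uniform_norm_ge0 uniform_normD 1 n.
rewrite mul1n => /le_trans; apply.
by apply: lerXn2r; rewrite ?nnegrE ?(ltW p1) ?uniform_norm_ge0// lerDl.
Qed.

(* The hump is large only at the square times. From a time [n] the next square
   is at distance [O(sqrt n)], so that the factor needed to reach it does not
   affect the exponent. *)
Lemma exists_functional x : 0 < rate -> Delta_oo x -> visible x ->
  exists2 v, dual_sphere D v &
    exp_growth (fun n => op_norm (v \o fwd_cocycle cocycle phi x n)) = lne rate%:E.
Proof.
move=> r0 Yx vx.
have [L [lL L1 Lw]] := gliding_hump (fun k => iter (k * k) transport one x).
pose u := complexify L.
have ul : linear u := complexify_linear lL.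
have u1 d : cabs (u d) <= rnorm d := complexify_le d lL L1.
have Lu d : `|L d| <= cabs (u d) := cabs_Re (u d).
have ou1 : (op_norm u <= 1)%E by apply: op_norm_le => // d; rewrite mul1r; exact: u1.
(* The vector of index [0] is the unit of [D], and its hump weight is [3 ^ - 1 / 2]. So [u] is not
   zero and can be put on the unit sphere; as its norm is at most one, this does not reduce its
   values. *)
have ou0 : ((1 / 6)%:E <= op_norm u)%E.
  have one1 : rnorm (one x) <= 1 by rewrite rnorm_aone.
  apply: le_trans (@op_norm_ge _ _ _ u _ one1); rewrite lee_fin.
  apply: le_trans (Lu _); apply: le_trans (Lw 0%N); rewrite /= rnorm_aone; lra.
have [t ut] : exists t : R, op_norm u = t%:E.
  by move: ou1 ou0; case: (op_norm u) => // t; exists t.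
move: ou0 ou1; rewrite ut !lee_fin => t0 t1.
have tp : 0 < t by lra.
have ti0 : 0 < t^-1 by rewrite invr_gt0.
pose v (d : D) : R[i]^o := t^-1%:C *: u d.
have vl : linear v by move=> k d e; rewrite /v ul scalerDr !scalerA mulrC.
have vS : dual_sphere D v.
  split; last by rewrite /v op_normZ// ut -EFinM mulVf ?gt_eqF.
  split=> //; exists t^-1 => d; rewrite /v rnormZc cabs_real gtr0_norm//.
  by rewrite ler_pM2l//; exact: u1.
exists v => //; apply/eqP; rewrite eq_le; apply/andP; split; first exact: exp_growth_functional_le.
rewrite lne_EFin//.
have [m Hm] := uniform_norm_le_expR.
(* The loss for each unit of [k]: [ln 3] from the hump weight, and [2 |m|] from the [i <= 2 k] steps
   that lead to the next square. *)
apply: (sparse_growth_ge (m := ln 3 + 2 * `|m|)) => e /vx[C HC].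
exists (C + ln 3 + ln 2) => n k i nk ik.
have Dx : iter_dom phi Delta n x by exact: essential_domain_sub Yx.
(* The cocycle at time [n] sends [d] to the vector of time [k ^ 2] detected by [v], so the norm at
   time [n] is at least the value of [v] there divided by the bound on [d]. *)
pose d := iter i transport one (iter n phi x).
have wE : fwd_cocycle cocycle phi x n d = iter (k * k) transport one x.
  by rewrite -nk iterD iter_transportE.
have dm : rnorm d <= expR (i%:R * m) by apply: le_trans (local_norm_le _ _) (Hm i).
have vnl : forall (z : R) w, (v \o fwd_cocycle cocycle phi x n) (z%:C *: w) =
    z%:C *: (v \o fwd_cocycle cocycle phi x n) w.
  by move=> z w /=; rewrite (linear_funZ (@cocycle_linear n x)) (linear_funZ vl).
apply: le_trans (op_norm_ge_ratio vnl (expR_gt0 _) dm); rewrite lee_fin ler_pdivlMr ?expR_gt0//.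
rewrite /= wE.
have vw : 3^-1 ^+ k.+1 / 2 * local_norm (k * k) x <= rnorm (v (iter (k * k) transport one x)).
  apply: le_trans (Lw k) _; apply: le_trans (Lu _) _.
  rewrite /v rnormZc cabs_real gtr0_norm// -[leLHS]mul1r.
  by apply: ler_wpM2r; [exact: cabs_ge0|rewrite invf_ge1].
apply: le_trans vw.
have e3 : 3^-1 ^+ k.+1 / 2 = expR (- (k.+1%:R * ln 3 + ln 2)) :> R.
  by rewrite expRN expRD expRM_natl !lnK ?posrE// invfM exprVn.
apply: (@le_trans _ _ (expR (- (k.+1%:R * ln 3 + ln 2)) *
    expR ((k * k)%:R * (ln rate - e) - C))); last first.
  by rewrite e3; apply: ler_wpM2l; [exact: expR_ge0|exact: HC].
rewrite -!expRD ler_expR.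
have ik' : i%:R <= 2 * k%:R :> R by rewrite -natrM ler_nat.
have h1 : i%:R * m <= i%:R * `|m| by rewrite ler_wpM2l// ler_norm.
have h2 : i%:R * `|m| <= 2 * k%:R * `|m| by rewrite ler_wpM2r.
rewrite -[k.+1]addn1 natrD; lra.
Qed.

End WeightedEndomorphism.

Theorem theorem5p15 (R : realType) (X : compactHausdorffType)
    (D : banachAlgType R[i])
    (alpha : {linear contFun X D -> contFun X D}) (phi : X -> X)
    (a : contFun X D) (Omega : set X) :
  {morph alpha : b c / b *b c} ->
  (forall b, `|alpha b| <= `|b|) ->
  generates alpha phi ->
  let Delta_oo := essential_domain phi (fiber_support alpha) in
  Omega `<=` Delta_oo ->
  (forall mu : probability (borelType X) R, Erg Delta_oo phi mu ->
    (0 < mu_ext mu Omega)%E) ->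
  is_max
    [set measure_exponent Delta_oo
           (fun x => fiber alpha x \o lmul (a (phi x))) phi mu
       | mu in Erg Delta_oo phi]
    (lne (spectral_radius (weighted alpha a)))
  /\
  is_max
    [set exp_growth (fun n => op_norm (bwd_cocycle
           (fun x => adjoint (lmul (a (phi x))) \o adjoint (fiber alpha x))
           phi xv.1 n xv.2))
       | xv in Omega `*` dual_sphere D]
    (lne (spectral_radius (weighted alpha a))).
Proof.
move=> aM aC gen Delta_oo OY OE.
have aL : linear alpha := linearP alpha.
have aC' b : sup_norm (alpha b) <= sup_norm b by have := aC b; rewrite !normE lecR.
have [cphi _ _] := gen.
have mY : measurable (Delta_oo : set (borelType X)).
  apply: closed_measurable; apply: essential_domain_closed => //.
    exact: fiber_support_open aM gen.
  exact: fiber_support_closed aM gen.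
rewrite (lne_spectral_radius_weighted a aL aM aC').
have r_ge0 := rate_ge0 a aM aC'.
split.
- have ub mu : Erg Delta_oo phi mu -> (measure_exponent Delta_oo
      (fun x => fiber alpha x \o lmul (a (phi x))) phi mu <= lne (rate alpha a)%:E)%E.
    move=> [_ muY _ _]; apply: measure_exponent_le => // x Yx.
    exact: exp_growth_fwd_cocycle_le.
  (* When the rate is zero the upper bound [-oo] is attained by every measure; if there is none, the
     convention on the empty set applies. A positive rate provides a measure. *)
  have [r0|r0] := eqVneq (rate alpha a) 0.
    have lN : lne (rate alpha a)%:E = -oo%E by rewrite r0 le0_lneNy.
    have [->|/set0P[mu Emu]] :=
        eqVneq (Erg Delta_oo phi) (set0 : set (probability (borelType X) R)).
      by right; rewrite image_set0 lN.
    left; split; last by move=> _ [nu Enu <-]; exact: ub.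
    by exists mu => //; apply/eqP; rewrite eq_le (ub _ Emu) lN leNye.
  have rp : 0 < rate alpha a by rewrite lt_def r0.
  have [mu Emu vmu] := exists_visible_measure aM aC' gen rp.
  left; split; last by move=> _ [nu Enu <-]; exact: ub.
  exists mu => //; have [_ muY _ _] := Emu; apply: measure_exponentE => //.
  apply: (@filterS _ _ (ae_filter_ringOfSetsType mu) _ _ _ vmu) => x vx Yx.
  exact: exp_growth_fwd_cocycle_ge.
- have ub x v : Omega x -> dual_sphere D v -> (exp_growth (fun n => op_norm (bwd_cocycle
           (fun x => adjoint (lmul (a (phi x))) \o adjoint (fiber alpha x))
           phi x n v)) <= lne (rate alpha a)%:E)%E.
    move=> /OY Yx vS; under [X in exp_growth X]eq_fun do rewrite bwd_cocycle_adjoint.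
    exact: exp_growth_functional_le.
  (* The same dichotomy; here the index set may be empty because [Omega] is. *)
  have [r0|r0] := eqVneq (rate alpha a) 0.
    have lN : lne (rate alpha a)%:E = -oo%E by rewrite r0 le0_lneNy.
    have [->|/set0P[[x v] [/= Ox vS]]] := eqVneq (Omega `*` dual_sphere D) set0.
      by right; rewrite image_set0 lN.
    left; split; last by move=> _ [[y w] [/= Oy wS] <-]; exact: ub.
    exists (x, v); first by split.
    apply: etrans (esym lN); apply/eqP; rewrite -leeNy_eq -lN; exact: ub.
  have rp : 0 < rate alpha a by rewrite lt_def r0.
  have [mu Emu vmu] := exists_visible_measure aM aC' gen rp.
  have [x Ox vx] := ae_intersects vmu (OE mu Emu).
  have [v vS vE] := exists_functional aL aM aC' gen rp (OY _ Ox) vx.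
  left; split; last by move=> _ [[y w] [/= Oy wS] <-]; exact: ub.
  exists (x, v) => //; rewrite -vE.
  by under [X in exp_growth X = _]eq_fun do rewrite bwd_cocycle_adjoint.
Qed.
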